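(* Let $n\ge 1$, $s\in(0,1)$, let $K \subset \mathbb{R}^n$ be an unconditional strictly convex body and $M$ a minimizer of the anisotropic fractional isoperimetric inequality $$P_s(E,K) \ge \gamma_{n,s}(K)\,|E|^{\frac{n-s}{n}}, \qquad E \subset \mathbb{R}^n \text{ bounded Borel}.$$ Then the anisotropic rearrangement $f^M$ with respect to $M$ is well-defined, and $$\int_{\mathbb{R}^n}\int_{\mathbb{R}^n} \frac{|f(x)-f(y)|}{\|x-y\|_K^{n+s}}\,dy\,dx \ \ge\ \int_{\mathbb{R}^n}\int_{\mathbb{R}^n} \frac{|f^M(x)-f^M(y)|}{\|x-y\|_K^{n+s}}\,dy\,dx$$ for all $f\in L^1(\mathbb{R}^n)$.
   Context: $|E|$ denotes $n$-dimensional Lebesgue measure. A convex body is a compact convex subset of $\mathbb{R}^n$ with non-empty interior. A subset of $\mathbb{R}^n$ is unconditional if it is symmetric with respect to every coordinate hyperplane $\{x_i=0\}$, $i=1,\dots,n$. A convex body $K$ is strictly convex if $(1-\lambda)x+\lambda y \in \operatorname{int} K$ for all $x,y\in K$ with $x\ne y$ and all $0<\lambda<1$. For an origin-symmetric convex body $K$, $\|\cdot\|_K$ is the norm on $\mathbb{R}^n$ with closed unit ball $K$. For a Borel set $E \subseteq \mathbb{R}^n$ with complement $E^c$, the anisotropic fractional $s$-perimeter is $$P_s(E,K) := \int_E \int_{E^c} \frac{1}{\|x-y\|_K^{n+s}}\,dy\,dx .$$ The optimal constant is $\gamma_{n,s}(K) := \inf\{P_s(E,K)|E|^{-\frac{n-s}{n}}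 : E\subset\mathbb{R}^n \text{ bounded Borel}, |E|>0\}$, and a minimizer is a bounded Borel set with positive measure attaining this infimum. Two sets are equivalent if they differ by a set of measure $0$. A set $L\subseteq\mathbb{R}^n$ is star-shaped (with respect to the origin $o$) if for every $x\in L$ the segment $[o,x]$ lies in $L$. The radial function of a bounded star-shaped set $L$ is $\rho_L(x) := \sup\{\lambda\ge 0 : \lambda x\in L\}$, $x\in\mathbb{R}^n\setminus\{o\}$. A star body is a bounded star-shaped set that contains the origin in its interior and whose radial function is continuous. For a star body $L$ and a measurable set $E\subseteq\mathbb{R}^n$, the (anisotropic) symmetrization is $E^L := \mathbb{R}^n$ if $|E|=\infty$, and $E^L := rL$ if $|E|<\infty$, where $r\ge0$ is chosen such that $|rL|=|E|$. For a measurable $f:\mathbb{R}^n\to\mathbb{R}$ with $|\{|f|>\tau\}|<\infty$ for all $\tau>0$, the (anisotropic) symmetrization (rearrangement) of $f$ with respect to $L$ is $f^L(x) := \sup\{\tau>0 : x\in\{|f|>\tau\}^L\}$ (with $\sup\emptyset=0$). The rearrangement $f^M$ with respect to $M$ means $f^L$, where $L$ is an unconditional star body to which $M$ is equivalent up to translation; ''well-defined'' means that such an $L$ exists. *)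

(* Defs.v *)
From HB Require Import structures.
From mathcomp Require Import all_boot all_order all_algebra.
From mathcomp Require Import all_classical all_reals all_analysis.
From mathcomp Require Import measurable_realfun.

Set Implicit Arguments.
Unset Strict Implicit.
Unset Printing Implicit Defensive.

Import Order.TTheory GRing.Theory Num.Theory.
Import numFieldNormedType.Exports.

Local Open Scope classical_set_scope.
Local Open Scope ring_scope.

(* R^n is ['rV[R]_n]; its library norm is the sup norm, which induces the usual
   topology and the usual bounded sets. *)

Section lebesgue_measure_rV.
Variable R : realType.

Local Notation borelRV n := (g_sigma_algebraType (@open 'rV[R]_n)).

Definition consRV n (p : measurableTypeR R * borelRV n) : borelRV n.+1 :=
  row_mx (p.1%:M : 'rV[R]_1) (p.2 : 'rV[R]_n).

Definition unconsRV n (v : borelRV n.+1) : measurableTypeR R * borelRV n :=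
  ((v : 'rV[R]_n.+1) 0 0, rsubmx (v : 'rV[R]_(1 + n))).

Lemma consRV0 n (p : measurableTypeR R * borelRV n) :
  (consRV p : 'rV[R]_n.+1) 0 0 = p.1.
Proof.
rewrite /consRV mxE; case: splitP => [j|j]; first by rewrite !ord1 mxE eqxx.
by [].
Qed.

Lemma consRVS n (p : measurableTypeR R * borelRV n) j :
  (consRV p : 'rV[R]_(1 + n)) 0 (rshift 1 j) = (p.2 : 'rV[R]_n) 0 j.
Proof. by rewrite /consRV row_mxEr. Qed.

Lemma consRVK n : cancel (@consRV n) (@unconsRV n).
Proof.
move=> [x v]; rewrite /unconsRV consRV0; congr (_, _).
by rewrite /consRV row_mxKr.
Qed.

Lemma ball_rat n (U : set 'rV[R]_n) (v : 'rV[R]_n) : open U -> U v ->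
  exists (w : 'rV[rat]_n) (k : nat),
    ball (map_mx ratr w : 'rV[R]_n) k.+1%:R^-1 v /\
    ball (map_mx ratr w : 'rV[R]_n) k.+1%:R^-1 `<=` U.
Proof.
move=> oU Uv.
have /nbhs_ballP[e /= e0 eU] : nbhs v U by exact: open_nbhs_nbhs.
have [k ke] : exists k : nat, k.+1%:R^-1 < e / 2.
  have e2 : 0 < e / 2 by rewrite divr_gt0.
  exists (Num.truncn (e / 2)^-1); rewrite invf_plt ?posrE//.
  exact: truncnS_gt.
have k0 : 0 < k.+1%:R^-1 :> R by rewrite invr_gt0.
have h i : exists q : rat, ball (v 0 i) k.+1%:R^-1 (ratr q).
  have [x [bx [q _ qx]]] : ball (v 0 i) k.+1%:R^-1 `&` (ratr @` setT) !=set0.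
    apply: dense_rat; last exact: ball_open.
    by exists (v 0 i); exact: ballxx.
  by exists q; rewrite qx.
have /choice[q hq] := h.
exists (\row_i q i), k; split.
  split => // i j; rewrite !mxE ord1.
  exact/ball_sym/hq.
move=> u bu; apply: eU.
have bv : ball v k.+1%:R^-1 (map_mx ratr (\row_i q i) : 'rV[R]_n).
  by split=> // i j; rewrite !mxE ord1; exact: hq.
apply: (@le_ball _ _ v (k.+1%:R^-1 + k.+1%:R^-1)).
  by rewrite [leRHS]splitr lerD// ltW.
exact: ball_triangle bv bu.
Qed.

Lemma measurable_ball_rV n (v : 'rV[R]_n) e :
  (@measurable _ (borelRV n)) (ball v e).
Proof. by apply: sub_sigma_algebra; exact: ball_open. Qed.

Lemma measurable_consRV n : measurable_fun setT (@consRV n).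
Proof.
apply: (measurability (f := @consRV n) (D := setT) (@open 'rV[R]_n.+1)
  (erefl : @measurable _ (borelRV n.+1) = <<s open >>)).
move=> _ [U oU <-]; rewrite setTI.
pose B (a : 'rV[rat]_n.+1 * nat) : set 'rV[R]_n.+1 :=
  ball (map_mx ratr a.1 : 'rV[R]_n.+1) a.2.+1%:R^-1.
pose D : set ('rV[rat]_n.+1 * nat) := [set a | B a `<=` U].
have -> : @consRV n @^-1` U = \bigcup_a
    (if `[< D a >] then @consRV n @^-1` B a else set0).
  apply/seteqP; split => [p Up|p [a _]].
    have [w [k [wk1 wk2]]] := ball_rat oU Up.
    exists (w, k) => //; rewrite ifT//; exact/asboolP.
  by case: ifPn => // /asboolP Da; exact: Da.
apply: countable_bigcupT_measurable => [|a]; first exact: countableP.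
case: ifPn => // _.
pose c := map_mx ratr a.1 : 'rV[R]_n.+1.
rewrite (_ : _ @^-1` _ = (ball (c 0 0) a.2.+1%:R^-1 : set R) `*`
    (ball (rsubmx (c : 'rV[R]_(1 + n))) a.2.+1%:R^-1)); last first.
  rewrite /B -/c; apply/seteqP; split => [[x v] [e0 /= h]|[x v] [/= h0 [e0 h]]].
    split => /=.
      by have := h 0 0; rewrite consRV0.
    split=> // i j; rewrite mxE ord1.
    by have := h 0 (rshift 1 j); rewrite consRVS.
  split=> // i j; rewrite ord1.
  case: (@split_ordP 1 n j) => [k -> | k ->].
    have -> : lshift n k = 0 by rewrite ord1; exact: val_inj.
    by rewrite consRV0.
  by rewrite consRVS; have := h 0 k; rewrite mxE.
apply: measurableX; last exact: measurable_ball_rV.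
exact: measurable_ball.
Qed.

Lemma measurable_unconsRV n : measurable_fun setT (@unconsRV n).
Proof.
apply: measurable_fun_pair.
  apply: (measurability _ (RGenOpens.measurableE R)) => _ [_ [a [b ->]] <-].
  rewrite setTI; apply: sub_sigma_algebra.
  apply: open_comp; last exact: interval_open.
  by move=> /= x _; exact: coord_continuous.
apply: (measurability (f := snd \o @unconsRV n) (D := setT) (@open 'rV[R]_n)
  (erefl : @measurable _ (borelRV n) = <<s open >>)) => _ [U oU <-].
rewrite setTI; apply: sub_sigma_algebra.
apply: open_comp => //= x _.
exact: (@continuous_rsubmx R 1 1 n).
Qed.

Definition lebesgue_step n
    (m : {sigma_finite_measure set (borelRV n) -> \bar R}) :
    set (borelRV n.+1) -> \bar R :=
  pushforward ((@lebesgue_measure R : set (measurableTypeR R) -> _) \x m)%E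
    (@consRV n).

Section step.
Variables (n : nat) (m : {sigma_finite_measure set (borelRV n) -> \bar R}).

HB.instance Definition _ := Measure.copy (lebesgue_step m)
  (measure_function_pushforward__canonical__measure_function_Measure
    _ (measurable_consRV (n := n))).

Lemma sigma_finite_lebesgue_step : sigma_finite setT (lebesgue_step m).
Proof.
have /sigma_finiteP[F [FT ndF Foo]] := sigma_finiteT
  (@lebesgue_measure R : {sigma_finite_measure set _ -> \bar R}).
have /sigma_finiteP[G [GT ndG Goo]] := sigma_finiteT m.
exists (fun k => @unconsRV n @^-1` (F k `*` G k)).
  rewrite predeqE => v; split=> // _.
  have [i _ Fi] : (\bigcup_k F k) (unconsRV v).1 by rewrite -FT.
  have [j _ Gj] : (\bigcup_k G k) (unconsRV v).2 by rewrite -GT.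
  exists (maxn i j) => //; split => /=.
    by move: Fi; exact/subsetPset/ndF/leq_maxl.
  by move: Gj; exact/subsetPset/ndG/leq_maxr.
move=> k; have [mF Fk] := Foo k; have [mG Gk] := Goo k; split.
  rewrite -[X in measurable X]setTI.
  by apply: measurable_unconsRV => //; exact: measurableX.
rewrite /lebesgue_step /pushforward -comp_preimage.
rewrite (_ : _ \o _ = id) ?preimage_id; last first.
  by apply/funext => p; exact: consRVK.
by rewrite product_measure1E// lte_mul_pinfty// ge0_fin_numE.
Qed.

HB.instance Definition _ := Measure_isSigmaFinite.Build _ _ _
  (lebesgue_step m) sigma_finite_lebesgue_step.

End step.

Fixpoint borel_lebesgue n : {sigma_finite_measure set (borelRV n) -> \bar R} :=
  if n is k.+1 then lebesgue_step (borel_lebesgue k)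
  else dirac ((0 : 'rV[R]_0) : borelRV 0).

Lemma measurable_boxRV n (A : 'I_n -> set (measurableTypeR R)) :
  (forall i, measurable (A i)) ->
  (@measurable _ (borelRV n)) [set v | forall i, A i ((v : 'rV[R]_n) 0 i)].
Proof.
elim: n A => [|n ih] A mA.
  by rewrite (_ : [set _ | _] = setT)//; apply/seteqP; split=> // v _ [].
rewrite (_ : [set _ | _] = @unconsRV n @^-1` (A 0 `*`
    [set v | forall i, A (rshift 1 i) ((v : 'rV[R]_n) 0 i)])); last first.
  apply/seteqP; split => [v Av|v [/= A0 Av] i]; last first.
    case: (@split_ordP 1 n i) => [k -> | k ->]; last by have := Av k; rewrite mxE.
    by have -> : lshift n k = 0 by rewrite ord1; exact: val_inj.
  by split => /= [|i]; [exact: Av|rewrite mxE; exact: Av].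
rewrite -[X in measurable X]setTI.
apply: (@measurable_unconsRV n measurableT).
by apply: measurableX => //; exact: (ih (fun i => A (rshift 1 i))).
Qed.

Lemma borel_lebesgue_box n (A : 'I_n -> set (measurableTypeR R)) :
  (forall i, measurable (A i)) ->
  borel_lebesgue n [set v | forall i, A i ((v : 'rV[R]_n) 0 i)] =
  (\prod_(i < n) lebesgue_measure (A i))%E.
Proof.
elim: n A => [|n ih] A mA.
  by rewrite big_ord0 /= diracE mem_set// => -[].
rewrite big_ord_recl -ih// /= /lebesgue_step /pushforward.
rewrite -product_measure1E//; last first.
  exact: (@measurable_boxRV n (fun i => A (lift ord0 i))).
congr (_ _); apply/seteqP; split => [[x v] /= h|[x v] /= [A0 Av] i].
  split => [|i]; first by have := h 0; rewrite consRV0.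
  have := h (rshift 1 i); rewrite consRVS.
  by rewrite (_ : rshift 1 i = lift ord0 i)//; exact: val_inj.
case: (@split_ordP 1 n i) => [k -> | k ->].
  have -> : lshift n k = 0 by rewrite ord1; exact: val_inj.
  by rewrite consRV0.
rewrite consRVS; have := Av k.
by rewrite (_ : rshift 1 k = lift ord0 k)//; exact: val_inj.
Qed.

(* The completion of [borel_lebesgue]: the measurable sets of its domain are the
   Lebesgue measurable sets. *)
Definition lebesgueRV n :=
  @completed_measure_extension _ _ R (borel_lebesgue n).
Arguments lebesgueRV : clear implicits.

HB.instance Definition _ n := Measure.on (lebesgueRV n).

Lemma lebesgueRV_borel n (A : set (borelRV n)) : measurable A ->
  measurable (A : set (caratheodory_type (borel_lebesgue n)^*%mu)) /\
  lebesgueRV n A = borel_lebesgue n A.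
Proof.
move=> mA; split; first exact: caratheodory_measurable_mu_ext.
exact: measurable_mu_extE.
Qed.

End lebesgue_measure_rV.
Arguments lebesgueRV : clear implicits.

Section anisotropic.
Variables (R : realType) (n : nat).
Local Notation V := 'rV[R]_n.
Local Notation vol := (lebesgueRV R n).
Implicit Types (A E K L M : set V) (x y : V) (r s t : R).

Definition borel_set A := <<s @open V >> A.

Definition reflection (i : 'I_n) x : V :=
  \row_j (if j == i then - x 0 j else x 0 j).

Definition unconditional A := forall i, reflection i @` A = A.

Definition convex_body K := [/\ compact K, convex_set K & K° !=set0].

Definition strictly_convex_body K := convex_body K /\
  forall x y t, K x -> K y -> x <> y -> 0 < t < 1 ->
    K° ((1 - t) *: x + t *: y).

Definition dilate r A : set V := [set r *: x | x in A].

Definition translate x A : set V := [set x + y | y in A].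

(* The norm with closed unit ball [K], when [K] is an origin-symmetric convex
   body. *)
Definition body_norm K x : R := inf [set r | 0 <= r /\ dilate r K x].

(* At [x = y], where the denominator vanishes, the kernel is [0^-1 = 0]; the
   diagonal is negligible. *)
Definition kernelK K s x y : R := (body_norm K (x - y) `^ (n%:R + s))^-1.

Definition perimeter s E K : \bar R :=
  (\int[vol]_(x in E) \int[vol]_(y in ~` E) (kernelK K s x y)%:E)%E.

Definition admissible E := [/\ bounded_set E, borel_set E & (0 < vol E)%E].

Definition isoperimetric_ratio s K E : \bar R :=
  (perimeter s E K * poweR (vol E) (- ((n%:R - s) / n%:R)))%E.

Definition isoperimetric_constant s K : \bar R :=
  ereal_inf [set isoperimetric_ratio s K E | E in admissible].

Definition minimizer s K M :=
  admissible M /\ isoperimetric_ratio s K M = isoperimetric_constant s K.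

Definition equivalent A E := vol (A `+` E) = 0%E.

Definition star_shaped L := forall x t, L x -> 0 <= t <= 1 -> L (t *: x).

Definition radial L x : R := sup [set r | 0 <= r /\ L (r *: x)].

Definition star_body L := [/\ bounded_set L, star_shaped L, L° 0 &
  {within [set x | x != 0], continuous (radial L)}].

Definition symmetrization L E : set V :=
  if vol E == +oo%E then setT
  else dilate (xget 0 [set r | 0 <= r /\ vol (dilate r L) = vol E]) L.

(* Extended-valued, because the supremum is always [+oo] at the origin. Adding
   the value 0 encodes the convention on the supremum of the empty set. *)
Definition rearrangement L (f : V -> R) x : \bar R :=
  ereal_sup (0%E |` [set t%:E | t in
    [set t | 0 < t /\ symmetrization L [set y | t < `|f y|] x]]).

Definition fractional_seminorm s K (f : V -> \bar R) : \bar R :=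
  (\int[vol]_x \int[vol]_y (`|f x - f y| * (kernelK K s x y)%:E))%E.

(* [L] is a set for which the rearrangement [f^M] is by definition [f^L]. *)
Definition rearranging_body M L := [/\ unconditional L, star_body L &
  exists x, equivalent M (translate x L)].

End anisotropic.

(* Main.v *)
Require Import Defs.
From HB Require Import structures.
From mathcomp Require Import all_boot all_order all_algebra.
From mathcomp Require Import all_classical all_reals all_analysis.
From mathcomp Require Import measurable_realfun ring lra.

Set Implicit Arguments.
Unset Strict Implicit.
Unset Printing Implicit Defensive.

Import Order.TTheory GRing.Theory Num.Theory.
Import numFieldNormedType.Exports.

Local Open Scope classical_set_scope.
Local Open Scope ring_scope.

(** The existence part rests on polarization, that is, two-point symmetrization
    in a hyperplane {x_i = c}. Since K is unconditional, the kernel is invariant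
    under this reflection; since K is strictly convex, the norm is strictly
    increasing in each |x_i|, so two distinct points on the same side of the
    hyperplane interact strictly more than one of them and the mirror image of
    the other. Hence polarization preserves the volume of a set E and does not
    increase its perimeter, and the loss is at least an integral of a positive
    function over the product of two sets: the points of the half-space H that
    lie in E while their mirror images do not ([pol_kept]), and those whose
    mirror images lie in E while they do not ([pol_moved]). For a minimizer M
    one of the two is therefore null ([refl_dichotomy]); comparing first moments
    tells which one, according to the position of c relative to the i-th
    coordinate of the barycentre of M ([refl_centre]). After a translation N of
    M centring it at the origin, a reflection in a hyperplane {x_i = d} keeps in
    N almost every point of N whose |x_i| it decreases. Composing such
    reflections in all coordinates gives the point reflections x -> u - x;
    Tonelli's theorem, applied to the pairs (x, u) with |u_i - x_i| < |x_i| for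
    all i, shows that, for almost every x in N, the box of all y with |y_i| <
    |x_i| lies in N up to a null set ([ae_box_null]). The union [boxcore] of all
    boxes contained in N up to null sets is open, unconditional and star-shaped;
    membership in it is monotone in every |x_i|, which makes its radial function
    continuous. It differs from N by a null set: the inclusion in one direction
    is a countable union over rational boxes, in the other a comparison of
    volumes under dilations by factors tending to 1.

    For the inequality, the coarea formula ([coarea]) writes the double integral
    of a function as twice the integral over t of the perimeters of its
    superlevel sets {t < g}, and passing from f to |f| does not increase the
    double integral. The superlevel sets of the rearrangement agree, up to null
    sets, with dilates of the body L having the same volumes as the superlevel
    sets of |f| ([vol_rearr_level], [rearr_level_null]). As L has the volume and
    the perimeter of M, and the perimeter is homogeneous of degree n - s under
    dilations, these dilates attain equality in the isoperimetric inequality,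
    and the perimeters compare level by level.

    The superlevel sets of |f| need not be bounded or Borel, so the inequality
    that defines M has to be extended to all measurable sets of finite volume
    ([isoperimetric]). Such a set is cut off by a large cube; averaging over the
    side length of the cube yields one for which the cut adds little perimeter
    ([exists_cut], [truncate_perimeter]). The same averaging gives a cube of
    finite perimeter, so that M has finite perimeter. Both use that the kernel
    times min(1, |z|) is integrable ([integral_kern1_lty]), because 0 < s < 1. *)

(** * Lebesgue measure under diagonal affine maps *)

Notation borelRV R n := (g_sigma_algebraType (@open 'rV[R]_n)).
(** The type of points with the Lebesgue measurable sets as measurable sets; the
    sets of [borelRV R n] are the Borel sets. *)
Notation leb R n := (caratheodory_type (borel_lebesgue R n)^*%mu).

HB.instance Definition _ (R : realType) n :=
  Measure_isSigmaFinite.Build _ _ _ (lebesgueRV R n)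
   (completed_measure_extension_sigma_finite (sigma_finiteT (borel_lebesgue R n))).

(** The pushforward packaged as a measure, so that uniqueness theorems for
    measures apply to it. *)
Definition push d1 d2 (T1 : measurableType d1) (T2 : measurableType d2) (R : realType)
    (m : {measure set T1 -> \bar R}) (f : T1 -> T2) (mf : measurable_fun setT f) :
  {measure set T2 -> \bar R} :=
  measure_function_pushforward__canonical__measure_function_Measure m mf.

Section diagonal_affine.
Variable R : realType.

Lemma measurable_affine (a b : R) :
  measurable_fun setT (fun x : measurableTypeR R => a * x + b : measurableTypeR R).
Proof.
by apply: measurable_funD => //; apply: measurable_funM.
Qed.

(** Both sides are measures in the set [A], up to the factor; they agree on
    intervals, hence everywhere. *)
Lemma lebesgue_measure_affine (a b : R) (A : set (measurableTypeR R)) :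
  a != 0 -> measurable A ->
  lebesgue_measure ((fun x => a * x + b) @^-1` A) = (`|a|^-1%:E * lebesgue_measure A)%E.
Proof.
move=> a0 mA.
have aN0 : `|a| != 0 by rewrite normr_eq0.
pose phi := (fun x => a * x + b) : measurableTypeR R -> measurableTypeR R.
have mphi : measurable_fun setT phi by exact: measurable_affine.
pose m := mscale (NngNum (normr_ge0 a)) (push (@lebesgue_measure R) mphi).
have mE B : m B = (`|a|%:E * lebesgue_measure (phi @^-1` B))%E by [].
have -> : lebesgue_measure A = m A.
  apply: lebesgue_measure_unique => // _ [[x y] _ <-].
  rewrite [RHS]mE.
  have [a_gt0|a_lt0|] := ltgtP 0 a; last by move=> a00; rewrite -a00 eqxx in a0.
  - rewrite (_ : _ @^-1` _ = `](x - b) / a, (y - b) / a]%classic); last first.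
      apply/seteqP; split => z; rewrite /= !in_itv/= ltr_pdivrMr// ler_pdivlMr//;
        by rewrite ltrBlDr lerBrDr mulrC.
    rewrite !lebesgue_measure_itv /= !lte_fin ltr_pM2r ?invr_gt0// ltrD2r.
    case: ifPn => _; last by rewrite mule0.
    rewrite -!EFinB -EFinM; congr (_%:E).
    by rewrite -mulrBl gtr0_norm // mulrC divfK ?gt_eqF//; ring.
  - rewrite (_ : _ @^-1` _ = `[(y - b) / a, (x - b) / a[%classic); last first.
      apply/seteqP; split => z; rewrite /= !in_itv/= ler_ndivrMr// ltr_ndivlMr//;
        by rewrite ltrBlDr lerBrDr mulrC andbC.
    rewrite !lebesgue_measure_itv /= !lte_fin ltr_nM2r ?invr_lt0// ltrD2r.
    case: ifPn => _; last by rewrite mule0.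
    rewrite -!EFinB -EFinM; congr (_%:E).
    by rewrite -mulrBl ltr0_norm // mulNr mulrC divfK ?lt_eqF//; ring.
by rewrite mE muleA -EFinM mulVf// mul1e.
Qed.

(** Reflections, translations and dilations are all of this form, so that one
    change of variables formula serves for all of them. *)
Definition daff n (a b : 'rV[R]_n) (x : 'rV[R]_n) : 'rV[R]_n :=
  \row_i (a 0 i * x 0 i + b 0 i).

Lemma continuous_daff n (a b : 'rV[R]_n) : continuous (daff a b).
Proof.
move=> x P [Q Qn QP].
exists (fun i j => (fun t => a 0 j * t + b 0 j) @^-1` Q i j) => [i j|y h].
  have := Qn i j; rewrite !mxE !ord1.
  suff : {for x 0 j, continuous (fun t => a 0 j * t + b 0 j)} by apply.
  apply: cvgD; last exact: cvg_cst.
  by apply: cvgM; [exact: cvg_cst|exact: cvg_id].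
by apply: QP => i j; rewrite !mxE; have := h i j; rewrite ord1.
Qed.

Lemma measurable_borel_daff n (a b : 'rV[R]_n) :
  measurable_fun setT (daff a b : borelRV R n -> borelRV R n).
Proof.
apply: (measurability (f := daff a b : borelRV R n -> borelRV R n) (D := setT) (@open 'rV[R]_n)
  (erefl : @measurable _ (borelRV R n) = <<s open >>)) => _ [U oU <-].
rewrite setTI; apply: sub_sigma_algebra.
by apply: open_comp => //= x _; exact: continuous_daff.
Qed.

Lemma daff_cons n (a b : 'rV[R]_n.+1) (p : measurableTypeR R * borelRV R n) :
  daff a b (consRV p) = consRV (a 0 0 * p.1 + b 0 0,
    daff (rsubmx (a : 'rV[R]_(1 + n))) (rsubmx (b : 'rV[R]_(1 + n))) p.2).
Proof.
apply/rowP => j; rewrite mxE.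
case: (@split_ordP 1 n j) => [k -> | k ->].
  have -> : lshift n k = 0 by rewrite ord1; exact: val_inj.
  by rewrite !consRV0.
by rewrite !consRVS !mxE.
Qed.

(** By induction on the dimension, comparing the two measures on products of a
    set of first coordinates with a set of remaining coordinates. *)
Lemma borel_lebesgue_daff n (a b : 'rV[R]_n) (A : set (borelRV R n)) :
  (forall i, a 0 i != 0) -> measurable A ->
  borel_lebesgue R n (daff a b @^-1` A) =
  ((\prod_i `|a 0 i|)^-1%:E * borel_lebesgue R n A)%E.
Proof.
elim: n a b A => [|n ih] a b A a0 mA.
  rewrite big_ord0 invr1 mul1e; congr (borel_lebesgue _ _ _).
  by apply/seteqP; split=> x; rewrite /preimage/= [daff _ _ _](_ : _ = x)//; apply/rowP => -[].
pose a' := rsubmx (a : 'rV[R]_(1 + n)).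
pose b' := rsubmx (b : 'rV[R]_(1 + n)).
have a'0 i : a' 0 i != 0 by rewrite mxE.
have aa : \prod_i `|a 0 i| = `|a 0 0| * \prod_i `|a' 0 i|.
  rewrite big_ord_recl; congr (_ * _); apply: eq_bigr => i _; rewrite mxE.
  by congr (`| a 0 _ |); exact: val_inj.
have aN0 : `|a 0 0| != 0 by rewrite normr_eq0.
have a'N0 : \prod_i `|a' 0 i| != 0 by apply/prodf_neq0 => i _; rewrite normr_eq0.
have nP : `| \prod_i `|a 0 i| | = \prod_i `|a 0 i| by rewrite ger0_norm// prodr_ge0.
pose phi := (fun p : measurableTypeR R * borelRV R n =>
  ((a 0 0 * p.1 + b 0 0, daff a' b' p.2) : measurableTypeR R * borelRV R n)).
have mphi : measurable_fun setT phi.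
  apply/measurable_fun_pairP; split.
    exact: (measurableT_comp (measurable_affine _ _) measurable_fst).
  exact: (measurableT_comp (measurable_borel_daff _ _) measurable_snd).
pose lm := ((@lebesgue_measure R : set (measurableTypeR R) -> _) \x borel_lebesgue R n)%E.
pose m := mscale (NngNum (normr_ge0 (\prod_i `|a 0 i|))) (push lm mphi).
have mE B : m B = (`|\prod_i `|a 0 i| |%:E * lm (phi @^-1` B))%E by [].
have lmE (B : set (measurableTypeR R)) (C : set (borelRV R n)) : measurable B -> measurable C ->
    lm (B `*` C) = (lebesgue_measure B * borel_lebesgue R n C)%E.
  by move=> mB mC; exact: product_measure1E.
have mA' : measurable (@consRV R n @^-1` A).
  by rewrite -[X in measurable X]setTI; exact: measurable_consRV.
rewrite /= /lebesgue_step /pushforward.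
rewrite (_ : _ @^-1` _ = phi @^-1` (@consRV R n @^-1` A)); last first.
  by apply/seteqP; split => p; rewrite /preimage /= daff_cons.
rewrite -/lm.
have -> : lm (@consRV R n @^-1` A) = m (@consRV R n @^-1` A).
  apply: product_measure_unique => //= B C mB mC.
  rewrite [LHS]mE.
  rewrite (_ : phi @^-1` _ =  ((fun x => a 0 0 * x + b 0 0) @^-1` B) `*` (daff a' b' @^-1` C)); last by [].
  rewrite lmE; last 2 first.
  - by rewrite -[X in measurable X]setTI; exact: measurable_affine.
  - by rewrite -[X in measurable X]setTI; exact: measurable_borel_daff.
  rewrite lebesgue_measure_affine// ih// muleACA.
  rewrite -EFinM -invfM -aa nP [LHS]muleA -EFinM mulfV ?mul1e//.
  by rewrite aa mulf_neq0.
rewrite mE muleA -EFinM nP.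
by rewrite mulVf ?mul1e// aa mulf_neq0.
Qed.

Lemma daffK n (a b : 'rV[R]_n) : (forall i, a 0 i != 0) ->
  cancel (daff a b) (daff (\row_i (a 0 i)^-1) (\row_i (- (a 0 i)^-1 * b 0 i))).
Proof.
by move=> a0 x; apply/rowP => i; rewrite !mxE mulNr mulrDr mulKf// addrK.
Qed.

Lemma daffVK n (a b : 'rV[R]_n) : (forall i, a 0 i != 0) ->
  cancel (daff (\row_i (a 0 i)^-1) (\row_i (- (a 0 i)^-1 * b 0 i))) (daff a b).
Proof.
by move=> a0 x; apply/rowP => i; rewrite !mxE mulNr mulrBr !mulVKf// subrK.
Qed.

(** A cover of [A] by Borel sets pulls back to a cover of the preimage. *)
Let vol_daff_le n (a b : 'rV[R]_n) (A : set 'rV[R]_n) :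
  (forall i, a 0 i != 0) ->
  (lebesgueRV R n (daff a b @^-1` A) <=
  (\prod_i `|a 0 i|)^-1%:E * lebesgueRV R n A)%E.
Proof.
move=> a0.
have p0 : 0 < \prod_i `|a 0 i| by rewrite prodr_gt0// => i _; rewrite normr_gt0.
rewrite -lee_pdivrMl ?invr_gt0// invrK.
apply: le_ereal_inf_tmp => _ [B [mB AB] <-].
rewrite -lee_pdivlMl//.
rewrite -nneseriesZl//.
rewrite [leRHS](_ : _ = \sum_(k <oo) borel_lebesgue R n (daff a b @^-1` (B k)))%E; last first.
  by apply: eq_eseriesr => k _; rewrite borel_lebesgue_daff.
apply: ereal_inf_lbound; exists (fun k => daff a b @^-1` B k) => //; split.
  by move=> k; rewrite -[X in measurable X]setTI; exact: measurable_borel_daff.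
by move=> x /AB[k _ ?]; exists k.
Qed.

(** The reverse inequality is [vol_daff_le] for the inverse map. *)
Lemma vol_daff n (a b : 'rV[R]_n) (A : set 'rV[R]_n) :
  (forall i, a 0 i != 0) ->
  lebesgueRV R n (daff a b @^-1` A) =
  ((\prod_i `|a 0 i|)^-1%:E * lebesgueRV R n A)%E.
Proof.
move=> a0; apply/eqP; rewrite eq_le vol_daff_le//=.
have p0 : 0 < \prod_i `|a 0 i| by rewrite prodr_gt0// => i _; rewrite normr_gt0.
rewrite lee_pdivrMl//.
have a'0 i : (\row_i (a 0 i)^-1 : 'rV[R]_n) 0 i != 0 by rewrite mxE invr_neq0.
have := vol_daff_le (\row_i (- (a 0 i)^-1 * b 0 i)) (daff a b @^-1` A) a'0.
rewrite -comp_preimage (_ : _ \o _ = id); last first.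
  by apply/funext => x; exact: daffVK.
congr (_ <= _ * _)%E; congr _%:E.
by under eq_bigr do rewrite mxE normfV; rewrite prodfV invrK.
Qed.

(** Carathéodory's criterion for the preimage of [A] is the one for [A], tested
    on the image of the test set and rescaled. *)
Lemma measurable_daff n (a b : 'rV[R]_n) :
  (forall i, a 0 i != 0) -> measurable_fun setT (daff a b : leb R n -> leb R n).
Proof.
move=> a0 _ A mA; rewrite setTI.
change ((lebesgueRV R n).-caratheodory (daff a b @^-1` A)) => X.
have p0 : 0 < \prod_i `|a 0 i| by rewrite prodr_gt0// => i _; rewrite normr_gt0.
have [Y ->] : exists Y, X = daff a b @^-1` Y.
  exists ((daff (\row_i (a 0 i)^-1) (\row_i (- (a 0 i)^-1 * b 0 i))) @^-1` X).
  by apply/seteqP; split=> x; rewrite /preimage /= daffK.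
have h : lebesgueRV R n Y = (lebesgueRV R n (Y `&` A) + lebesgueRV R n (Y `&` ~` A))%E.
  exact: mA.
rewrite (vol_daff b Y a0) (vol_daff b (Y `&` A) a0) (vol_daff b (Y `&` ~` A) a0) h.
by rewrite ge0_muleDr//; exact: mu_ext_ge0.
Qed.

End diagonal_affine.

Section toolkit.
Variables (R : realType) (n : nat).
Local Notation V := 'rV[R]_n.
Local Notation vol := (lebesgueRV R n).
Local Notation T := (leb R n).

(** An open set is a countable union of rational balls, and a ball for the sup
    norm is a finite intersection of conditions on the coordinates. *)
Lemma measurable_rVP d (X : measurableType d) (F : X -> borelRV R n) :
  (forall i, measurable_fun setT (fun x => (F x : V) 0 i : measurableTypeR R)) ->
  measurable_fun setT F.
Proof.
move=> mF; apply: (measurability (f := F) (D := setT) (@open V)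
  (erefl : @measurable _ (borelRV R n) = <<s open >>)).
move=> _ [U oU <-]; rewrite setTI.
pose B (a : 'rV[rat]_n * nat) : set V :=
  ball (map_mx ratr a.1 : V) a.2.+1%:R^-1.
pose D : set ('rV[rat]_n * nat) := [set a | B a `<=` U].
have -> : F @^-1` U = \bigcup_a (if `[< D a >] then F @^-1` B a else set0).
  apply/seteqP; split => [p Up|p [a _]].
    have [w [k [wk1 wk2]]] := ball_rat oU Up.
    exists (w, k) => //; rewrite ifT//; exact/asboolP.
  by case: ifPn => // /asboolP Da; exact: Da.
apply: countable_bigcupT_measurable => [|a]; first exact: countableP.
case: ifPn => // _.
pose c := map_mx ratr a.1 : V.
rewrite (_ : _ @^-1` _ = \bigcap_(i in [set: 'I_n])
    ((fun x => (F x : V) 0 i : measurableTypeR R) @^-1` (ball (c 0 i) a.2.+1%:R^-1 : set R))).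
  apply: fin_bigcap_measurable; first exact: finite_finset.
  move=> i _; rewrite -[X in measurable X]setTI; apply: mF => //.
  exact: measurable_ball.
rewrite /B -/c; apply/seteqP; split => [x [e0 h] i _|x h]; first exact: h.
by split=> // i j; rewrite ord1; exact: h.
Qed.

Lemma measurable_leb_borel : measurable_fun setT (id : T -> borelRV R n).
Proof. by move=> _ A mA; rewrite setTI; exact: (lebesgueRV_borel mA).1. Qed.

Lemma measurable_borel_coord i :
  measurable_fun setT (fun x : borelRV R n => (x : V) 0 i : measurableTypeR R).
Proof.
apply: (measurability _ (RGenOpens.measurableE R)) => _ [_ [a [b ->]] <-].
rewrite setTI; apply: sub_sigma_algebra.
apply: open_comp; last exact: interval_open.
by move=> /= x _; exact: coord_continuous.
Qed.

Lemma measurable_coord i :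
  measurable_fun setT (fun x : T => (x : V) 0 i : measurableTypeR R).
Proof. exact: (measurableT_comp (measurable_borel_coord i) measurable_leb_borel). Qed.

Lemma measurable_sub :
  measurable_fun setT (fun p : T * T => (p.1 : V) - p.2 : borelRV R n).
Proof.
apply: measurable_rVP => i.
under eq_fun do rewrite !mxE.
apply: measurable_funB.
  exact: (measurableT_comp (measurable_coord i) measurable_fst).
exact: (measurableT_comp (measurable_coord i) measurable_snd).
Qed.

Lemma vol_box (A : 'I_n -> set (measurableTypeR R)) : (forall i, measurable (A i)) ->
  vol [set v | forall i, A i ((v : V) 0 i)] = (\prod_(i < n) lebesgue_measure (A i))%E.
Proof.
move=> mA; have mB := measurable_boxRV mA.
by rewrite (lebesgueRV_borel mB).2 borel_lebesgue_box.
Qed.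

Lemma vol_hyperplane i (c : R) : vol [set v : V | v 0 i = c] = 0%E.
Proof.
rewrite (_ : [set _ | _] = [set v : V | forall j, (if j == i then [set c] else setT) (v 0 j)]); last first.
  apply/seteqP; split => v /= h; last by have := h i; rewrite eqxx.
  by move=> j; case: eqP => // ->.
rewrite (vol_box (A := fun j => if j == i then [set c] else setT)).
  rewrite (bigD1 i)//= eqxx lebesgue_measure_set1 mul0e//.
by move=> j; case: ifP.
Qed.

Lemma vol_point (x : V) : (0 < n)%N -> vol [set x] = 0%E.
Proof.
move=> n0; apply/eqP; rewrite eq_le mu_ext_ge0// andbT.
rewrite -(vol_hyperplane (Ordinal n0) (x 0 (Ordinal n0))).
by apply: le_mu_ext => _ ->.
Qed.

Lemma integral_daff (a b : V) (f : T -> \bar R) :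
  (forall i, a 0 i != 0) -> measurable_fun setT f -> (forall x, (0 <= f x)%E) ->
  (\int[vol]_x f (daff a b x) = (\prod_i `|a 0 i|)^-1%:E * \int[vol]_x f x)%E.
Proof.
move=> a0 mf f0.
have := @ge0_integral_pushforward _ _ _ _ R (daff a b : T -> T) (measurable_daff b a0) vol
  setT f measurableT mf (fun x _ => f0 x).
rewrite preimage_setT => H.
have p0 : 0 <= (\prod_i `|a 0 i|)^-1 by rewrite invr_ge0 prodr_ge0.
transitivity (\int[mscale (NngNum p0) vol]_x f x)%E; last first.
  by rewrite ge0_integral_mscale.
transitivity (\int[push vol (measurable_daff b a0)]_x f x)%E; first exact/esym/H.
apply: (@eq_measure_integral _ _ _ _ (mscale (NngNum p0) vol) (push vol (measurable_daff b a0))).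
move=> A mA _; exact: vol_daff.
Qed.

End toolkit.

(** * Reflections, translations and dilations *)

Section transforms.
Variables (R : realType) (n : nat).
Local Notation V := 'rV[R]_n.
Local Notation vol := (lebesgueRV R n).
Local Notation T := (leb R n).
Implicit Types (x y b : V) (i : 'I_n) (c r : R) (A B : set V).

(** The reflection in the hyperplane {x_i = c}. *)
Definition refl i c x : V := \row_j (if j == i then 2 * c - x 0 j else x 0 j).

Lemma reflK i c : involutive (refl i c).
Proof.
move=> x; apply/rowP => j; rewrite !mxE; case: ifP => h; rewrite ?h //; ring.
Qed.

Lemma refl_daff i c : refl i c =
  daff (\row_j (if j == i then -1 else 1)) (\row_j (if j == i then 2 * c else 0)).
Proof.
by apply/funext => x; apply/rowP => j; rewrite !mxE; case: ifP => _; ring.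
Qed.

Lemma shift_daff b : (fun x => x + b) = daff (\row__ 1) b.
Proof. by apply/funext => x; apply/rowP => j; rewrite !mxE mul1r. Qed.

Lemma opp_daff b : (fun x => b - x) = daff (\row__ -1) b.
Proof. by apply/funext => x; apply/rowP => j; rewrite !mxE mulN1r addrC. Qed.

Lemma scale_daff r : (fun x => r *: x) = daff (\row__ r) 0.
Proof. by apply/funext => x; apply/rowP => j; rewrite !mxE addr0. Qed.

Let refl0 i j : (\row_j (if j == i then -1 else 1) : V) 0 j != 0.
Proof. by rewrite mxE; case: ifP; rewrite ?oppr_eq0 oner_eq0. Qed.
Let shift0 j : (\row__ 1 : V) 0 j != 0. Proof. by rewrite mxE oner_eq0. Qed.
Let opp0 j : (\row__ -1 : V) 0 j != 0. Proof. by rewrite mxE oppr_eq0 oner_eq0. Qed.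
Let scale0 r : r != 0 -> forall j, (\row__ r : V) 0 j != 0. Proof. by move=> ? j; rewrite mxE. Qed.

Let refl1 i : \prod_j `|(\row_j (if j == i then -1 else 1) : V) 0 j| = 1.
Proof. by rewrite big1// => j _; rewrite mxE; case: ifP; rewrite ?normrN normr1. Qed.
Let shift1 : \prod_j `|(\row__ 1 : V) 0 j| = 1.
Proof. by rewrite big1// => j _; rewrite mxE normr1. Qed.
Let opp1 : \prod_j `|(\row__ -1 : V) 0 j| = 1.
Proof. by rewrite big1// => j _; rewrite mxE normrN normr1. Qed.
Let scale1 r : \prod_j `|(\row__ r : V) 0 j| = `|r| ^+ n.
Proof.
under eq_bigr do rewrite mxE.
by rewrite prodr_const card_ord.
Qed.

Lemma measurable_refl i c : measurable_fun setT (refl i c : T -> T).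
Proof. by rewrite refl_daff; apply: measurable_daff. Qed.

Lemma measurable_shift b : measurable_fun setT ((fun x => x + b) : T -> T).
Proof. by rewrite shift_daff; apply: measurable_daff. Qed.

Lemma measurable_opp b : measurable_fun setT ((fun x => b - x) : T -> T).
Proof. by rewrite opp_daff; apply: measurable_daff. Qed.

Lemma measurable_scale r : r != 0 -> measurable_fun setT ((fun x => r *: x) : T -> T).
Proof. by move=> r0; rewrite scale_daff; apply: measurable_daff; exact: scale0. Qed.

Lemma vol_refl i c A : vol (refl i c @^-1` A) = vol A.
Proof. by rewrite refl_daff vol_daff// refl1 invr1 mul1e. Qed.

Lemma vol_shift b A : vol ((fun x => x + b) @^-1` A) = vol A.
Proof. by rewrite shift_daff vol_daff// shift1 invr1 mul1e. Qed.

Lemma vol_scale r A : r != 0 ->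
  vol ((fun x => r *: x) @^-1` A) = ((`|r| ^+ n)^-1%:E * vol A)%E.
Proof. by move=> r0; rewrite scale_daff vol_daff ?scale1//; exact: scale0. Qed.

Section integrals.
Variable f : T -> \bar R.
Hypotheses (mf : measurable_fun setT f) (f0 : forall x, (0 <= f x)%E).

Lemma integral_refl i c : (\int[vol]_x f (refl i c x) = \int[vol]_x f x)%E.
Proof. by rewrite refl_daff integral_daff// refl1 invr1 mul1e. Qed.

Lemma integral_shift b : (\int[vol]_x f ((x : V) + b)%R = \int[vol]_x f x)%E.
Proof.
under eq_integral do rewrite -[(_ + b)%R]/((fun x : V => x + b) _) shift_daff.
by rewrite integral_daff// shift1 invr1 mul1e.
Qed.

Lemma integral_pointrefl b : (\int[vol]_x f (b - (x : V))%R = \int[vol]_x f x)%E.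
Proof.
under eq_integral do rewrite -[(b - _)%R]/((fun x : V => b - x) _) opp_daff.
by rewrite integral_daff// opp1 invr1 mul1e.
Qed.

Lemma integral_scale r : r != 0 ->
  (\int[vol]_x f (r *: (x : V))%R = (`|r| ^+ n)^-1%:E * \int[vol]_x f x)%E.
Proof.
move=> r0; under eq_integral do rewrite -[(r *: _)%R]/((fun x : V => r *: x) _) scale_daff.
by rewrite integral_daff ?scale1//; exact: scale0.
Qed.
End integrals.

Lemma translateE b A : translate b A = (fun x => x - b) @^-1` A.
Proof.
apply/seteqP; split=> [_ [y Ay <-]|x Ax] /=; first by rewrite /preimage/= addrC addKr.
by exists (x - b) => //; rewrite addrC subrK.
Qed.

Lemma dilateE r A : r != 0 -> dilate r A = (fun x => r^-1 *: x) @^-1` A.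
Proof.
move=> r0; apply/seteqP; split=> [_ [y Ay <-]|x Ax] /=.
  by rewrite /preimage/= scalerA mulVf// scale1r.
by exists (r^-1 *: x) => //; rewrite scalerA mulfV// scale1r.
Qed.

Lemma measurable_translate b (A : set T) : measurable A -> measurable (translate b A : set T).
Proof.
move=> mA; rewrite translateE -[X in measurable X]setTI; exact: measurable_shift.
Qed.

Lemma measurable_dilate r (A : set T) : r != 0 -> measurable A -> measurable (dilate r A : set T).
Proof.
move=> r0 mA; rewrite dilateE// -[X in measurable X]setTI.
by apply: measurable_scale => //; rewrite invr_neq0.
Qed.

Lemma vol_translate b A : vol (translate b A) = vol A.
Proof. by rewrite translateE vol_shift. Qed.

Lemma vol_dilate r A : r != 0 -> vol (dilate r A) = ((`|r| ^+ n)%:E * vol A)%E.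
Proof. by move=> r0; rewrite dilateE// vol_scale ?invr_neq0// normfV exprVn invrK. Qed.

Lemma borel_translate b A : borel_set A -> borel_set (translate b A).
Proof.
move=> mA; rewrite translateE shift_daff /borel_set -[X in _ X]setTI.
exact: (measurable_borel_daff _ _ measurableT).
Qed.

Lemma borel_refl i c A : borel_set A -> borel_set (refl i c @^-1` A).
Proof.
move=> mA; rewrite refl_daff /borel_set -[X in _ X]setTI.
exact: (measurable_borel_daff _ _ measurableT).
Qed.

Lemma borel_measurable A : borel_set A -> measurable (A : set T).
Proof. by move=> mA; exact: (lebesgueRV_borel mA).1. Qed.

Lemma coord_le_norm x i : `|x 0 i| <= `|x|.
Proof.
by rewrite [leRHS]mx_normE -[leLHS]nngE num_le; exact: (le_bigmax _ _ (0, i)).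
Qed.

Lemma norm_le_coord x r : 0 <= r -> (`|x| <= r) <-> (forall i, `|x 0 i| <= r).
Proof.
move=> r0; split=> [xr i|h]; first exact: le_trans (coord_le_norm _ _) xr.
rewrite -[r]/(NngNum r0)%:num [leLHS]mx_normE num_le; apply/bigmax_leP.
by split=> // -[i j] _; rewrite -num_le /= ord1.
Qed.

Lemma norm_lt_coord x r : 0 < r -> (`|x| < r) <-> (forall i, `|x 0 i| < r).
Proof.
move=> r0; split=> [xr i|h]; first exact: le_lt_trans (coord_le_norm _ _) xr.
rewrite -[r]/(NngNum (ltW r0))%:num [ltLHS]mx_normE num_lt; apply/bigmax_ltP.
by split=> // -[i j] _; rewrite -num_lt /= ord1.
Qed.

Lemma bounded_setP A : bounded_set A <-> exists2 r, 0 < r & forall x, A x -> `|x| < r.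
Proof.
split=> [/ex_strict_bound_gt0[r r0 Ar]|[r r0 Ar]]; first by exists r.
exists r; split; first exact: num_real.
by move=> z rz x Ax; apply/ltW/(lt_trans (Ar x Ax)).
Qed.

Definition cube r : set V := [set x | `|x| < r].

Lemma borel_cube r : borel_set (cube r).
Proof.
rewrite (_ : cube r = ball (0 : V) r); first exact: measurable_ball_rV.
by apply/seteqP; split=> x; rewrite -ball_normE /cube /= sub0r normrN.
Qed.

Lemma vol_cube r : 0 < r -> vol (cube r) = ((2 * r) ^+ n)%:E.
Proof.
move=> r0.
rewrite (_ : cube r = [set x : V | forall i, `]-r, r[%classic (x 0 i)]); last first.
  apply/seteqP; split=> x /=.
    by move/(norm_lt_coord _ r0) => h i; rewrite in_itv/= -ltr_norml.
  by move=> h; apply/(norm_lt_coord _ r0) => i; rewrite ltr_norml; have := h i; rewrite in_itv.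
rewrite (vol_box (A := fun=> `]-r, r[%classic))//.
under eq_bigr do rewrite lebesgue_measure_itv/= lte_fin gtrN// -EFinB opprK -mulr2n -mulr_natl.
by rewrite prodEFin prodr_const card_ord.
Qed.

Lemma vol_lty_bounded A : bounded_set A -> (vol A < +oo)%E.
Proof.
move=> /bounded_setP[r r0 Ar].
by apply: (@le_lt_trans _ _ (vol (cube r))); [exact: le_mu_ext|rewrite vol_cube// ltry].
Qed.

End transforms.

(** * The norm of an unconditional strictly convex body *)

Section kernel.
Variables (R : realType) (n : nat).
Local Notation V := 'rV[R]_n.
Local Notation vol := (lebesgueRV R n).
Local Notation T := (leb R n).
Implicit Types (x y b z : V) (i : 'I_n) (c r : R).

Variables (K : set V) (s : R).
Hypotheses (n1 : (1 <= n)%N) (s01 : 0 < s < 1).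
Hypotheses (Ku : unconditional K) (Ks : strictly_convex_body K).

Let Kcpt : compact K. Proof. by case: Ks => -[]. Qed.
Let Kstrict x y t : K x -> K y -> x <> y -> 0 < t < 1 -> K° ((1 - t) *: x + t *: y).
Proof. by case: Ks => _; apply. Qed.

Lemma body_reflection i x : K x -> K (reflection i x).
Proof. by move=> Kx; rewrite -(Ku i); exists x. Qed.

(** Reflect in all coordinate hyperplanes, one after the other. *)
Lemma body_opp x : K x -> K (- x).
Proof.
move=> Kx.
have H (l : seq 'I_n) : uniq l -> K (\row_j (if j \in l then - x 0 j else x 0 j)).
  elim: l => [_|i l ih /= /andP[il ul]].
    by rewrite (_ : \row_j _ = x)//; apply/rowP => j; rewrite mxE.
  rewrite (_ : \row_j _ = reflection i (\row_j (if j \in l then - x 0 j else x 0 j))).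
    by apply: body_reflection; exact: ih.
  apply/rowP => j; rewrite !mxE inE.
  by have [->|//] := eqVneq j i; rewrite (negbTE il).
have := H _ (enum_uniq 'I_n); congr (K _).
by apply/rowP => j; rewrite !mxE mem_enum.
Qed.

(** The origin is the midpoint of an interior point and its opposite. *)
Lemma body_int0 : K° 0.
Proof.
have [_ _ [p Kp]] := Ks.1.
have [p00|p0] := eqVneq p 0; first by move: Kp; rewrite p00.
have -> : 0 = (1 - 2^-1) *: p + 2^-1 *: (- p).
  by rewrite scalerN -scalerBl (_ : _ - _ = 0) ?scale0r//; lra.
have Kp' := interior_subset Kp.
apply: Kstrict => //; [exact: body_opp| |by lra].
move=> /eqP; rewrite -addr_eq0 -mulr2n -scaler_nat scaler_eq0 (negbTE p0) orbF.
by rewrite pnatr_eq0.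
Qed.

Lemma body_ball : exists2 e, 0 < e & forall x, `|x| < e -> K x.
Proof.
have /nbhs_ballP[e /= e0 eK] := body_int0.
exists e => // x xe; apply: eK.
by rewrite -ball_normE /= sub0r normrN.
Qed.

Lemma body0 : K 0. Proof. exact: interior_subset body_int0. Qed.

Lemma body_scale t x : K x -> 0 <= t <= 1 -> K (t *: x).
Proof.
move=> Kx t01.
have [->|x0] := eqVneq x 0; first by rewrite scaler0; exact: body0.
have [->|t0] := eqVneq t 0; first by rewrite scale0r; exact: body0.
have [->|t1] := eqVneq t 1; first by rewrite scale1r.
have -> : t *: x = (1 - t) *: 0 + t *: x by rewrite scaler0 add0r.
apply: interior_subset; apply: Kstrict => //; first exact: body0.
  by move=> x00; rewrite -x00 eqxx in x0.
by move: t01; rewrite !le_eqVlt eq_sym (negbTE t0) (negbTE t1).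
Qed.

Lemma body_bound : exists2 B, 0 < B & forall x, K x -> `|x| < B.
Proof. exact/bounded_setP/compact_bounded. Qed.

Local Notation N := (body_norm K).

Lemma gauge_set_nonempty x : [set r | 0 <= r /\ dilate r K x] !=set0.
Proof.
have [e e0 eK] := body_ball.
pose t := (`|x| + 1) / e.
have t0 : 0 < t by rewrite divr_gt0// ltr_wpDl.
exists t; split; first exact: ltW.
exists (t^-1 *: x); last by rewrite scalerA mulfV ?gt_eqF// scale1r.
apply: eK; rewrite normrZ gtr0_norm ?invr_gt0// invf_div mulrAC ltr_pdivrMr ?ltr_wpDl//.
by rewrite ltr_pM2l// ltrDl.
Qed.

(** Turns the infimum defining the norm into a usable condition: it may be
    tested at positive radii, because K contains the origin. *)
Lemma body_norm_ltP x r : 0 < r ->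
  (N x < r) <-> (exists2 q, 0 < q < r & K (q^-1 *: x)).
Proof.
move=> r0; have lb : lbound [set r | 0 <= r /\ dilate r K x] 0 by move=> t [].
split=> [Nr|[q /andP[q0 qr] Kq]]; last first.
  apply: le_lt_trans qr; apply: ge_inf; first by exists 0.
  split; first exact: ltW.
  by exists (q^-1 *: x) => //; rewrite scalerA mulfV ?gt_eqF// scale1r.
have hi := gauge_set_nonempty x.
have [q [q0 [y Ky yx]] qr] := inf_lt hi Nr.
have [q00|qN0] := eqVneq q 0.
  exists (r / 2); first by rewrite divr_gt0//= ltr_pdivrMr// mulr2n mulrDr mulr1 ltrDl.
  by rewrite -yx q00 scale0r scaler0; exact: body0.
exists q; first by rewrite lt_neqAle eq_sym qN0 q0.
by rewrite -yx scalerA mulVf// scale1r.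
Qed.

Lemma body_norm_ge0 x : 0 <= N x.
Proof.
by apply: lb_le_inf (gauge_set_nonempty x) _ => t [].
Qed.

Lemma body_normZ r x : 0 < r -> N (r *: x) = r * N x.
Proof.
move=> r0.
have H t : (N (r *: x) < t) = (r * N x < t).
  have [t0|t0] := ltP 0 t; last first.
    rewrite !ltNge (le_trans t0)/= ?body_norm_ge0// (le_trans t0)//.
    by rewrite mulr_ge0 ?body_norm_ge0// ltW.
  rewrite mulrC -ltr_pdivlMr//; apply/idP/idP.
    move/(body_norm_ltP _ t0) => [q /andP[q0 qt] Kq].
    apply/body_norm_ltP; first by rewrite divr_gt0.
    exists (q / r); first by rewrite divr_gt0//= ltr_pM2r// invr_gt0.
    by rewrite invf_div mulrC -scalerA.
  have tr0 : 0 < t / r by rewrite divr_gt0.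
  move/(body_norm_ltP _ tr0) => [q /andP[q0 qt] Kq].
  apply/body_norm_ltP => //.
  exists (q * r); first by rewrite mulr_gt0//= -ltr_pdivlMr.
  by rewrite scalerA invfM -mulrA mulVf ?mulr1// gt_eqF.
apply/eqP; rewrite eq_le !leNgt H ltxx /= -H ltxx//.
Qed.

Lemma body_norm_lower : exists2 c, 0 < c & forall x, c * `|x| <= N x.
Proof.
have [B B0 KB] := body_bound; exists B^-1; first by rewrite invr_gt0.
move=> x; rewrite leNgt; apply/negP => h.
have x0 : 0 < B^-1 * `|x| by apply: le_lt_trans h; exact: body_norm_ge0.
have [q /andP[q0 qx] /KB] := (body_norm_ltP _ x0).1 h.
rewrite normrZ gtr0_norm ?invr_gt0// mulrC ltr_pdivrMr// => /lt_trans.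
by move=> /(_ `|x|); rewrite ltxx -ltr_pdivlMl// => /(_ qx).
Qed.

Lemma body_norm_gt0 x : x != 0 -> 0 < N x.
Proof.
by have [c c0 h] := body_norm_lower => x0; apply: lt_le_trans (h x); rewrite mulr_gt0// normr_gt0.
Qed.

Lemma body_norm0 : N 0 = 0.
Proof.
have := @body_normZ 2 0; rewrite scaler0 => /(_ ltac:(by [])) h.
lra.
Qed.

Lemma eq_body_norm x y : (forall q, 0 < q -> K (q^-1 *: x) <-> K (q^-1 *: y)) -> N x = N y.
Proof.
move=> h.
have H t : (N x < t) = (N y < t).
  have [t0|t0] := ltP 0 t; last by rewrite !ltNge !(le_trans t0) ?body_norm_ge0.
  apply/idP/idP => /(body_norm_ltP _ t0) [q qt Kq]; apply/body_norm_ltP => //;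
    by exists q => //; apply/h => //; case/andP: qt.
by apply/eqP; rewrite eq_le !leNgt -H ltxx /= H ltxx.
Qed.

Lemma body_normN x : N (- x) = N x.
Proof.
apply: eq_body_norm => q q0; rewrite scalerN.
by split=> /body_opp //; rewrite opprK.
Qed.

Lemma reflectionK i : involutive (@reflection R n i).
Proof. by move=> x; apply/rowP => j; rewrite !mxE; case: ifP => h; rewrite ?h ?opprK. Qed.

Lemma reflectionZ i t x : reflection i (t *: x) = t *: reflection i x.
Proof. by apply/rowP => j; rewrite !mxE; case: ifP; rewrite ?mulrN. Qed.

Lemma body_norm_reflection i x : N (reflection i x) = N x.
Proof.
apply: eq_body_norm => q q0; rewrite -reflectionZ.
by split=> /(@body_reflection i) //; rewrite reflectionK.
Qed.

(** The infimum defining the norm is attained, since K is closed. *)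
Lemma body_norm_attained x : x != 0 -> K ((N x)^-1 *: x).
Proof.
move=> x0; have Nx := body_norm_gt0 x0.
have : closed K by apply: compact_closed Kcpt; exact: norm_hausdorff.
apply; move=> U.
have c : {for N x, continuous (fun t : R => t^-1 *: x)}.
  apply: cvgZr_tmp; apply: cvgV; [by rewrite gt_eqF|exact: cvg_id].
move=> /c /nbhs_ballP[e /= e0 eU].
pose t := N x + e / 2.
have h : N x < t by rewrite ltrDl divr_gt0.
have t0 := lt_trans Nx h.
have [u /andP[u0 ut] Ku'] := (body_norm_ltP _ t0).1 h.
exists (t^-1 *: x); split.
  have -> : t^-1 *: x = (u / t) *: (u^-1 *: x) by rewrite scalerA mulrAC mulfV ?gt_eqF// mul1r.
  by apply: body_scale => //; rewrite divr_ge0 ?ltW//= ltr_pdivrMr ?mul1r.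
apply: eU; rewrite /ball/= /t opprD addrA subrr add0r normrN gtr0_norm ?divr_gt0//.
by rewrite ltr_pdivrMr// mulr2n mulrDr mulr1 ltrDl.
Qed.

(** The point [z] lies strictly between [z'] and its mirror image; scaled to the
    boundary of K, these two are distinct points of K, and strict convexity puts
    the scaled [z] into the interior of K. *)
Lemma body_norm_strict i z z' : (forall j, j != i -> z 0 j = z' 0 j) ->
  `|z 0 i| < `|z' 0 i| -> N z < N z'.
Proof.
move=> zz' zi.
have z'i : z' 0 i != 0 by rewrite -normr_gt0; apply: le_lt_trans zi.
have z'0 : z' != 0 by apply: contra_neq z'i => ->; rewrite mxE.
have N0 := body_norm_gt0 z'0.
(* the barycentric coordinate of z between z' and its mirror image *)
pose t := (1 - z 0 i / z' 0 i) / 2.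
have t01 : 0 < t < 1.
  have : `|z 0 i / z' 0 i| < 1 by rewrite normrM normfV ltr_pdivrMr ?normr_gt0// mul1r.
  by rewrite ltr_norml /t => /andP[? ?]; lra.
have zE : z = (1 - t) *: z' + t *: reflection i z'.
  apply/rowP => j; rewrite !mxE; case: eqP => [->|/eqP/zz' ->]; last ring.
  rewrite /t; by field.
have neq : (N z')^-1 *: z' <> (N z')^-1 *: reflection i z'.
  move/rowP/(_ i); rewrite !mxE eqxx => /mulfI; rewrite invr_eq0 gt_eqF// => /(_ isT) h.
  by move: z'i; rewrite (_ : z' 0 i = 0) ?eqxx//; lra.
have := @Kstrict _ _ t (body_norm_attained z'0) _ neq t01.
rewrite -reflectionZ => /(_ (body_reflection i (body_norm_attained z'0))).
rewrite (_ : _ + _ = (N z')^-1 *: z); last first.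
  by rewrite [in RHS]zE reflectionZ scalerDr !scalerA ![_ * (N z')^-1]mulrC.
move=> /nbhs_ballP[e /= e0 eK].
have [->|z0] := eqVneq z 0; first by rewrite body_norm0.
have nz : 0 < `|z| by rewrite normr_gt0.
(* a factor larger than 1 by which the scaled z can still be enlarged inside K *)
pose u := 1 + e * N z' / (2 * `|z|).
have u1 : 1 < u by rewrite ltrDl divr_gt0 ?mulr_gt0.
have u0 : 0 < u by apply: lt_trans u1.
apply/body_norm_ltP => //; exists (N z' / u).
  by rewrite divr_gt0//= ltr_pdivrMr// ltr_pMr.
apply: eK; rewrite -ball_normE /= invf_div -scalerBl normrZ.
have -> : (N z')^-1 - u / N z' = - (e / (2 * `|z|)).
  by rewrite /u; field; rewrite !gt_eqF.
rewrite normrN gtr0_norm ?divr_gt0 ?mulr_gt0// invfM !mulrA divfK ?gt_eqF//.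
lra.
Qed.

End kernel.

(** * Integrability of the kernel *)

Section riesz_kernel.
Variables (R : realType) (n : nat).
Local Notation V := 'rV[R]_n.
Local Notation vol := (lebesgueRV R n).
Local Notation T := (leb R n).
Local Notation cube := (@cube R n).
Implicit Types (x y b z : V) (i : 'I_n) (c r : R).

Variables (K : set V) (s : R).
Hypotheses (n1 : (1 <= n)%N) (s01 : 0 < s < 1).
Hypotheses (Ku : unconditional K) (Ks : strictly_convex_body K).

Local Notation N := (body_norm K).

(** The set where the norm is less than [r] is the union of the closed sets
    [q K] over the positive rationals [q] below [r]. *)
Lemma measurable_body_norm : measurable_fun setT (N : borelRV R n -> measurableTypeR R).
Proof.
apply: (measurability _ (RGenInftyO.measurableE R)) => _ [_ [r ->] <-].
rewrite setTI.
have [r0|r0] := leP r 0.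
  rewrite (_ : _ @^-1` _ = set0)//; apply/seteqP; split=> // x /=.
  by rewrite in_itv/= ltNge (le_trans r0)// (body_norm_ge0 Ku Ks).
have Kc : closed K.
  by case: Ks => -[+ _ _] _; apply: compact_closed; exact: norm_hausdorff.
rewrite (_ : _ @^-1` _ = \bigcup_(q : rat)
    (if `[< 0 < (ratr q : R) < r >] then (fun x => (ratr q)^-1 *: x) @^-1` K else set0)).
  apply: bigcupT_measurable_rat => q; case: ifPn => // _.
  rewrite scale_daff -[X in measurable X]setTI.
  apply: measurable_borel_daff => //; rewrite -[K]setCK; apply: measurableC.
  by apply: sub_sigma_algebra; exact: closed_openC.
apply/seteqP; split=> x /=.
  rewrite in_itv/= => /(body_norm_ltP Ku Ks _ r0)[p /andP[p0 pr] Kp].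
  have [q] := rat_in_itvoo pr; rewrite in_itv/= => /andP[pq qr].
  exists q => //; rewrite ifT; last by apply/asboolP; rewrite qr (lt_trans p0).
  have q0 : 0 < (ratr q : R) by exact: lt_trans pq.
  rewrite /preimage/=.
  have -> : (ratr q)^-1 *: x = (p / ratr q) *: (p^-1 *: x).
    by rewrite scalerA mulrAC mulfV ?gt_eqF// mul1r.
  by apply: (body_scale Ku Ks) => //; rewrite divr_ge0 ?ltW//= ltr_pdivrMr ?mul1r.
move=> [q _]; case: ifPn => // /asboolP qr Kq.
by rewrite in_itv/=; apply/(body_norm_ltP Ku Ks _ r0); exists (ratr q).
Qed.

Definition kern z : R := (N z `^ (n%:R + s))^-1.

Lemma kernelKE x y : kernelK K s x y = kern (x - y). Proof. by []. Qed.

Lemma kernE z : kern z = N z `^ (- (n%:R + s)).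
Proof. by rewrite powRN. Qed.

Lemma measurable_kern : measurable_fun setT (kern : borelRV R n -> measurableTypeR R).
Proof.
rewrite (_ : kern = fun z => N z `^ (- (n%:R + s))); last by apply/funext => z; exact: kernE.
exact: (measurableT_comp (measurable_powR _) measurable_body_norm).
Qed.

Lemma measurable_kernelK :
  measurable_fun setT (fun p : T * T => kernelK K s p.1 p.2 : measurableTypeR R).
Proof. exact: (measurableT_comp measurable_kern (@measurable_sub R n)). Qed.

Let ns0 : 0 < n%:R + s.
Proof. by case/andP: s01 => s0 _; rewrite ltr_wpDl. Qed.

Lemma kern_ge0 z : 0 <= kern z.
Proof. by rewrite kernE powR_ge0. Qed.

Lemma kern0 : kern 0 = 0.
Proof. by rewrite /kern (body_norm0 Ku Ks) powR0 ?invr0// gt_eqF. Qed.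

Lemma kernN z : kern (- z) = kern z.
Proof. by rewrite /kern (body_normN Ku Ks). Qed.

Lemma kernZ r z : 0 < r -> kern (r *: z) = (r `^ (n%:R + s))^-1 * kern z.
Proof.
move=> r0; by rewrite /kern (body_normZ Ku Ks)// powRM ?invfM//; [exact: ltW|exact: (body_norm_ge0 Ku Ks)].
Qed.

Lemma kern_reflection i z : kern (reflection i z) = kern z.
Proof. by rewrite /kern (body_norm_reflection Ku Ks). Qed.

Lemma kern_strict i z z' : z != 0 -> (forall j, j != i -> z 0 j = z' 0 j) ->
  `|z 0 i| < `|z' 0 i| -> kern z' < kern z.
Proof.
move=> z0 zz' zi.
have N0 := body_norm_gt0 Ku Ks z0.
have NN := body_norm_strict Ku Ks zz' zi.
rewrite /kern ltf_pV2 ?posrE ?powR_gt0//; last exact: lt_trans NN.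
by apply: gt0_ltr_powR => //; rewrite nnegrE ltW// (lt_trans N0).
Qed.

Lemma kern_upper : exists2 C, 0 < C & forall z r, 0 < r -> r <= `|z| ->
  kern z <= C * (r `^ (n%:R + s))^-1.
Proof.
have [c c0 cN] := body_norm_lower Ku Ks.
exists (c `^ (n%:R + s))^-1; first by rewrite invr_gt0 powR_gt0.
move=> z r r0 rz; rewrite -invfM -(powRM _ (ltW c0) (ltW r0)) /kern.
have cr0 : 0 < c * r by rewrite mulr_gt0.
have crN : c * r <= N z by apply: le_trans (cN z); rewrite ler_pM2l.
have N0 : 0 < N z by apply: lt_le_trans crN.
rewrite lef_pV2 ?posrE ?powR_gt0//.
by apply: ge0_ler_powR => //; rewrite ?nnegrE ltW.
Qed.

(** The kernel is not integrable near the origin. In a unit range of nested cuts,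
    those that separate two points differing by [z] have total length at most
    [min 1 |z|], which explains the weight. *)
Definition kern1 z : R := Num.min 1 `|z| * kern z.

Lemma measurable_norm_rV : measurable_fun setT (fun z : borelRV R n => `|z : V| : measurableTypeR R).
Proof.
apply: (measurability _ (RGenInftyO.measurableE R)) => _ [_ [r ->] <-].
rewrite setTI.
rewrite (_ : _ @^-1` _ = cube r); first exact: borel_cube.
by apply/seteqP; split=> x; rewrite /preimage /cube /= in_itv.
Qed.

Lemma measurable_kern1 : measurable_fun setT (kern1 : borelRV R n -> measurableTypeR R).
Proof.
apply: measurable_funM; last exact: measurable_kern.
by apply: measurable_minr => //; exact: measurable_norm_rV.
Qed.

Lemma pow2_ge (a : R) : exists k : nat, a < 2 ^+ k.
Proof.
exists (Num.truncn a).+1; apply: (lt_le_trans (truncnS_gt a)).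
rewrite -natrX ler_nat; exact/ltnW/ltn_expl.
Qed.

Let w : R := 2 `^ s.
Let w1 : 1 < w.
Proof.
case/andP: s01 => s0 s1; rewrite /w -[X in X < _](powRr0 2).
by rewrite /powR !ifF ?pnatr_eq0// ltr_expR ltr_pM2r// ln_gt0// ltr1n.
Qed.
Let w2 : w < 2.
Proof.
case/andP: s01 => s0 s1; rewrite /w -[X in _ < X](@powRr1 _ 2)//.
by rewrite /powR !ifF ?pnatr_eq0// ltr_expR ltr_pM2r// ln_gt0// ltr1n.
Qed.

Let pow2ns k : ((2 ^- k : R) `^ (n%:R + s))^-1 = (2 ^+ n * w) ^+ k.
Proof.
rewrite -powRN -powR_invn// -powRrM mulrNN mulrC powRrM powR_mulrn ?powR_ge0//.
by rewrite powRD ?powR_mulrn// pnatr_eq0 implybT.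
Qed.

Let pow2ns' k : ((2 ^+ k : R) `^ (n%:R + s))^-1 = (2 ^+ n * w) ^- k.
Proof.
rewrite -powR_mulrn// -powRrM mulrC powRrM powR_mulrn ?powR_ge0//.
by rewrite powRD ?powR_mulrn// pnatr_eq0 implybT.
Qed.

Lemma term_le_nneseries (u : (\bar R)^nat) k : (forall j, (0 <= u j)%E) ->
  (u k <= \sum_(0 <= j <oo) u j)%E.
Proof.
move=> u0; rewrite (@nneseriesD1 _ u k xpredT)//.
by apply: leeDl; apply: nneseries_ge0 => i _ _; exact: u0.
Qed.

(** A dyadic decomposition: the first series handles the shells inside the unit
    cube, where the weight [min 1 |z|] is used, and the second those outside. *)
Lemma kern1_le : exists2 C, 0 < C & forall z,
  ((kern1 z)%:E <= \sum_(0 <= k <oo) (C * (2 ^- k * (2 ^+ n * w) ^+ k.+1) * \1_(cube (2 ^- k)) z)%:E +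
   \sum_(0 <= k <oo) (C * ((2 ^+ n * w) ^- k) * \1_(cube (2 ^+ k.+1)) z)%:E)%E.
Proof.
have [C C0 kC] := kern_upper; exists C => // z.
have w0 : 0 < w by exact: lt_trans w1.
have t1 k : (0 <= (C * (2 ^- k * (2 ^+ n * w) ^+ k.+1) * \1_(cube (2 ^- k)) z)%:E)%E.
  by rewrite lee_fin !mulr_ge0// ?ltW// ?invr_gt0 ?exprn_gt0// mulr_gt0 ?exprn_gt0.
have t2 k : (0 <= (C * ((2 ^+ n * w) ^- k) * \1_(cube (2 ^+ k.+1)) z)%:E)%E.
  by rewrite lee_fin !mulr_ge0// ?ltW// ?invr_gt0 ?exprn_gt0// mulr_gt0 ?exprn_gt0.
have [z00|z0] := eqVneq z 0.
  have -> : kern1 z = 0 by rewrite /kern1 z00 kern0 mulr0.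
  by apply: adde_ge0; apply: nneseries_ge0 => k _ _; [exact: t1|exact: t2].
have nz : 0 < `|z| by rewrite normr_gt0.
have [z1|z1] := ltP `|z| 1.
  (* the dyadic shell that contains z *)
  have /ex_minnP[k kz kmin] : exists k, 2 ^- k.+1 <= `|z|.
    have [k hk] := pow2_ge `|z|^-1; exists k.
    rewrite -[leRHS]invrK lef_pV2 ?posrE ?invr_gt0 ?exprn_gt0//.
    by rewrite (le_trans (ltW hk))// ler_weXn2l// ler1n.
  have zk : z \in cube (2 ^- k).
    rewrite inE /cube/=; case: k kz kmin => [|k] kz kmin; first by rewrite expr0 invr1.
    by rewrite ltNge; apply/negP => /kmin; rewrite ltnn.
  apply: (@le_trans _ _ (\sum_(0 <= k <oo) (C * (2 ^- k * (2 ^+ n * w) ^+ k.+1) * \1_(cube (2 ^- k)) z)%:E)%E); last first.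
    by rewrite leeDl// nneseries_ge0.
  apply: le_trans (term_le_nneseries k t1).
  rewrite lee_fin indicE zk mulr1 /kern1 mulrCA.
  apply: ler_pM; [by rewrite le_min ler01 ltW|exact: kern_ge0| |].
    by rewrite ge_min; apply/orP; right; move: zk; rewrite inE => /ltW.
  by rewrite -pow2ns; apply: kC => //; rewrite invr_gt0 exprn_gt0.
have /ex_minnP[k kz kmin] : exists k, `|z| < 2 ^+ k.+1.
  have [k hk] := pow2_ge `|z|; exists k.
  by rewrite (lt_le_trans hk)// ler_weXn2l// ler1n.
have zk : 2 ^+ k <= `|z|.
  case: k kz kmin => [|k] kz kmin; first by rewrite expr0.
  by rewrite leNgt; apply/negP => /kmin; rewrite ltnn.
apply: (@le_trans _ _ (\sum_(0 <= k <oo) (C * ((2 ^+ n * w) ^- k) * \1_(cube (2 ^+ k.+1)) z)%:E)%E); last first.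
  by rewrite leeDr// nneseries_ge0.
apply: le_trans (term_le_nneseries k t2).
rewrite lee_fin indicE mem_set// mulr1 /kern1.
apply: le_trans (_ : kern z <= _).
  by rewrite ler_piMl ?kern_ge0// ge_min lexx.
by rewrite -pow2ns'; apply: kC => //; rewrite exprn_gt0.
Qed.

Lemma geometric_lty (a q : R) : 0 <= a -> 0 < q < 1 ->
  (\sum_(0 <= k <oo) (a * q ^+ k)%:E < +oo)%E.
Proof.
move=> a0 /andP[q0 q1]; apply: (@le_lt_trans _ _ (a / (1 - q))%:E); last exact: ltry.
apply: lime_le.
  by apply: is_cvg_nneseries => k _ _; rewrite lee_fin mulr_ge0// exprn_ge0// ltW.
apply: nearW => m; rewrite sumEFin lee_fin.
by apply: geometric_le_lim => //; rewrite gtr0_norm.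
Qed.

(** Integrating [kern1_le] gives two geometric series, of ratios [2 ^ s / 2] and
    [2 ^ (- s)]; they converge for 0 < s < 1. *)
Lemma integral_kern1_lty : (\int[vol]_z (kern1 z)%:E < +oo)%E.
Proof.
have [C C0 kC] := kern1_le.
have w0 : 0 < w by exact: lt_trans w1.
have mcube r : measurable (cube r : set T).
  by apply: borel_measurable; exact: borel_cube.
have m1 (a : R) r : measurable_fun setT (fun z : T => (a * \1_(cube r) z)%:E).
  by apply/measurable_EFinP; apply: measurable_funM => //; exact: measurable_indic.
have i1 (a : R) r : 0 <= a -> 0 < r -> (\int[vol]_z (a * \1_(cube r) z)%:E = (a * (2 * r) ^+ n)%:E)%E.
  move=> a0 r0.
  under eq_integral do rewrite EFinM.
  rewrite ge0_integralZl; [|exact: measurableT| |by move=> z _; rewrite lee_fin|exact: a0]; last first.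
    by apply/measurable_EFinP; exact: measurable_indic.
  by rewrite integral_indic// setIT [X in (_ * X)%E](vol_cube _ r0).
have p1 k : 0 <= C * (2 ^- k * (2 ^+ n * w) ^+ k.+1).
  by rewrite !mulr_ge0// ?ltW// ?invr_gt0 ?exprn_gt0// mulr_gt0 ?exprn_gt0.
have p2 k : 0 <= C * ((2 ^+ n * w) ^- k).
  by rewrite !mulr_ge0// ?ltW// ?invr_gt0 ?exprn_gt0// mulr_gt0 ?exprn_gt0.
pose F1 z := (\sum_(0 <= k <oo) (C * (2 ^- k * (2 ^+ n * w) ^+ k.+1) * \1_(cube (2 ^- k)) z)%:E)%E.
pose F2 z := (\sum_(0 <= k <oo) (C * ((2 ^+ n * w) ^- k) * \1_(cube (2 ^+ k.+1)) z)%:E)%E.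
have F10 z : (0 <= F1 z)%E by apply: nneseries_ge0 => k _ _; rewrite lee_fin mulr_ge0.
have F20 z : (0 <= F2 z)%E by apply: nneseries_ge0 => k _ _; rewrite lee_fin mulr_ge0.
have mF1 : measurable_fun setT (F1 : T -> \bar R).
  by apply: ge0_emeasurable_sum => // k z _ _; rewrite lee_fin mulr_ge0.
have mF2 : measurable_fun setT (F2 : T -> \bar R).
  by apply: ge0_emeasurable_sum => // k z _ _; rewrite lee_fin mulr_ge0.
have iF1 : (\int[vol]_z F1 z = \sum_(0 <= k <oo) (C * (2 ^- k * (2 ^+ n * w) ^+ k.+1) * (2 * 2 ^- k) ^+ n)%:E)%E.
  rewrite /F1 integral_nneseries; [|exact: measurableT|by move=> k; exact: m1|by move=> k z _; rewrite lee_fin mulr_ge0].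
  by apply: eq_eseriesr => k _; rewrite i1// invr_gt0 exprn_gt0.
have iF2 : (\int[vol]_z F2 z = \sum_(0 <= k <oo) (C * ((2 ^+ n * w) ^- k) * (2 * 2 ^+ k.+1) ^+ n)%:E)%E.
  rewrite /F2 integral_nneseries; [|exact: measurableT|by move=> k; exact: m1|by move=> k z _; rewrite lee_fin mulr_ge0].
  by apply: eq_eseriesr => k _; rewrite i1// exprn_gt0.
have {}kC z : ((kern1 z)%:E <= F1 z + F2 z)%E by exact: kC.
have k0 z : (0 <= (kern1 z)%:E)%E by rewrite lee_fin mulr_ge0 ?kern_ge0// le_min ler01/=.
clearbody F1 F2.
apply: (@le_lt_trans _ _ (\int[vol]_z (F1 z + F2 z))%E).
  apply: ge0_le_integral.
  - exact: measurableT.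
  - by move=> z _; exact: k0.
  - apply/measurable_EFinP.
    exact: (measurableT_comp measurable_kern1 (@measurable_leb_borel R n)).
  - exact: emeasurable_funD.
  - by move=> z _; exact: kC.
rewrite ge0_integralD; [|exact: measurableT|by move=> z _; exact: F10|exact: mF1|by move=> z _; exact: F20|exact: mF2].
rewrite iF1 iF2 lte_add_pinfty//.
  rewrite (_ : (\sum_(0 <= k <oo) _ = \sum_(0 <= k <oo) ((C * 2 ^+ n * w * 2 ^+ n) * (w / 2) ^+ k)%:E)%E).
    apply: geometric_lty; first by rewrite !mulr_ge0 ?exprn_ge0// ltW.
    by rewrite divr_gt0//= ltr_pdivrMr// mul1r.
  apply: eq_eseriesr => k _; congr _%:E.
  have e2 : (2 : R) ^+ k != 0 by rewrite expf_neq0 ?pnatr_eq0.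
  have e3 : (2 : R) ^+ n ^+ k != 0 by rewrite !expf_neq0 ?pnatr_eq0.
  rewrite exprS !exprMn !exprVn [_ ^+ k ^+ n]exprAC.
  by field; rewrite e2 e3.
rewrite (_ : (\sum_(0 <= k <oo) _ = \sum_(0 <= k <oo) ((C * 4 ^+ n) * (w ^-1) ^+ k)%:E)%E).
  apply: geometric_lty; first by rewrite !mulr_ge0 ?exprn_ge0// ltW.
  by rewrite invr_gt0 w0/= invf_lt1.
apply: eq_eseriesr => k _; congr _%:E.
have e2 : (2 : R) ^+ n ^+ k != 0 by rewrite !expf_neq0 ?pnatr_eq0.
have e3 : w ^+ k != 0 by rewrite expf_neq0// gt_eqF.
have -> : (4 : R) = 2 * 2 by rewrite -natrM.
rewrite exprS !exprMn exprVn [_ ^+ k ^+ n]exprAC.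
by field; rewrite e2 e3.
Qed.

End riesz_kernel.

(** * Double integrals *)

Lemma sigma_finite_square d (T : measurableType d) (R : realType)
    (mu : {sigma_finite_measure set T -> \bar R}) : sigma_finite setT (mu \x mu)%E.
Proof.
have /sigma_finiteP[F [FT ndF Foo]] := sigma_finiteT mu.
exists (fun i => F i `*` F i) => [|i].
  apply/seteqP; split=> // -[x y] _.
  have [i _ Fx] : (\bigcup_k F k) x by rewrite -FT.
  have [j _ Fy] : (\bigcup_k F k) y by rewrite -FT.
  exists (maxn i j) => //; split => /=.
    by move: Fx; exact/subsetPset/ndF/leq_maxl.
  by move: Fy; exact/subsetPset/ndF/leq_maxr.
have [mF Fi] := Foo i; split; first exact: measurableX.
by rewrite product_measure1E// lte_mul_pinfty// ge0_fin_numE.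
Qed.

(** A name for the product measure that carries its sigma-finiteness, so that
    Tonelli's theorem applies to it and a third variable. *)
Definition square d (T : measurableType d) (R : realType)
    (mu : {sigma_finite_measure set T -> \bar R}) : set (T * T) -> \bar R :=
  (mu \x mu)%E.

Section square.
Context d (T : measurableType d) (R : realType).
Variable mu : {sigma_finite_measure set T -> \bar R}.
HB.instance Definition _ := Measure.on (square mu).
HB.instance Definition _ :=
  Measure_isSigmaFinite.Build _ _ _ (square mu) (sigma_finite_square mu).
End square.

Section double_integrals.
Context d (T : measurableType d) (R : realType).
Variable mu : {sigma_finite_measure set T -> \bar R}.
Local Open Scope ereal_scope.
Local Notation mumu := (mu \x mu).

Implicit Types (F G : T * T -> \bar R).

Lemma integral_null_eq F G (Z : set T) : measurable Z -> mu Z = 0 ->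
  measurable_fun setT F -> measurable_fun setT G ->
  (forall p, 0 <= F p) -> (forall p, 0 <= G p) ->
  (forall x y, ~ Z x -> ~ Z y -> F (x, y) = G (x, y)) ->
  \int[mumu]_p F p = \int[mumu]_p G p.
Proof.
move=> mZ Z0 mF mG F0 G0 FG.
apply: ge0_ae_eq_integral => //.
exists ((Z `*` setT) `|` (setT `*` Z)); split.
- by apply: measurableU; exact: measurableX.
- apply/eqP; rewrite eq_le measure_ge0 andbT; apply: (@le_trans _ _ (mumu (Z `*` setT) + mumu (setT `*` Z))).
    by apply: measureU2; exact: measurableX.
  have -> : mumu (Z `*` setT) = 0.
    by rewrite product_measure1E// [X in X * _]Z0 mul0e.
  have -> : mumu (setT `*` Z) = 0.
    by rewrite product_measure1E// [X in _ * X]Z0 mule0.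
  by rewrite adde0.
- move=> [x y] /=; apply: contra_notP => /not_orP [/not_andP zx /not_andP zy] _.
  by apply: FG => [Zx|Zy]; [case: zx|case: zy].
Qed.

Lemma integral_le_null F G (Z : set T) : measurable Z -> mu Z = 0 ->
  measurable_fun setT F -> measurable_fun setT G ->
  (forall p, 0 <= F p) -> (forall p, 0 <= G p) ->
  (forall x y, ~ Z x -> ~ Z y -> F (x, y) <= G (x, y)) ->
  \int[mumu]_p F p <= \int[mumu]_p G p.
Proof.
move=> mZ Z0 mF mG F0 G0 FG.
rewrite (@integral_null_eq G (fun p => maxe (F p) (G p)) Z)//.
- apply: ge0_le_integral => //; first exact: measurable_maxe.
  by move=> p _; rewrite le_max lexx.
- exact: measurable_maxe.
- by move=> p; rewrite le_max F0.
- by move=> x y Zx Zy; rewrite max_r// FG.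
Qed.

Lemma integral_swap F : measurable_fun setT F -> (forall p, 0 <= F p) ->
  \int[mumu]_p F (p.2, p.1) = \int[mumu]_p F p.
Proof.
move=> mF F0; rewrite fubini_tonelli2//; first by rewrite [RHS]fubini_tonelli1.
apply: (measurableT_comp (f := F) (g := fun p : T * T => (p.2, p.1))) => //.
by apply/measurable_fun_pairP; split; [exact: measurable_snd|exact: measurable_fst].
Qed.

(** The map [phi] multiplies integrals by [c]: reflections have [c = 1], the
    inverse of the dilation by [r] has [c = r ^ n]. *)
Section change.
Variables (phi : T -> T) (c : \bar R).
Hypothesis mphi : measurable_fun setT phi.
Hypothesis iphi : forall f : T -> \bar R, measurable_fun setT f -> (forall x, 0 <= f x) ->
  \int[mu]_x f (phi x) = c * \int[mu]_x f x.

Lemma measurable_phi1 : measurable_fun setT (fun p : T * T => (phi p.1, p.2)).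
Proof.
by apply/measurable_fun_pairP; split; [exact: (measurableT_comp mphi measurable_fst)|exact: measurable_snd].
Qed.

Lemma measurable_phi2 : measurable_fun setT (fun p : T * T => (p.1, phi p.2)).
Proof.
by apply/measurable_fun_pairP; split; [exact: measurable_fst|exact: (measurableT_comp mphi measurable_snd)].
Qed.

Hypothesis c0 : 0 <= c.

Lemma integral_phi1 F : measurable_fun setT F -> (forall p, 0 <= F p) ->
  \int[mumu]_p F (phi p.1, p.2) = c * \int[mumu]_p F p.
Proof.
move=> mF F0; rewrite fubini_tonelli2//; last exact: (measurableT_comp mF measurable_phi1).
rewrite [in RHS]fubini_tonelli2// -ge0_integralZl//.
- apply: eq_integral => y _; rewrite /fubini_G /= (iphi (f := fun x => F (x, y)))//.
  exact: measurableT_comp.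
- exact: measurable_fun_fubini_tonelli_G.
- by move=> y _; apply: integral_ge0.
Qed.

Lemma integral_phi2 F : measurable_fun setT F -> (forall p, 0 <= F p) ->
  \int[mumu]_p F (p.1, phi p.2) = c * \int[mumu]_p F p.
Proof.
move=> mF F0; rewrite fubini_tonelli1//; last exact: (measurableT_comp mF measurable_phi2).
rewrite [in RHS]fubini_tonelli1// -ge0_integralZl//.
- apply: eq_integral => y _; rewrite /fubini_F /= (iphi (f := fun x => F (y, x)))//.
  exact: measurableT_comp.
- exact: measurable_fun_fubini_tonelli_F.
- by move=> y _; apply: integral_ge0.
Qed.

End change.

End double_integrals.

(** * Interactions and perimeters for a general kernel *)

Section perimeter.
Context d (T : measurableType d) (R : realType).
Variable mu : {sigma_finite_measure set T -> \bar R}.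
Local Open Scope ereal_scope.
Local Notation mumu := (mu \x mu).

Variable k : T -> T -> R.
Hypothesis mk : measurable_fun setT (fun p : T * T => k p.1 p.2).
Hypothesis k0 : forall x y, (0 <= k x y)%R.

Definition pairf (A B : set T) (p : T * T) : R := (\1_A p.1 * \1_B p.2 * k p.1 p.2)%R.

(** Integrating over the product measure instead of iterating integrals allows
    changes of variables in either argument. *)
Definition interaction (A B : set T) : \bar R := \int[mumu]_p (pairf A B p)%:E.

Lemma pairf_ge0 A B p : (0 <= pairf A B p)%R.
Proof. by rewrite /pairf !mulr_ge0. Qed.

Lemma measurable_pairf A B : measurable A -> measurable B ->
  measurable_fun setT (pairf A B).
Proof.
move=> mA mB.
have mI C (mC : measurable C) : measurable_fun setT (\1_C : T -> R) by exact: measurable_indic.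
apply: measurable_funM => //; apply: measurable_funM.
  exact: (measurableT_comp (mI _ mA) measurable_fst).
exact: (measurableT_comp (mI _ mB) measurable_snd).
Qed.

Lemma measurable_Epairf A B : measurable A -> measurable B ->
  measurable_fun setT (fun p => (pairf A B p)%:E).
Proof. by move=> mA mB; apply/measurable_EFinP; exact: measurable_pairf. Qed.

Lemma interaction_ge0 A B : 0 <= interaction A B.
Proof. by apply: integral_ge0 => p _; rewrite lee_fin pairf_ge0. Qed.

Lemma interactionE A B : measurable A -> measurable B ->
  \int[mu]_(x in A) \int[mu]_(y in B) (k x y)%:E = interaction A B.
Proof.
move=> mA mB; rewrite /interaction fubini_tonelli1; [|exact: measurable_Epairf|by move=> p; rewrite lee_fin pairf_ge0].
rewrite [LHS]integral_mkcond; apply: eq_integral => x _; rewrite /fubini_F patchE.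
case: ifPn => xA; last first.
  by rewrite integral0_eq// => y _; rewrite /pairf/= indicE (negbTE xA) !mul0r.
rewrite [LHS]integral_mkcond; apply: eq_integral => y _; rewrite patchE /pairf/= !indicE xA mul1r.
by case: ifPn => yB; rewrite ?mul1r ?mul0r.
Qed.

(** Changing the sets inside a null set of points changes the integrand only on
    a null set of pairs. *)
Lemma interaction_null_eq A B A' B' (Z : set T) :
  measurable A -> measurable B -> measurable A' -> measurable B' ->
  measurable Z -> mu Z = 0 ->
  (forall x, ~ Z x -> (x \in A) = (x \in A')) -> (forall x, ~ Z x -> (x \in B) = (x \in B')) ->
  interaction A B = interaction A' B'.
Proof.
move=> mA mB mA' mB' mZ Z0 AA' BB'.
apply: (integral_null_eq mZ Z0); [exact: measurable_Epairf|exact: measurable_Epairf| | |].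
- by move=> p; rewrite lee_fin pairf_ge0.
- by move=> p; rewrite lee_fin pairf_ge0.
- by move=> x y Zx Zy; rewrite /pairf /= !indicE AA'// BB'.
Qed.

Lemma interaction_preimage (phi : T -> T) (c : \bar R) (l : R) A B :
  measurable_fun setT phi ->
  (forall f : T -> \bar R, measurable_fun setT f -> (forall x, 0 <= f x) ->
     \int[mu]_x f (phi x) = c * \int[mu]_x f x) -> 0 <= c ->
  (0 <= l)%R -> (forall x y, k (phi x) (phi y) = l * k x y)%R ->
  measurable A -> measurable B ->
  l%:E * interaction (phi @^-1` A) (phi @^-1` B) = c * (c * interaction A B).
Proof.
move=> mphi iphi c0 l0 kphi mA mB.
have mF := measurable_Epairf mA mB.
have F0 p : 0 <= (pairf A B p)%:E by rewrite lee_fin pairf_ge0.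
rewrite /interaction -(integral_phi1 mphi iphi c0 mF F0).
have mG : measurable_fun setT (fun p : T * T => (pairf A B (phi p.1, p.2))%:E).
  exact: (measurableT_comp mF (measurable_phi1 mphi)).
rewrite -(integral_phi2 mphi iphi c0 mG) => [|p]; last exact: F0.
have mphiA : measurable (phi @^-1` A) by rewrite -[X in measurable X]setTI; exact: mphi.
have mphiB : measurable (phi @^-1` B) by rewrite -[X in measurable X]setTI; exact: mphi.
rewrite -ge0_integralZl//; last 2 first.
- exact: measurable_Epairf.
- by move=> p _; rewrite lee_fin pairf_ge0.
apply: eq_integral => p _; rewrite -EFinM /pairf/= kphi; congr _%:E.
rewrite !indicE /=.
rewrite (_ : (p.1 \in phi @^-1` A) = (phi p.1 \in A)); last by apply/idP/idP; rewrite !inE.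
rewrite (_ : (p.2 \in phi @^-1` B) = (phi p.2 \in B)); last by apply/idP/idP; rewrite !inE.
by rewrite mulrCA.
Qed.

Definition per E := interaction E (~` E).

(** A pair separated by [E `&` B] is either separated by [E], or has both points
    in [E] and is separated by [B]. *)
Lemma per_setI E B : measurable E -> measurable B ->
  per (E `&` B) <= per E + interaction (E `&` B) (E `\` B).
Proof.
move=> mE mB; have mEB := measurableI _ _ mE mB.
have mEC := measurableC mE; have mEBC := measurableC mEB; have mD := measurableD mE mB.
rewrite /per /interaction -ge0_integralD//; last 4 first.
- by move=> p _; rewrite lee_fin pairf_ge0.
- exact: measurable_Epairf.
- by move=> p _; rewrite lee_fin pairf_ge0.
- exact: measurable_Epairf.
apply: ge0_le_integral => //.
- by move=> p _; rewrite lee_fin pairf_ge0.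
- exact: measurable_Epairf.
- by apply: emeasurable_funD; exact: measurable_Epairf.
- move=> p _; rewrite -EFinD lee_fin -mulrDl ler_wpM2r// setDE !indicE !in_setI !in_setC !in_setI.
  by case: (p.1 \in E); case: (p.1 \in B); case: (p.2 \in E); case: (p.2 \in B) => /=; lra.
Qed.

End perimeter.

(** * Polarization *)

(** Two-point inequality for the four pairs formed by x, y and their mirror
    images. Here [hx] and [hy] say whether x and y lie in the half-space, [a],
    [a'], [b], [b'] whether x, its image, y and its image lie in the set, and
    [k1], [k2] are the kernels at (x, y) and (x, image of y). The left-hand side
    belongs to the polarized set and contains the gain [m]. *)
Lemma fold_ineq (R : realType) (hx hy a a' b b' : bool) (k1 k2 m : R) :
  (if hx == hy then k2 < k1 else k1 < k2) ->
  (hx -> hy -> m <= k1 - k2) ->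
  (if hx then a || a' else a && a')%:R * (~~ (if hy then b || b' else b && b'))%:R * k1 +
  (if ~~ hx then a' || a else a' && a)%:R * (~~ (if hy then b || b' else b && b'))%:R * k2 +
  ((if hx then a || a' else a && a')%:R * (~~ (if ~~ hy then b' || b else b' && b))%:R * k2 +
   (if ~~ hx then a' || a else a' && a)%:R * (~~ (if ~~ hy then b' || b else b' && b))%:R * k1) +
  [&& hx, a & ~~ a']%:R * [&& hy, ~~ b & b']%:R * m <=
  a%:R * (~~ b)%:R * k1 + a'%:R * (~~ b)%:R * k2 +
  (a%:R * (~~ b')%:R * k2 + a'%:R * (~~ b')%:R * k1).
Proof.
case: hx; case: hy => /= h hm; try (have {}hm := hm isT isT);
  case: a; case: a'; case: b; case: b' => /=; rewrite ?(mul0r, mul1r, mulr0, mulr1, add0r, addr0); lra.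
Qed.

(** The reflection is an abstract measure-preserving involution [sigma] that
    exchanges [H] with its complement off the null set [P], the hyperplane. *)
Section polarization.
Context d (T : measurableType d) (R : realType).
Variable mu : {sigma_finite_measure set T -> \bar R}.
Local Open Scope ereal_scope.
Local Notation mumu := (mu \x mu).

Variable k : T -> T -> R.
Hypothesis mk : measurable_fun setT (fun p : T * T => k p.1 p.2).
Hypothesis k0 : forall x y, (0 <= k x y)%R.

Variables (sigma : T -> T) (H P : set T).
Hypothesis msigma : measurable_fun setT sigma.
Hypothesis isigma : forall f : T -> \bar R, measurable_fun setT f -> (forall x, 0 <= f x) ->
  \int[mu]_x f (sigma x) = 1 * \int[mu]_x f x.
Hypothesis sigmaK : involutive sigma.
Hypothesis mH : measurable H.
Hypothesis mP : measurable P.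
Hypothesis P0 : mu P = 0.
Hypothesis HP : forall x, ~ P x -> (sigma x \in H) = (x \notin H).
Hypothesis kS : forall x y, k (sigma x) (sigma y) = k x y.
Hypothesis kH : forall x y, H x -> H y -> x <> y -> (k x (sigma y) < k x y)%R.

Definition polarize (E : set T) : set T :=
  [set x | if x \in H then (x \in E) || (sigma x \in E) else (x \in E) && (sigma x \in E)].

(** Polarization leaves these points in place and moves the mirror images of
    those of [pol_moved] into [H]; both sets are described by their trace on
    [H]. *)
Definition pol_kept (E : set T) : set T := [set x | [&& x \in H, x \in E & sigma x \notin E]].
Definition pol_moved (E : set T) : set T := [set x | [&& x \in H, x \notin E & sigma x \in E]].

Let in_pol E x : (x \in polarize E) =
  (if x \in H then (x \in E) || (sigma x \in E) else (x \in E) && (sigma x \in E)).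
Proof. by rewrite /polarize; apply/idP/idP; rewrite inE. Qed.

Let in_pol_kept E x : (x \in pol_kept E) = [&& x \in H, x \in E & sigma x \notin E].
Proof. by rewrite /pol_kept; apply/idP/idP; rewrite inE. Qed.

Let in_pol_moved E x : (x \in pol_moved E) = [&& x \in H, x \notin E & sigma x \in E].
Proof. by rewrite /pol_moved; apply/idP/idP; rewrite inE. Qed.

Let in_pre E x : (x \in sigma @^-1` E) = (sigma x \in E).
Proof. by apply/idP/idP; rewrite !inE. Qed.

Lemma measurable_presigma E : measurable E -> measurable (sigma @^-1` E).
Proof. by move=> mE; rewrite -[X in measurable X]setTI; exact: msigma. Qed.

Lemma measurable_polarize E : measurable E -> measurable (polarize E).
Proof.
move=> mE; have mE' := measurable_presigma mE.
rewrite (_ : polarize E = (E `&` sigma @^-1` E) `|` (H `&` (E `|` sigma @^-1` E))).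
  by apply: measurableU; apply: measurableI => //; exact: measurableU.
apply/seteqP; split=> x /mem_set xE; apply/set_mem; move: xE;
  rewrite in_pol !in_setU !in_setI !in_setU in_pre;
  by case: (x \in H); case: (x \in E); case: (sigma x \in E).
Qed.

Lemma measurable_pol_kept E : measurable E -> measurable (pol_kept E).
Proof.
move=> mE; have mE' := measurable_presigma mE.
rewrite (_ : pol_kept E = H `&` (E `&` ~` (sigma @^-1` E))).
  by apply: measurableI => //; apply: measurableI => //; exact: measurableC.
by apply/seteqP; split=> x /mem_set xE; apply/set_mem; move: xE;
  rewrite in_pol_kept !in_setI in_setC in_pre.
Qed.

Lemma measurable_pol_moved E : measurable E -> measurable (pol_moved E).
Proof.
move=> mE; have mE' := measurable_presigma mE.
rewrite (_ : pol_moved E = H `&` (~` E `&` (sigma @^-1` E))).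
  by apply: measurableI => //; apply: measurableI => //; exact: measurableC.
by apply/seteqP; split=> x /mem_set xE; apply/set_mem; move: xE;
  rewrite in_pol_moved !in_setI in_setC in_pre.
Qed.

(** The integrand of the perimeter summed over the four images of a pair under
    reflecting either point. *)
Definition foldf (E : set T) (p : T * T) : \bar R :=
  (pairf k E (~` E) p)%:E + (pairf k E (~` E) (sigma p.1, p.2))%:E +
  ((pairf k E (~` E) (p.1, sigma p.2))%:E + (pairf k E (~` E) (sigma p.1, sigma p.2))%:E).

Let F0 A B p : 0 <= (pairf k A B p)%:E.
Proof. by rewrite lee_fin pairf_ge0. Qed.

Lemma foldf_ge0 E p : 0 <= foldf E p.
Proof. by rewrite /foldf !adde_ge0. Qed.

Lemma measurable_foldf E : measurable E -> measurable_fun setT (foldf E).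
Proof.
move=> mE; have mF := measurable_Epairf mk mE (measurableC mE).
have m1 := measurable_phi1 msigma.
have m2 := measurable_phi2 msigma.
apply: emeasurable_funD; apply: emeasurable_funD => //.
- exact: (measurableT_comp mF m1).
- exact: (measurableT_comp mF m2).
- exact: (measurableT_comp (measurableT_comp mF m1) m2).
Qed.

Lemma integral_foldf E : measurable E ->
  \int[mumu]_p foldf E p = 4%:E * per mu k E.
Proof.
move=> mE; have mF := measurable_Epairf mk mE (measurableC mE).
have m1 := measurable_phi1 msigma.
have m2 := measurable_phi2 msigma.
have mF1 := measurableT_comp mF m1.
have mF2 := measurableT_comp mF m2.
have mF12 := measurableT_comp mF1 m2.
have e1 := integral_phi1 msigma isigma lee01 mF (F0 E (~` E)).
have e2 := integral_phi2 msigma isigma lee01 mF (F0 E (~` E)).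
have e12 := integral_phi2 msigma isigma lee01 mF1 (fun p => F0 E (~` E) (sigma p.1, p.2)).
rewrite ge0_integralD//; last 4 first.
- by move=> p _; exact: adde_ge0.
- exact: emeasurable_funD.
- by move=> p _; exact: adde_ge0.
- exact: emeasurable_funD.
rewrite !ge0_integralD//.
rewrite e1 e2 e12 /= e1 !mul1e -/(interaction mu k E (~` E)) -/(per mu k E).
move: (interaction_ge0 mu k0 E (~` E)); rewrite -/(per mu k E).
case: (per mu k E) => [r _|_|//].
  by rewrite -!EFinD -EFinM; congr _%:E; ring.
by rewrite gt0_muley ?lte_fin.
Qed.

(** Pointwise comparison of the folded integrands by [fold_ineq]; the loss is
    the excess of the kernel on pairs formed by a kept and a moved point. *)
Lemma per_polarize_fold E : measurable E ->
  4%:E * per mu k (polarize E) +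
    \int[mumu]_p (\1_(pol_kept E) p.1 * \1_(pol_moved E) p.2 * Num.max 0 (k p.1 p.2 - k p.1 (sigma p.2)))%:E
  <= 4%:E * per mu k E.
Proof.
move=> mE; have mpE := measurable_polarize mE.
rewrite -!integral_foldf//.
have mG : measurable_fun setT (fun p : T * T =>
   (\1_(pol_kept E) p.1 * \1_(pol_moved E) p.2 * Num.max 0 (k p.1 p.2 - k p.1 (sigma p.2)))%:E).
  apply/measurable_EFinP; apply: measurable_funM.
    have mI C (mC : measurable C) : measurable_fun setT (\1_C : T -> R) by exact: measurable_indic.
    apply: measurable_funM.
      exact: (measurableT_comp (mI _ (measurable_pol_kept mE)) measurable_fst).
    exact: (measurableT_comp (mI _ (measurable_pol_moved mE)) measurable_snd).
  apply: measurable_maxr => //; apply: measurable_funB => //.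
  exact: (measurableT_comp mk (measurable_phi2 msigma)).
have G0 (p : T * T) : 0 <= (\1_(pol_kept E) p.1 * \1_(pol_moved E) p.2 * Num.max 0 (k p.1 p.2 - k p.1 (sigma p.2)))%:E.
  by rewrite lee_fin !mulr_ge0// le_max lexx.
rewrite -ge0_integralD//; last 2 first.
- by move=> p _; exact: foldf_ge0.
- exact: measurable_foldf.
apply: (integral_le_null mP P0).
- by apply: emeasurable_funD => //; exact: measurable_foldf.
- exact: measurable_foldf.
- by move=> p; rewrite adde_ge0// foldf_ge0.
- by move=> p; exact: foldf_ge0.
move=> x y Px Py; rewrite /foldf /pairf /=.
have kxy' : k (sigma x) y = k x (sigma y) by rewrite -kS sigmaK.
rewrite !kS kxy' -!EFinD lee_fin !indicE !in_setC !in_pol !in_pol_kept !in_pol_moved !sigmaK.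
rewrite !HP//.
have h1 : x \in H -> y \in H -> x <> y -> (k x (sigma y) < k x y)%R.
  by rewrite !inE; exact: kH.
have h2 : x \notin H -> y \notin H -> x <> y -> (k x (sigma y) < k x y)%R.
  move=> xH yH xy; have := @kH (sigma x) (sigma y); rewrite sigmaK kxy' kS; apply.
  - by apply/set_mem; rewrite HP.
  - by apply/set_mem; rewrite HP.
  - by move=> xy'; apply: xy; rewrite -[x]sigmaK xy' sigmaK.
have h3 : x \in H -> y \notin H -> x <> sigma y -> (k x y < k x (sigma y))%R.
  move=> xH yH xy; rewrite -[X in k x X]sigmaK; apply: kH => //; first exact/set_mem.
  by apply/set_mem; rewrite HP.
have h4 : x \notin H -> y \in H -> x <> sigma y -> (k x y < k x (sigma y))%R.
  move=> xH yH xy; rewrite -kxy' -kS; apply: kH; [by apply/set_mem; rewrite HP|exact/set_mem|].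
  by move=> xy'; apply: xy; rewrite -xy' sigmaK.
(* the kernel on the diagonal is unrelated to its other values, so pairs of
   equal or mirror points are treated apart *)
have [xy|xy] := pselect (x = y).
  rewrite -xy.
  case: (x \in H); case: (x \in E); case: (sigma x \in E) => /=; lra.
have [xsy|xsy] := pselect (x = sigma y).
  have -> : y = sigma x by rewrite xsy sigmaK.
  rewrite !sigmaK HP//.
  case: (x \in H); case: (x \in E); case: (sigma x \in E) => /=; lra.
move: h1 h2 h3 h4; move=> h1 h2 h3 h4; apply: fold_ineq.
  move: h1 h2 h3 h4.
  by case: (x \in H); case: (y \in H) => /= h1 h2 h3 h4;
    [exact: h1|exact: h3|exact: h4|exact: h2].
move=> xH yH; rewrite max_r// subr_ge0 ltW//; exact: h1.
Qed.

(** Of a point and its mirror image, the polarized set contains as many as the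
    original set does. *)
Lemma measure_polarize E : measurable E -> mu (polarize E) = mu E.
Proof.
move=> mE; have mpE := measurable_polarize mE.
have mI (C : set T) (mC : measurable C) : measurable_fun setT (fun x => (\1_C x : R)%:E).
  by apply/measurable_EFinP; exact: measurable_indic.
have I0 (C : set T) x : 0 <= (\1_C x : R)%:E by rewrite lee_fin.
have dbl (C : set T) : measurable C ->
    \int[mu]_x ((\1_C x)%:E + (\1_C (sigma x))%:E) = 2%:E * mu C.
  move=> mC; rewrite ge0_integralD//; [|exact: mI|exact: (measurableT_comp (mI _ mC) msigma)].
  rewrite (isigma (mI _ mC))//.
  by rewrite mul1e integral_indic// setIT -mule2n -mule_natl.
have e : 2%:E * mu (polarize E) = 2%:E * mu E.
  rewrite -!dbl//; apply: ae_eq_integral => //.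
  - by apply: emeasurable_funD; [exact: mI|exact: (measurableT_comp (mI _ mpE) msigma)].
  - by apply: emeasurable_funD; [exact: mI|exact: (measurableT_comp (mI _ mE) msigma)].
  - exists P; split => // x /=; apply: contra_notP => Px _.
    rewrite -!EFinD !indicE !in_pol HP// sigmaK; congr _%:E.
    by case: (x \in H); case: (x \in E); case: (sigma x \in E) => /=; lra.
have := congr1 (fun z => (2^-1)%:E * z) e.
by rewrite !muleA -EFinM mulVf// !mul1e.
Qed.

(** If polarization does not decrease the perimeter, the loss integral vanishes;
    its integrand is positive on [pol_kept E `*` pol_moved E]. *)
Lemma polarize_dichotomy E : measurable E -> per mu k E < +oo ->
  per mu k E <= per mu k (polarize E) -> mu (pol_kept E) = 0 \/ mu (pol_moved E) = 0.
Proof.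
move=> mE fin le_per.
have := per_polarize_fold mE.
have := interaction_ge0 mu k0 E (~` E); rewrite -/(per mu k E) => p0.
set J := \int[mumu]_p _ => fold.
have J0 : 0 <= J.
  by apply: integral_ge0 => p _; rewrite lee_fin !mulr_ge0// le_max lexx.
have pfin : per mu k E \is a fin_num by rewrite ge0_fin_numE.
have fin4 : 4%:E * per mu k E \is a fin_num by rewrite fin_numM.
have J00 : J = 0.
  apply/eqP; rewrite eq_le J0 andbT.
  rewrite -(@leeD2lE _ (4%:E * per mu k E))// adde0; apply: le_trans fold.
  by rewrite leeD2r// lee_pmul2l// ?lte_fin.
have mX := measurable_pol_kept mE; have mY := measurable_pol_moved mE.
have mI (C : set T) (mC : measurable C) : measurable_fun setT (\1_C : T -> R) by exact: measurable_indic.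
have mG : measurable_fun setT (fun p : T * T =>
   (\1_(pol_kept E) p.1 * \1_(pol_moved E) p.2 * Num.max 0 (k p.1 p.2 - k p.1 (sigma p.2)))%:E).
  apply/measurable_EFinP; apply: measurable_funM.
    apply: measurable_funM.
      exact: (measurableT_comp (mI _ mX) measurable_fst).
    exact: (measurableT_comp (mI _ mY) measurable_snd).
  apply: measurable_maxr => //; apply: measurable_funB => //.
  exact: (measurableT_comp mk (measurable_phi2 msigma)).
have : mumu (pol_kept E `*` pol_moved E) = 0.
  have := (ae_eq_integral_abs mumu measurableT mG).1.
  under eq_integral => p _ do rewrite abse_EFin ger0_norm ?mulr_ge0 ?le_max ?lexx//.
  move=> /(_ J00) [N [mN N0 hN]].
  apply/eqP; rewrite eq_le measure_ge0 andbT -N0.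
  apply: le_measure; rewrite ?inE//; first exact: measurableX.
  move=> [x y] [/= xX yY]; apply: hN => /= /(_ I) /eqP.
  rewrite eqe !indicE !mem_set// !mul1r => /eqP h.
  move: xX yY; rewrite /pol_kept /pol_moved /= => /and3P[xH xE _] /and3P[yH yE _].
  have xy : x <> y by move=> xy; rewrite xy (negbTE yE) in xE.
  have := kH (set_mem xH) (set_mem yH) xy.
  move=> lt; move: h; rewrite max_r ?subr_ge0 ?(ltW lt)// => /eqP.
  by rewrite subr_eq0 gt_eqF.
rewrite product_measure1E// => /eqP; rewrite mule_eq0 => /orP[] /eqP h; [left|right]; exact: h.
Qed.

End polarization.

(** * The coarea formula and cuts along superlevel sets *)

Lemma eq_indic (R : pzRingType) (T1 T2 : Type) (A : set T1) (B : set T2) x y :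
  (A x <-> B y) -> \1_A x = \1_B y :> R.
Proof.
move=> h; rewrite !indicE; suff -> : (x \in A) = (y \in B) by [].
by apply/idP/idP; rewrite !inE => /h.
Qed.

Section layers.
Context d (T : measurableType d) (R : realType).
Variable mu : {sigma_finite_measure set T -> \bar R}.
Local Open Scope ereal_scope.
Local Notation mumu := (mu \x mu).
Local Notation lam := (@lebesgue_measure R).

Variable k : T -> T -> R.
Hypothesis mk : measurable_fun setT (fun p : T * T => k p.1 p.2).
Hypothesis k0 : forall x y, (0 <= k x y)%R.
Hypothesis kC : forall x y, k x y = k y x.

Variable g : T -> measurableTypeR R.
Hypothesis mg : measurable_fun setT g.

Let TT := (T * T)%type.
Let TTR := (TT * measurableTypeR R)%type.

(** The triples (x, y, t) such that the superlevel set at t contains x but not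
    y; integrating the kernel over t first, or over (x, y) first, gives the two
    sides of the coarea formula. *)
Definition between : set TTR := [set q | (g q.1.2 <= q.2)%R && (q.2 < g q.1.1)%R].

Let mg1 : measurable_fun setT (fun q : TTR => g q.1.1).
Proof. exact: (measurableT_comp mg (measurableT_comp measurable_fst measurable_fst)). Qed.
Let mg2 : measurable_fun setT (fun q : TTR => g q.1.2).
Proof. exact: (measurableT_comp mg (measurableT_comp measurable_snd measurable_fst)). Qed.

Lemma measurable_between : measurable between.
Proof.
have m1 : measurable_fun setT (fun q : TTR => (g q.1.2 <= q.2)%R).
  by apply: measurable_fun_ler => //; exact: measurable_snd.
have m2 : measurable_fun setT (fun q : TTR => (q.2 < g q.1.1)%R).
  by apply: measurable_fun_ltr => //; exact: measurable_snd.
rewrite (_ : between = (fun q : TTR => (g q.1.2 <= q.2)%R) @^-1` [set true] `&`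
  (fun q : TTR => (q.2 < g q.1.1)%R) @^-1` [set true]).
  apply: measurableI; rewrite -[X in measurable X]setTI; [exact: m1|exact: m2].
by apply/seteqP; split => q; [move=> /andP[h1 h2]; split|move=> [h1 h2]; apply/andP; split].
Qed.

Definition layer (q : TTR) : R := (\1_between q * k q.1.1 q.1.2)%R.

Lemma layer_ge0 q : (0 <= layer q)%R.
Proof. by rewrite /layer mulr_ge0. Qed.

Lemma measurable_layer : measurable_fun setT layer.
Proof.
apply: measurable_funM.
  by apply: measurable_indic; exact: measurable_between.
exact: (measurableT_comp mk measurable_fst).
Qed.

Lemma measurable_Elayer : measurable_fun setT (fun q => (layer q)%:E).
Proof. by apply/measurable_EFinP; exact: measurable_layer. Qed.

Definition suplevel (t : R) : set T := [set x | (t < g x)%R].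

Lemma measurable_suplevel t : measurable (suplevel t).
Proof.
have m1 : measurable_fun setT (fun x : T => (t < g x)%R).
  by apply: measurable_fun_ltr => //; exact: measurable_cst.
rewrite (_ : suplevel t = (fun x : T => (t < g x)%R) @^-1` [set true]).
  by rewrite -[X in measurable X]setTI; exact: m1.
by [].
Qed.

Let layer_pairf t p : layer (p, t) = pairf k (suplevel t) (~` suplevel t) p.
Proof.
have es x : (x \in suplevel t) = (t < g x)%R by apply/idP/idP; rewrite inE.
have eb : ((p, t) \in between) = (g p.2 <= t)%R && (t < g p.1)%R by apply/idP/idP; rewrite inE.
rewrite /layer /pairf /=; congr (_ * _)%R; rewrite !indicE in_setC -natrM mulnb.
by rewrite eb !es -leNgt andbC.
Qed.

Lemma integral_layer_per t : \int[mumu]_p (layer (p, t))%:E = per mu k (suplevel t).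
Proof. by apply: eq_integral => p _; rewrite layer_pairf. Qed.

Lemma integral_layer p : \int[lam]_t (layer (p, t))%:E =
  (Num.max 0 (g p.1 - g p.2) * k p.1 p.2)%:E.
Proof.
rewrite /layer/=.
transitivity (\int[lam]_t ((k p.1 p.2)%:E * (\1_(`[g p.2, g p.1[%classic) t)%:E)).
  apply: eq_integral => t _; rewrite -EFinM.
  suff -> : \1_between (p, t) = \1_(`[g p.2, g p.1[%classic) t :> R by rewrite mulrC.
  by apply: eq_indic; rewrite /between/= in_itv.
rewrite ge0_integralZl//; [|by apply/measurable_EFinP; exact: measurable_indic|by rewrite lee_fin].
have -> : \int[lam]_t (\1_(`[g p.2, g p.1[%classic) t)%:E = lam (`[g p.2, g p.1[%classic).
  by rewrite integral_indic// setIT.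
rewrite lebesgue_measure_itv/= lte_fin.
rewrite EFinM muleC; congr (_ * _).
case: ltP => h; first by rewrite -EFinB max_r// subr_ge0 ltW.
by rewrite max_l// subr_le0.
Qed.

Lemma measurable_per_suplevel : measurable_fun setT (fun t : measurableTypeR R => per mu k (suplevel t)).
Proof.
have h := measurable_fun_fubini_tonelli_G (m1 := square mu) (fun q => (layer q)%:E) measurable_Elayer
  (fun q => layer_ge0 q).
by apply: eq_measurable_fun h => t _; rewrite /fubini_G integral_layer_per.
Qed.

Let measurable_half : measurable_fun setT (fun p : TT => (Num.max 0 (g p.1 - g p.2) * k p.1 p.2)%:E).
Proof.
apply/measurable_EFinP; apply: measurable_funM => //.
apply: measurable_maxr => //; apply: measurable_funB.
  exact: (measurableT_comp mg measurable_fst).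
exact: (measurableT_comp mg measurable_snd).
Qed.

Lemma measurable_difference_weight :
  measurable_fun setT (fun p : T * T => (`|g p.1 - g p.2| * k p.1 p.2)%:E).
Proof.
apply/measurable_EFinP; apply: measurable_funM => //.
apply: (measurableT_comp (@normr_measurable R setT)); apply: measurable_funB.
  exact: (measurableT_comp mg measurable_fst).
exact: (measurableT_comp mg measurable_snd).
Qed.

(** Tonelli's theorem yields the integral of the positive part of the
    difference; swapping the variables yields the negative part. *)
Lemma coarea : \int[mumu]_p (`|g p.1 - g p.2| * k p.1 p.2)%:E =
  2%:E * \int[lam]_t per mu k (suplevel t).
Proof.
pose Q (p : TT) := (Num.max 0 (g p.1 - g p.2) * k p.1 p.2)%:E.
have Q0 p : 0 <= Q p by rewrite lee_fin mulr_ge0// le_max lexx.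
have -> : \int[lam]_t per mu k (suplevel t) = \int[mumu]_p Q p.
  under eq_integral do rewrite -integral_layer_per.
  rewrite -(fubini_tonelli (m1 := square mu) (fun q => (layer q)%:E)).
  - by apply: eq_integral => p _; rewrite integral_layer.
  - exact: measurable_Elayer.
  - by move=> q; rewrite lee_fin layer_ge0.
rewrite mule_natl mule2n -[X in _ = X + _](integral_swap mu measurable_half Q0).
rewrite -ge0_integralD//; last 2 first.
- by move=> p _; exact: (Q0 (p.2, p.1)).
- apply: (measurableT_comp (f := Q) (g := fun p : T * T => (p.2, p.1))) => //.
  by apply/measurable_fun_pairP; split; [exact: measurable_snd|exact: measurable_fst].
apply: eq_integral => p _; rewrite /Q/= -EFinD (kC p.2) -mulrDl; congr (_ * _)%:E.
have [h|h] := leP (g p.1) (g p.2).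
  by rewrite ler0_norm ?subr_le0// max_r ?subr_ge0// max_l ?subr_le0// addr0 opprB.
by rewrite gtr0_norm ?subr_gt0// max_l ?subr_le0 ?ltW// max_r ?subr_ge0 ?ltW// add0r.
Qed.

Section truncation.
Variables (A C : set T) (b : R).
Hypotheses (mA : measurable A) (mC : measurable C).

(** The part of the perimeter created when [A] is cut along the boundary of a
    superlevel set, seen from [C]. *)
Definition cut_interaction t := interaction mu k (A `&` suplevel t) (C `\` suplevel t).

(** An upper bound of the integral over b <= t <= b + 1 of the integrands of
    [cut_interaction t]: the length of the t-interval separating two points is
    at most the minimum in this formula. *)
Definition cut_weight (p : T * T) : R :=
  (\1_(A `&` suplevel b) p.1 * \1_(C `\` suplevel (b + 1)) p.2 *
   (Num.min 1 `|g p.1 - g p.2| * k p.1 p.2))%R.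

Let window : set (measurableTypeR R) := `[b, (b + 1)%R]%classic.

Let mwindow : measurable window. Proof. exact: measurable_itv. Qed.

Let mIw : measurable_fun setT (\1_window : measurableTypeR R -> R).
Proof. exact: measurable_indic. Qed.

Let slice (q : TTR) : R := (\1_A q.1.1 * \1_C q.1.2 * \1_window q.2 * layer q)%R.

Let slice_ge0 q : (0 <= slice q)%R.
Proof. by rewrite /slice !mulr_ge0// layer_ge0. Qed.

Let measurable_slice : measurable_fun setT (fun q => (slice q)%:E).
Proof.
apply/measurable_EFinP; apply: measurable_funM; last exact: measurable_layer.
have mI (D : set T) (mD : measurable D) : measurable_fun setT (\1_D : T -> R) by exact: measurable_indic.
apply: measurable_funM.
  apply: measurable_funM.
    exact: (measurableT_comp (mI _ mA) (measurableT_comp measurable_fst measurable_fst)).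
  exact: (measurableT_comp (mI _ mC) (measurableT_comp measurable_snd measurable_fst)).
exact: (measurableT_comp mIw measurable_snd).
Qed.

Let integral_slice1 t : \int[mumu]_p (slice (p, t))%:E = (\1_window t)%:E * cut_interaction t.
Proof.
have mS := measurable_suplevel t.
rewrite /cut_interaction /interaction -ge0_integralZl//; last 2 first.
- apply: measurable_Epairf => //; [exact: measurableI|exact: measurableD].
- by move=> p _; rewrite lee_fin pairf_ge0.
apply: eq_integral => p _; rewrite -EFinM /slice /= layer_pairf /pairf setDE; congr _%:E.
by rewrite !indicE !in_setI in_setC -!mulnb !natrM; ring.
Qed.

Let integral_slice2 p : \int[lam]_t (slice (p, t))%:E <= (cut_weight p)%:E.
Proof.
have -> : \int[lam]_t (slice (p, t))%:E =
    (\1_A p.1 * \1_C p.2 * k p.1 p.2)%:E * lam (window `&` `[g p.2, g p.1[%classic).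
  have mw : measurable (window `&` `[g p.2, g p.1[%classic) by exact: measurableI.
  rewrite -[X in lam X]setIT -integral_indic// -ge0_integralZl//; last 2 first.
  - by apply/measurable_EFinP; exact: measurable_indic.
  - by rewrite lee_fin !mulr_ge0.
  apply: eq_integral => t _; rewrite -EFinM /slice /layer /=; congr _%:E.
  have -> : \1_between (p, t) = \1_(`[g p.2, g p.1[%classic) t :> R.
    by apply: eq_indic; rewrite /between/= in_itv.
  rewrite (_ : \1_(window `&` `[g p.2, g p.1[%classic) t =
    \1_window t * \1_(`[g p.2, g p.1[%classic) t)%R; first by ring.
  by rewrite !indicE in_setI -mulnb natrM.
have w0 : (0 <= Num.min 1 `|g p.1 - g p.2|)%R by rewrite le_min ler01/=.
have [h1|h1] := leP (g p.1) b.
  rewrite (_ : _ `&` _ = set0) ?measure0 ?mule0 ?lee_fin ?/cut_weight ?mulr_ge0//.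
  apply/seteqP; split => // t; rewrite /window/= !in_itv/= => -[/andP[bt _] /andP[_ tg]].
  by move: (le_lt_trans bt (lt_le_trans tg h1)); rewrite ltxx.
have [h2|h2] := ltP (b + 1)%R (g p.2).
  rewrite (_ : _ `&` _ = set0) ?measure0 ?mule0 ?lee_fin ?/cut_weight ?mulr_ge0//.
  apply/seteqP; split => // t; rewrite /window/= !in_itv/= => -[/andP[_ tb] /andP[gt _]].
  by move: (le_lt_trans (le_trans gt tb) h2); rewrite ltxx.
have -> : cut_weight p = (\1_A p.1 * \1_C p.2 * k p.1 p.2 * Num.min 1 `|g p.1 - g p.2|)%R.
  rewrite /cut_weight !indicE in_setI setDE in_setI in_setC.
  have -> : p.1 \in suplevel b by rewrite inE.
  have -> : p.2 \in suplevel (b + 1) = false.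
    by apply/negbTE; rewrite notin_setE /suplevel/= => /lt_le_trans/(_ h2); rewrite ltxx.
  by rewrite !andbT; ring.
rewrite [leRHS]EFinM; apply: lee_wpmul2l; first by rewrite lee_fin !mulr_ge0.
rewrite /Num.min; case: ifPn => _.
  apply: (@le_trans _ _ (lam window)); first by apply: measureIl.
  rewrite lebesgue_measure_itv/= lte_fin ltrDl ltr01 -EFinB lee_fin.
  by rewrite addrAC subrr add0r.
apply: (@le_trans _ _ (lam `[g p.2, g p.1[%classic)); first by apply: measureIr.
rewrite lebesgue_measure_itv/= lte_fin; case: ifPn => h; last by rewrite lee_fin.
by rewrite -EFinB lee_fin ler_norm.
Qed.

Lemma cut_weight_ge0 p : (0 <= cut_weight p)%R.
Proof. by rewrite /cut_weight !mulr_ge0// le_min ler01/=. Qed.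

Lemma measurable_cut_weight : measurable_fun setT (fun p => (cut_weight p)%:E).
Proof.
apply/measurable_EFinP; apply: measurable_funM; last first.
  apply: measurable_funM => //; apply: measurable_minr => //.
  apply: measurableT_comp => //; apply: measurable_funB.
    exact: (measurableT_comp mg measurable_fst).
  exact: (measurableT_comp mg measurable_snd).
have mI (D : set T) (mD : measurable D) : measurable_fun setT (\1_D : T -> R) by exact: measurable_indic.
have mS := measurable_suplevel b; have mS1 := measurable_suplevel (b + 1)%R.
apply: measurable_funM.
  exact: (measurableT_comp (mI _ (measurableI _ _ mA mS)) measurable_fst).
exact: (measurableT_comp (mI _ (measurableD mC mS1)) measurable_snd).
Qed.

(** Some level t with b <= t <= b + 1 is not worse than the average, up to
    [e]. *)
Lemma exists_cut (e : R) : (0 < e)%R -> \int[mumu]_p (cut_weight p)%:E < +oo ->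
  exists2 t, (b <= t <= b + 1)%R & cut_interaction t <= \int[mumu]_p (cut_weight p)%:E + e%:E.
Proof.
move=> e0 fin; apply: contrapT => no.
have W0 : 0 <= \int[mumu]_p (cut_weight p)%:E.
  by apply: integral_ge0 => p _; rewrite lee_fin /cut_weight !mulr_ge0// le_min ler01/=.
set W := \int[mumu]_p _ in fin no W0.
have wfin : W \is a fin_num by rewrite ge0_fin_numE.
have cutl t : window t -> W + e%:E <= cut_interaction t.
  move=> wt; rewrite leNgt; apply/negP => h; apply: no; exists t; last exact: ltW.
  by move: wt; rewrite /window/= in_itv.
(* if all cuts exceed the average by e, so does their integral over [b, b + 1] *)
have : W + e%:E <= W.
  have h1 : \int[lam]_t (\int[mumu]_p (slice (p, t))%:E) <= W.
    rewrite -(fubini_tonelli (m1 := square mu) (fun q => (slice q)%:E))//.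
    apply: ge0_le_integral => //.
    - by move=> p _; apply: integral_ge0 => t _; rewrite lee_fin.
    - exact: (measurable_fun_fubini_tonelli_F (fun q => (slice q)%:E)).
    - exact: measurable_cut_weight.
  apply: le_trans h1.
  have -> : W + e%:E = \int[lam]_t ((W + e%:E) * (\1_window t)%:E).
    rewrite ge0_integralZl//; last 2 first.
    - exact/measurable_EFinP.
    - by rewrite adde_ge0// lee_fin ltW.
    have -> : \int[lam]_t (\1_window t)%:E = lam window by rewrite integral_indic// setIT.
    by rewrite lebesgue_measure_itv/= lte_fin ltrDl ltr01 -EFinB (addrC b) addrK mule1.
  apply: ge0_le_integral => //.
  - by move=> t _; apply: mule_ge0; [apply: adde_ge0 => //; rewrite lee_fin ltW|rewrite lee_fin].
  - by apply: emeasurable_funM => //; apply/measurable_EFinP.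
  - exact: (measurable_fun_fubini_tonelli_G (m1 := square mu) (fun q => (slice q)%:E)).
  - move=> t _; rewrite integral_slice1 indicE.
    case: (boolP (t \in window)) => [/set_mem/cutl h|_]; last by rewrite mule0 mul0e.
    by rewrite mule1 mul1e.
by rewrite -[leRHS]adde0 leeD2lE// lee_fin leNgt e0.
Qed.

End truncation.

End layers.

(** * The anisotropic perimeter *)

Section borel_hull.
Variables (R : realType) (n : nat).
Local Notation V := 'rV[R]_n.
Local Notation vol := (lebesgueRV R n).
Local Notation T := (leb R n).

Lemma le_vol (A B : set V) : A `<=` B -> (vol A <= vol B)%E.
Proof. by move=> AB; apply: le_mu_ext. Qed.

Lemma vol_ge0 (A : set V) : (0 <= vol A)%E.
Proof. exact: mu_ext_ge0. Qed.

(** Intersect Borel sets that cover [A] with almost the same volume; they exist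
    by the definition of the outer measure. *)
Lemma borel_hull (A : set V) : (vol A < +oo)%E ->
  exists B : set V, [/\ borel_set B, A `<=` B & vol B = vol A].
Proof.
move=> Aoo; have Afin : vol A \is a fin_num by rewrite ge0_fin_numE ?vol_ge0.
have H (j : nat) : exists U : set V, [/\ borel_set U, A `<=` U & (vol U <= vol A + (j.+1%:R^-1)%:E)%E].
  have j0 : 0 < (j.+1%:R^-1 : R) by rewrite invr_gt0.
  have [_ [F [mF AF] <-] hF] := lb_ereal_inf_adherent j0 Afin.
  exists (\bigcup_k F k); split => //.
    by apply: (@bigcup_measurable _ (borelRV R n)) => k _; exact: mF.
  apply: le_trans (ltW hF).
  rewrite (_ : (\sum_(k <oo) borel_lebesgue R n (F k) = \sum_(k <oo) vol (F k))%E).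
    exact: outer_measure_sigma_subadditive.
  by apply: eq_eseriesr => k _; rewrite (lebesgueRV_borel (mF k)).2.
have [U hU] := choice H.
exists (\bigcap_j U j); split.
- by apply: (@bigcap_measurable _ (borelRV R n)) => [|j _]; [exists 0%N|have [] := hU j].
- by move=> x Ax j _; have [_ + _] := hU j; apply.
apply/eqP; rewrite eq_le; apply/andP; split; last first.
  by apply: le_vol => x Ax j _; have [_ + _] := hU j; apply.
apply/lee_addgt0Pr => e e0.
have [j je] : exists j : nat, j.+1%:R^-1 < e.
  exists (Num.truncn e^-1); rewrite invf_plt ?posrE//.
  exact: truncnS_gt.
have [_ _ hj] := hU j.
apply: (@le_trans _ _ (vol (U j))); first by apply: le_vol => x; exact.
by apply: le_trans hj _; rewrite leeD2l// lee_fin ltW.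
Qed.

End borel_hull.

Section anisotropic_perimeter.
Variables (R : realType) (n : nat).
Local Notation V := 'rV[R]_n.
Local Notation vol := (lebesgueRV R n).
Local Notation T := (leb R n).
Local Notation cube := (@cube R n).

Variables (K : set V) (s : R).
Hypotheses (n1 : (1 <= n)%N) (s01 : 0 < s < 1).
Hypotheses (Ku : unconditional K) (Ks : strictly_convex_body K).

Local Notation k := (kernelK K s).

Lemma kernelK_ge0 x y : 0 <= k x y.
Proof. exact: kern_ge0. Qed.

Lemma kernelKC x y : k x y = k y x.
Proof. by rewrite !kernelKE -(kernN s Ku Ks) opprB. Qed.

Definition kernelK_measurable := measurable_kernelK s Ku Ks.

(** The [perimeter] with its iterated integral replaced by one over the product
    measure; the two agree on measurable sets by [perimeterE]. *)
Definition vper (E : set V) : \bar R := per vol k (E : set T).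

Lemma perimeterE (E : set V) : measurable (E : set T) -> perimeter s E K = vper E.
Proof.
move=> mE; rewrite /perimeter /vper /per.
apply: (interactionE vol kernelK_measurable kernelK_ge0 mE); exact: measurableC.
Qed.

Lemma vper_ge0 E : (0 <= vper E)%E.
Proof. exact: (interaction_ge0 vol kernelK_ge0). Qed.

Lemma vper_null_eq (E E' Z : set V) : measurable (E : set T) -> measurable (E' : set T) ->
  measurable (Z : set T) -> vol Z = 0%E -> (forall x, ~ Z x -> E x <-> E' x) -> vper E = vper E'.
Proof.
move=> mE mE' mZ Z0 h.
have h1 x : ~ Z x -> (x \in E) = (x \in E').
  by move=> /h hx; apply/idP/idP; rewrite !inE => /hx.
apply: (interaction_null_eq kernelK_measurable kernelK_ge0 mE _ mE' _ mZ Z0 h1).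
- exact: measurableC.
- exact: measurableC.
- by move=> x Zx; rewrite !in_setC h1.
Qed.

Lemma vper_translate b (E : set V) : measurable (E : set T) -> vper (translate b E) = vper E.
Proof.
move=> mE; rewrite translateE /vper /per preimage_setC.
have := @interaction_preimage _ T R vol k kernelK_measurable kernelK_ge0 (fun x : V => x - b) 1%E 1 E (~` E)
   (measurable_shift (- b)).
rewrite !mul1e; apply => //.
- by move=> f mf f0; rewrite mul1e (integral_shift mf f0 (- b)).
- move=> x y; rewrite mul1r !kernelKE; congr kern.
  by rewrite opprB addrA subrK.
- exact: measurableC.
Qed.

(** Two changes of variables contribute [r ^ n] each, and the kernel is
    homogeneous of degree [- (n + s)]. *)
Lemma vper_dilate r (E : set V) : 0 < r -> measurable (E : set T) ->
  vper (dilate r E) = ((r `^ (n%:R - s))%:E * vper E)%E.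
Proof.
move=> r0 mE; have rN0 : r != 0 by rewrite gt_eqF.
have rV0 : r^-1 != 0 by rewrite invr_neq0.
rewrite dilateE// /vper /per preimage_setC.
have l0 : 0 <= r `^ (n%:R + s) by exact: powR_ge0.
have c0 : (0 <= (r ^+ n)%:E :> \bar R)%E by rewrite lee_fin exprn_ge0// ltW.
have ki x y : k (r^-1 *: x) (r^-1 *: y) = r `^ (n%:R + s) * k x y.
  rewrite !kernelKE -scalerBr (kernZ s Ku Ks) ?invr_gt0//; congr (_ * _).
  by rewrite -powRN -powR_inv1 ?ltW// -powRrM mulN1r opprK.
have ii f : measurable_fun setT (f : T -> \bar R) -> (forall x, 0 <= f x)%E ->
    (\int[vol]_x f (r^-1 *: (x : V))%R = (r ^+ n)%:E * \int[vol]_x f x)%E.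
  move=> mf f0; rewrite (integral_scale mf f0 rV0).
  by rewrite normfV gtr0_norm// exprVn invrK.
have := @interaction_preimage _ T R vol k kernelK_measurable kernelK_ge0 (fun x : V => r^-1 *: x) (r ^+ n)%:E
  (r `^ (n%:R + s)) E (~` E) (measurable_scale rV0) ii c0 l0 ki mE (measurableC mE).
set X := interaction _ _ _ _; set Y := interaction _ _ _ _ => e.
have p0 : r `^ (n%:R + s) != 0 by rewrite gt_eqF// powR_gt0.
have -> : X = ((r `^ (n%:R + s))^-1%:E * ((r `^ (n%:R + s))%:E * X))%E.
  by rewrite muleA -EFinM mulVf// mul1e.
rewrite e !muleA -!EFinM; congr (_%:E * _)%E.
rewrite -powRN -(powR_mulrn _ (ltW r0)) -!powRD ?rN0 ?implybT//.
by congr (_ `^ _); ring.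
Qed.

Lemma kern1_ge0 z : 0 <= kern1 K s z.
Proof. by rewrite /kern1 mulr_ge0 ?kern_ge0// le_min ler01/=. Qed.

Definition kern1_mass : \bar R := (\int[vol]_z (kern1 K s z)%:E)%E.

Lemma kern1_mass_fin : kern1_mass \is a fin_num.
Proof.
rewrite ge0_fin_numE; first exact: (integral_kern1_lty s01 Ku Ks).
by apply: integral_ge0 => z _; rewrite lee_fin kern1_ge0.
Qed.

Lemma kern1N z : kern1 K s (- z) = kern1 K s z.
Proof. by rewrite /kern1 normrN (kernN s Ku Ks). Qed.

Lemma measurable_kern1_leb : measurable_fun setT (fun z : T => (kern1 K s z)%:E).
Proof.
apply/measurable_EFinP.
exact: (measurableT_comp (measurable_kern1 s Ku Ks) (@measurable_leb_borel R n)).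
Qed.

Lemma measurable_kern1_sub : measurable_fun setT (fun p : T * T => kern1 K s ((p.1 : V) - p.2)).
Proof. exact: (measurableT_comp (measurable_kern1 s Ku Ks) (@measurable_sub R n)). Qed.

Lemma integral_kern1_left (G : set T) : measurable G ->
  (\int[vol \x vol]_p (\1_G p.1 * kern1 K s ((p.1 : V) - p.2)%R)%:E = vol G * kern1_mass)%E.
Proof.
move=> mG.
have mI : measurable_fun setT (\1_G : T -> R) by exact: measurable_indic.
have mF : measurable_fun setT (fun p : T * T => (\1_G p.1 * kern1 K s ((p.1 : V) - p.2)%R)%:E).
  apply/measurable_EFinP; apply: measurable_funM; last exact: measurable_kern1_sub.
  exact: (measurableT_comp mI measurable_fst).
rewrite fubini_tonelli1; [|exact: mF|by move=> p; rewrite lee_fin mulr_ge0 ?kern1_ge0].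
rewrite (_ : vol G = \int[vol]_x (\1_G x)%:E)%E; last by rewrite integral_indic ?setIT.
have K10 : (0 <= kern1_mass)%E by apply: integral_ge0 => z _; rewrite lee_fin kern1_ge0.
rewrite -ge0_integralZr; [|exact: measurableT|exact/measurable_EFinP|by move=> x _; rewrite lee_fin|exact: K10].
apply: eq_integral => x _; rewrite /fubini_F /=.
under eq_integral do rewrite EFinM.
rewrite ge0_integralZl; [|exact: measurableT| |by move=> y _; rewrite lee_fin kern1_ge0|by rewrite lee_fin].
  have e : (\int[vol]_y (kern1 K s ((x : V) - y)%R)%:E = kern1_mass)%E.
    have := integral_pointrefl measurable_kern1_leb _ x; apply.
    by move=> z; rewrite lee_fin kern1_ge0.
  exact: (f_equal (fun z => ((\1_G x)%:E * z)%E) e).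
apply: (measurableT_comp measurable_kern1_leb (measurable_opp x)).
Qed.

Lemma integral_kern1_right (G : set T) : measurable G ->
  (\int[vol \x vol]_p (\1_G p.2 * kern1 K s ((p.1 : V) - p.2)%R)%:E = vol G * kern1_mass)%E.
Proof.
move=> mG; rewrite -(integral_kern1_left mG).
have mI : measurable_fun setT (\1_G : T -> R) by exact: measurable_indic.
have mF : measurable_fun setT (fun p : T * T => (\1_G p.1 * kern1 K s ((p.1 : V) - p.2)%R)%:E).
  apply/measurable_EFinP; apply: measurable_funM; last exact: measurable_kern1_sub.
  exact: (measurableT_comp mI measurable_fst).
rewrite -(integral_swap vol mF); last by move=> p; rewrite lee_fin mulr_ge0 ?kern1_ge0.
by apply: eq_integral => p _ /=; rewrite -opprB kern1N.
Qed.

End anisotropic_perimeter.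

(** * Truncation by cubes *)

(** Cubes centred at the origin are the superlevel sets of [- |x|], so the cuts
    along superlevel sets become truncations by cubes. *)
Section tail_truncation.
Variables (R : realType) (n : nat).
Local Notation V := 'rV[R]_n.
Local Notation vol := (lebesgueRV R n).
Local Notation T := (leb R n).
Local Notation cube := (@cube R n).

Variables (K : set V) (s : R).
Hypotheses (n1 : (1 <= n)%N) (s01 : 0 < s < 1).
Hypotheses (Ku : unconditional K) (Ks : strictly_convex_body K).

Local Notation k := (kernelK K s).
Local Notation mk := (kernelK_measurable s Ku Ks).
Local Notation k0 := (@kernelK_ge0 R n K s).
Local Notation kC := (kernelKC s Ku Ks).
Local Notation vper := (vper K s).
Local Notation D := (kern1_mass K s).

Let g (x : T) : measurableTypeR R := - `|x : V|.

Lemma measurable_negnorm : measurable_fun setT g.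
Proof.
have mN := measurableT_comp (@measurable_norm_rV R n) (@measurable_leb_borel R n).
rewrite (_ : g = fun x : T => 0 - `|x : V|); last by apply/funext => x; rewrite sub0r.
by apply: measurable_funB; [exact: measurable_cst|exact: mN].
Qed.

Lemma measurable_cube r : measurable (cube r : set T).
Proof. by apply: borel_measurable; exact: borel_cube. Qed.

Lemma suplevel_cube t : suplevel g t = cube (- t).
Proof. by apply/seteqP; split=> x; rewrite /suplevel /cube /g /= ltrNr. Qed.

Lemma kern1_mass_ge0 : (0 <= D)%E.
Proof. by apply: integral_ge0 => z _; rewrite lee_fin (kern1_ge0 K s). Qed.

Lemma min_norm_kern (x y : V) : Num.min 1 `|g x - g y| * k x y <= kern1 K s (x - y).
Proof.
rewrite /kern1 kernelKE ler_wpM2r ?kern_ge0//.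
rewrite le_min ge_min lexx/= ge_min; apply/orP; right.
by rewrite /g opprK addrC distrC ler_dist_dist.
Qed.

Lemma integral_cut_weight_le (A C G : set T) b :
  measurable A -> measurable C -> measurable G ->
  (forall p : T * T, \1_(A `&` suplevel g b) p.1 * \1_(C `\` suplevel g (b + 1)) p.2 <= \1_G p.1 :> R) ->
  (\int[vol \x vol]_p (cut_weight (k : T -> T -> R) g A C b p)%:E <= vol G * D)%E.
Proof.
move=> mA mC mG h; rewrite -(integral_kern1_left s Ku Ks mG).
have mI : measurable_fun setT (\1_G : T -> R) by exact: measurable_indic.
apply: ge0_le_integral.
- exact: measurableT.
- by move=> p _; rewrite lee_fin; exact: (@cut_weight_ge0 _ T R (kernelK K s) k0 g A C b p).
- exact: (measurable_cut_weight mk measurable_negnorm b mA mC).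
- apply/measurable_EFinP; apply: measurable_funM; last exact: (measurable_kern1_sub s Ku Ks).
  exact: (measurableT_comp mI measurable_fst).
- move=> p _; rewrite lee_fin /cut_weight; apply: ler_pM => //.
  + by apply: mulr_ge0; [rewrite le_min ler01/=|exact: k0].
  + exact: min_norm_kern.
Qed.

Lemma integral_cut_weight_ler (A C G : set T) b :
  measurable A -> measurable C -> measurable G ->
  (forall p : T * T, \1_(A `&` suplevel g b) p.1 * \1_(C `\` suplevel g (b + 1)) p.2 <= \1_G p.2 :> R) ->
  (\int[vol \x vol]_p (cut_weight (k : T -> T -> R) g A C b p)%:E <= vol G * D)%E.
Proof.
move=> mA mC mG h; rewrite -(integral_kern1_right s Ku Ks mG).
have mI : measurable_fun setT (\1_G : T -> R) by exact: measurable_indic.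
apply: ge0_le_integral.
- exact: measurableT.
- by move=> p _; rewrite lee_fin; exact: (@cut_weight_ge0 _ T R (kernelK K s) k0 g A C b p).
- exact: (measurable_cut_weight mk measurable_negnorm b mA mC).
- apply/measurable_EFinP; apply: measurable_funM; last exact: (measurable_kern1_sub s Ku Ks).
  exact: (measurableT_comp mI measurable_snd).
- move=> p _; rewrite lee_fin /cut_weight; apply: ler_pM => //.
  + by apply: mulr_ge0; [rewrite le_min ler01/=|exact: k0].
  + exact: min_norm_kern.
Qed.

(** The average perimeter of the cubes of half-side between 1 and 2 is
    finite. *)
Lemma finite_perimeter_cube : exists2 r, 0 < r & (vper (cube r) < +oo)%E.
Proof.
(* the levels t in [-2, -1] are the cubes of half-side in [1, 2] *)
have W : (\int[vol \x vol]_p (cut_weight (k : T -> T -> R) g setT setT (-2) p)%:E <= vol (cube 2) * D)%E.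
  apply: integral_cut_weight_le; [exact: measurableT|exact: measurableT|exact: measurable_cube|].
  move=> p; rewrite setTI suplevel_cube opprK.
  by rewrite !indicE; case: (_ \in cube 2); case: (_ \in _); rewrite /=; lra.
have Woo : (\int[vol \x vol]_p (cut_weight (k : T -> T -> R) g setT setT (-2) p)%:E < +oo)%E.
  apply: le_lt_trans W _; rewrite vol_cube//.
  by rewrite -(fineK (kern1_mass_fin s01 Ku Ks)) -EFinM ltry.
have [t /andP[t2 t1] ht] := @exists_cut _ T R vol (kernelK K s) mk k0 g measurable_negnorm _ _ _ measurableT measurableT _ ltr01 Woo.
exists (- t).
  by rewrite oppr_gt0 (le_lt_trans t1)// addrC subr_lt0 ltr1n.
move: ht; rewrite /cut_interaction setTI setTD suplevel_cube => ht.
apply: le_lt_trans ht _.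
by rewrite lte_add_pinfty// ltry.
Qed.

(** Choose the half-side between [r] and [r + 1] by averaging; the new boundary
    interacts only with the part of [E] outside [cube r]. *)
Lemma truncate_perimeter (E : set T) (r e : R) : measurable E -> (vol E < +oo)%E -> 0 < e ->
  exists2 rho, r <= rho & (vper (E `&` cube rho) <= vper E + (vol (E `\` cube r) * D + e%:E))%E.
Proof.
move=> mE Eoo e0; set b := - (r + 1).
have mEr : measurable (E `\` cube r : set T) by apply: measurableD => //; exact: measurable_cube.
have W : (\int[vol \x vol]_p (cut_weight (k : T -> T -> R) g E E b p)%:E <= vol (E `\` cube r) * D)%E.
  apply: integral_cut_weight_ler => //.
  move=> p; rewrite (suplevel_cube (b + 1)) (_ : - (b + 1) = r); last by rewrite /b; ring.
  by rewrite ler_piMl// indicE; case: (_ \in _).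
have Woo : (\int[vol \x vol]_p (cut_weight (k : T -> T -> R) g E E b p)%:E < +oo)%E.
  apply: le_lt_trans W _.
  have fE : vol (E `\` cube r) \is a fin_num.
    rewrite ge0_fin_numE ?vol_ge0//; apply: le_lt_trans Eoo; apply: le_vol; exact: subDsetl.
  by rewrite -(fineK (kern1_mass_fin s01 Ku Ks)) -(fineK fE) -EFinM ltry.
have [t /andP[t1 t2] ht] := @exists_cut _ T R vol (kernelK K s) mk k0 g measurable_negnorm _ _ _ mE mE _ e0 Woo.
exists (- t).
  by move: t2; rewrite /b lerNr => /le_trans; apply; rewrite opprD addrNK.
have := per_setI vol mk k0 mE (measurable_cube (- t)).
rewrite -/(vper _) -suplevel_cube => /le_trans; apply.
apply: leeD => //.
by apply: le_trans ht _; rewrite leeD2r.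
Qed.

End tail_truncation.

(** * The isoperimetric inequality for sets of finite volume *)

Section minimizer.
Variables (R : realType) (n : nat).
Local Notation V := 'rV[R]_n.
Local Notation vol := (lebesgueRV R n).
Local Notation T := (leb R n).
Local Notation cube := (@cube R n).

Variables (K : set V) (s : R).
Hypotheses (n1 : (1 <= n)%N) (s01 : 0 < s < 1).
Hypotheses (Ku : unconditional K) (Ks : strictly_convex_body K).
Variable M : set V.
Hypothesis Mmin : minimizer s K M.

Local Notation vper := (vper K s).
Local Notation D := (kern1_mass K s).
Let alpha := (n%:R - s) / n%:R.

Lemma minimizer_bounded : bounded_set M. Proof. by case: Mmin => -[]. Qed.
Lemma minimizer_borel : borel_set M. Proof. by case: Mmin => -[]. Qed.
Lemma minimizer_vol_gt0 : (0 < vol M)%E. Proof. by case: Mmin => -[]. Qed.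
Lemma minimizer_measurable : measurable (M : set T).
Proof. by apply: borel_measurable; exact: minimizer_borel. Qed.
Lemma minimizer_vol_fin : vol M \is a fin_num.
Proof. by rewrite ge0_fin_numE ?vol_ge0// vol_lty_bounded//; exact: minimizer_bounded. Qed.

Let v := fine (vol M).
Lemma minimizer_vol : vol M = v%:E. Proof. by rewrite fineK//; exact: minimizer_vol_fin. Qed.
Let v0 : 0 < v.
Proof. by rewrite -lte_fin -minimizer_vol; exact: minimizer_vol_gt0. Qed.

Lemma alpha01 : 0 < alpha <= 1.
Proof.
case/andP: s01 => s0 s1; have nR : (1 : R) <= n%:R by rewrite ler1n.
have nR0 : (0 : R) < n%:R by apply: lt_le_trans nR.
rewrite /alpha; apply/andP; split.
  by rewrite divr_gt0// subr_gt0 (lt_le_trans s1).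
by rewrite ler_pdivrMr// mul1r gerBl ltW.
Qed.

Lemma ratioE (E : set V) : admissible E ->
  isoperimetric_ratio s K E = (vper E * ((fine (vol E) `^ alpha)^-1)%:E)%E.
Proof.
move=> [bE mE E0]; rewrite /isoperimetric_ratio perimeterE//; last exact: borel_measurable.
by rewrite poweRN// ge0_fin_numE ?vol_ge0// vol_lty_bounded.
Qed.

Lemma minimizer_le_ratio (E : set V) : admissible E ->
  (vper M * ((v `^ alpha)^-1)%:E <= vper E * ((fine (vol E) `^ alpha)^-1)%:E)%E.
Proof.
move=> aE; rewrite -!ratioE//; last by case: Mmin.
case: Mmin => _ ->; apply: ereal_inf_lbound; by exists E.
Qed.

Lemma vol_cube_gt0 r : 0 < r -> (0 < vol (cube r))%E.
Proof. by move=> r0; rewrite vol_cube// lte_fin exprn_gt0// mulr_gt0. Qed.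

Lemma admissible_cube r : 0 < r -> admissible (cube r).
Proof.
move=> r0; split; [|exact: borel_cube|exact: vol_cube_gt0].
by apply/bounded_setP; exists r.
Qed.

(** Compare with a cube of finite perimeter. *)
Lemma minimizer_per_fin : vper M \is a fin_num.
Proof.
have [r r0 rfin] := finite_perimeter_cube s01 Ku Ks.
rewrite ge0_fin_numE; last exact: vper_ge0.
have h := minimizer_le_ratio (admissible_cube r0).
have w0 : 0 < (v `^ alpha)^-1 by rewrite invr_gt0 powR_gt0.
rewrite ltey; apply/eqP => Moo; move: h; rewrite Moo gt0_mulye ?lte_fin// leye_eq.
have cfin : vper (cube r) \is a fin_num by rewrite ge0_fin_numE ?vper_ge0.
by rewrite -(fineK cfin) -EFinM.
Qed.

Let p := fine (vper M).
Lemma minimizer_per : vper M = p%:E. Proof. by rewrite fineK//; exact: minimizer_per_fin. Qed.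
Let p0 : 0 <= p. Proof. by rewrite -lee_fin -minimizer_per vper_ge0. Qed.

Lemma isoperimetric_admissible (E : set V) : admissible E ->
  ((p * (fine (vol E) / v) `^ alpha)%:E <= vper E)%E.
Proof.
move=> aE; have [bE mE E0] := aE.
have Efin : vol E \is a fin_num by rewrite ge0_fin_numE ?vol_ge0// vol_lty_bounded.
have e0 : 0 < fine (vol E) by rewrite -lte_fin fineK.
have := minimizer_le_ratio aE; rewrite minimizer_per -EFinM.
have q0 : 0 < fine (vol E) `^ alpha by rewrite powR_gt0.
rewrite muleC -lee_pdivrMl ?invr_gt0// invrK -EFinM => h.
apply: le_trans h; rewrite lee_fin.
rewrite powRM ?invr_ge0 ?(ltW e0) ?(ltW v0)// (_ : v^-1 `^ alpha = (v `^ alpha)^-1).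
  by rewrite mulrCA.
by rewrite -powRN -powR_inv1 ?(ltW v0)// -powRrM mulN1r.
Qed.

Lemma measurable_borel_eq (E : set T) : measurable E -> (vol E < +oo)%E ->
  exists B : set V, [/\ borel_set B, E `<=` B, vol B = vol E & vol (B `\` E) = 0%E].
Proof.
move=> mE Eoo; have [B [bB EB BE]] := borel_hull Eoo; exists B; split => //.
have mB := borel_measurable bB.
have Efin : vol E \is a fin_num by rewrite ge0_fin_numE ?vol_ge0.
have : vol B = (vol E + vol (B `\` E))%E.
  rewrite -measureU//; last 2 first.
  - exact: measurableD.
  - by apply/seteqP; split=> // x [Ex []].
  by congr (vol _); rewrite setDUK.
rewrite BE => h; have := congr1 (fun z => (z - vol E)%E) h.
by rewrite subee// addeAC subee// add0e => <-.
Qed.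

(** Replace the set by a Borel set containing it and of the same volume, still
    inside a cube. *)
Lemma isoperimetric_bounded (E : set V) : measurable (E : set T) -> bounded_set E ->
  ((p * (fine (vol E) / v) `^ alpha)%:E <= vper E)%E.
Proof.
move=> mE bE; have Eoo := vol_lty_bounded bE.
have Efin : vol E \is a fin_num by rewrite ge0_fin_numE ?vol_ge0.
have [E0|E0] := leP (vol E) 0%E.
  have -> : vol E = 0%E by apply/eqP; rewrite eq_le E0 vol_ge0.
  by rewrite mul0r powR0 ?mulr0 ?vper_ge0// gt_eqF//; case/andP: alpha01.
have [B [bB EB BE BD]] := measurable_borel_eq mE Eoo.
have [r r0 Er] := (bounded_setP E).1 bE.
pose B' := B `&` cube r.
have bB' : borel_set B' by apply: (@measurableI _ (borelRV R n)) => //; exact: borel_cube.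
have EB' : E `<=` B' by move=> x Ex; split; [exact: EB|exact: Er].
have B'E : vol B' = vol E.
  apply/eqP; rewrite eq_le; apply/andP; split; last exact: le_vol.
  by rewrite -BE; apply: le_vol => x [].
have mB' := borel_measurable bB'.
rewrite (@vper_null_eq _ _ K s Ku Ks E B' (B `\` E))//.
- rewrite -B'E; apply: isoperimetric_admissible; split => //; last by rewrite B'E.
  by apply/bounded_setP; exists r => // x [].
- by apply: measurableD => //; exact: borel_measurable.
- move=> x nx; split; first exact: EB'.
  by move=> [Bx _]; apply: contrapT => nE; apply: nx.
Qed.

Lemma vol_cut_small (E : set T) (d : R) : measurable E -> (vol E < +oo)%E -> 0 < d ->
  exists2 r : R, 0 < r & (vol (E `\` cube r) <= d%:E)%E.
Proof.
move=> mE Eoo d0.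
pose F (j : nat) : set T := E `\` cube j%:R.
have mF j : measurable (F j) by apply: measurableD => //; exact: measurable_cube.
have F0 : \bigcap_j F j = set0.
  apply/seteqP; split=> // x h.
  have [_] := h (Num.truncn `|x : V|).+1 I; apply; rewrite /cube /=.
  exact: truncnS_gt.
have ndF : nonincreasing_seq F.
  move=> i j ij; apply/subsetPset => x [Ex nx]; split=> // xi; apply: nx.
  by rewrite /cube /=; apply: lt_le_trans xi _; rewrite ler_nat.
have F0oo : (vol (F 0%N) < +oo)%E.
  by apply: le_lt_trans Eoo; apply: le_vol => x [].
have mIF : measurable (\bigcap_j F j) by rewrite F0.
have := nonincreasing_cvg_mu F0oo mF mIF ndF.
rewrite F0 measure0 => /fine_cvgP[_ /cvgrPdist_le /(_ _ d0)] [N _ hN].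
exists N.+1%:R; first by [].
have Ffin : vol (F N.+1) \is a fin_num.
  by rewrite ge0_fin_numE ?vol_ge0//; apply: le_lt_trans Eoo; apply: le_vol => x [].
have := hN N.+1 (leqnSn N); rewrite /= sub0r normrN => h.
by rewrite -(fineK Ffin) lee_fin (le_trans (ler_norm _)).
Qed.

(** Truncate by a cube that loses volume at most [d] and gains perimeter at most
    a multiple of [d], and let [d] tend to 0. *)
Lemma isoperimetric (E : set T) : measurable E -> (vol E < +oo)%E ->
  ((p * (fine (vol E) / v) `^ alpha)%:E <= vper E)%E.
Proof.
move=> mE Eoo.
have Efin : vol E \is a fin_num by rewrite ge0_fin_numE ?vol_ge0.
have [E0|E0] := leP (vol E) 0%E.
  have -> : vol E = 0%E by apply/eqP; rewrite eq_le E0 vol_ge0.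
  by rewrite mul0r powR0 ?mulr0 ?vper_ge0// gt_eqF//; case/andP: alpha01.
set e := fine (vol E); have e0 : 0 < e by rewrite -lte_fin fineK.
set c := p * (e / v) `^ alpha.
have c0 : 0 <= c by rewrite mulr_ge0 ?powR_ge0.
have Df := kern1_mass_fin s01 Ku Ks; have D0 := kern1_mass_ge0 K s.
pose Q := fine D + c / e + 1.
have Q0 : 0 < Q by rewrite ltr_wpDl// addr_ge0 ?fine_ge0// divr_ge0// ltW.
apply/lee_addgt0Pr => eps eps0.
(* d < e keeps the truncated volume positive; d * Q <= eps absorbs both the
   perimeter of the cut and the loss of volume *)
pose d := Num.min (e / 2) (eps / Q).
have d0 : 0 < d by rewrite lt_min !divr_gt0.
have de : d < e by rewrite gt_min; apply/orP; left; rewrite ltr_pdivrMr// mulr2n mulrDr mulr1 ltrDl.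
have [r r0 hr] := vol_cut_small mE Eoo d0.
have [rho rrho htr] := truncate_perimeter s01 Ku Ks r mE Eoo d0.
pose E' : set T := E `&` cube rho.
have mE' : measurable E' by apply: measurableI => //; exact: measurable_cube.
have bE' : bounded_set (E' : set V).
  by apply/bounded_setP; exists rho; [exact: lt_le_trans rrho|move=> x []].
have E'fin : vol E' \is a fin_num by rewrite ge0_fin_numE ?vol_ge0// vol_lty_bounded.
have hE' : e - d <= fine (vol E').
  rewrite lerBlDr -lee_fin EFinD !fineK//.
  apply: (@le_trans _ _ (vol E' + vol (E `\` cube r))%E); last by rewrite leeD2l.
  apply: (@le_trans _ _ (vol (E' `|` (E `\` cube r)))).
    apply: le_vol => x Ex; have [xr|xr] := pselect (cube r x); last by right.
    by left; split=> //; apply: lt_le_trans rrho.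
  by apply: measureU2 => //; apply: measurableD => //; exact: measurable_cube.
have E'e : fine (vol E') <= e by rewrite /e fine_le//; apply: le_vol => x [].
have := isoperimetric_bounded mE' bE'.
(* as alpha <= 1, q ^ alpha >= q for the ratio q <= 1 of the volumes *)
have hc : c * (1 - d / e) <= p * (fine (vol E') / v) `^ alpha.
  have -> : fine (vol E') / v = (e / v) * (fine (vol E') / e).
    by rewrite mulrAC mulrCA mulfV ?gt_eqF// mulr1 mulrC.
  have E'0 : 0 < fine (vol E') by apply: lt_le_trans hE'; rewrite subr_gt0.
  rewrite powRM ?divr_ge0 ?(ltW e0) ?(ltW v0) ?(ltW E'0)// mulrA -/c ler_wpM2l//.
  apply: le_trans (ger1_powR _ _); last 2 first.
  - by rewrite divr_gt0//= ler_pdivrMr// mul1r.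
  - by case/andP: alpha01.
  by rewrite ler_pdivlMr// mulrBl mul1r divfK ?gt_eqF.
rewrite -lee_fin in hc => /(le_trans hc)/le_trans/(_ htr) {}hc.
have {}hc : ((c * (1 - d / e))%:E <= vper E + (d * (fine D + 1))%:E)%E.
  apply: le_trans hc _; rewrite leeD2l// mulrDr mulr1 EFinD leeD2r//.
  by rewrite EFinM fineK// lee_wpmul2r.
have -> : c = c * (1 - d / e) + d * (c / e) by rewrite mulrBr mulr1 mulrCA; ring.
rewrite EFinD; apply: le_trans (leeD2r _ hc) _.
rewrite -addeA leeD2l// -EFinD lee_fin -mulrDr.
have -> : fine D + 1 + c / e = Q by rewrite /Q; ring.
by rewrite -ler_pdivlMr// ge_min lexx orbT.
Qed.

End minimizer.

(** * Reflection symmetry of a minimizer about its barycentre *)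

Lemma null_of_integral_eq0 d (T : measurableType d) (R : realType)
    (mu : {measure set T -> \bar R}) (w : T -> R) (X : set T) :
  measurable X -> measurable_fun setT w -> (forall x, 0 <= w x) -> (forall x, X x -> 0 < w x) ->
  (\int[mu]_x (w x * \1_X x)%:E = 0)%E -> mu X = 0%E.
Proof.
move=> mX mw w0 wX h.
have mF : measurable_fun setT (fun x => (w x * \1_X x)%:E).
  by apply/measurable_EFinP; apply: measurable_funM => //; exact: measurable_indic.
have := (ae_eq_integral_abs mu measurableT mF).1.
under eq_integral => x _ do rewrite abse_EFin ger0_norm ?mulr_ge0//.
move=> /(_ h) [N [mN N0 hN]].
apply/eqP; rewrite eq_le measure_ge0 andbT -N0.
apply: le_measure; rewrite ?inE//.
move=> x Xx; apply: hN => /= /(_ I) /eqP.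
by rewrite eqe indicE mem_set// mulr1 gt_eqF// wX.
Qed.

Section centre.
Variables (R : realType) (n : nat).
Local Notation V := 'rV[R]_n.
Local Notation vol := (lebesgueRV R n).
Local Notation T := (leb R n).

Variables (K : set V) (s : R).
Hypotheses (n1 : (1 <= n)%N) (s01 : 0 < s < 1).
Hypotheses (Ku : unconditional K) (Ks : strictly_convex_body K).
Variable M : set V.
Hypothesis Mmin : minimizer s K M.

Local Notation vper := (vper K s).

Definition below (i : 'I_n) (c : R) : set V := [set x | x 0 i < c].

Lemma borel_below i c : borel_set (below i c).
Proof.
rewrite (_ : below i c = (fun x : V => x 0 i) @^-1` `]-oo, c[%classic); last first.
  by apply/seteqP; split=> x; rewrite /below /preimage /= in_itv.
have := @measurable_borel_coord R n i measurableT `]-oo, c[%classic.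
by rewrite setTI; apply.
Qed.

Lemma refl_coord i c (x : V) : refl i c x 0 i = 2 * c - x 0 i.
Proof. by rewrite mxE eqxx. Qed.

Local Notation Kept i c := (@pol_kept _ T (refl i c) (below i c) M).
Local Notation Moved i c := (@pol_moved _ T (refl i c) (below i c) M).
Local Notation pol i c := (@polarize _ T (refl i c) (below i c) M).

Lemma below_refl i c (x : V) : x 0 i <> c -> (refl i c x \in below i c) = (x \notin below i c).
Proof.
move=> xc; apply/idP/idP; rewrite notin_setE inE /below/= refl_coord.
  by move=> h /= h2; lra.
by move=> /negP; rewrite -leNgt le_eqVlt => /orP[/eqP h|]; [case: xc|lra].
Qed.

Lemma kernelK_refl i c x y : kernelK K s (refl i c x) (refl i c y) = kernelK K s x y.
Proof.
rewrite !kernelKE -(kern_reflection s Ku Ks i (x - y)); congr (kern _ _ _).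
by apply/rowP => j; rewrite !mxE; case: ifP => _; ring.
Qed.

(** On the same side of the hyperplane the i-th coordinates of two points are
    closer than after reflecting one of them. *)
Lemma kernelK_polarize i c (x y : V) : below i c x -> below i c y -> x <> y ->
  kernelK K s x (refl i c y) < kernelK K s x y.
Proof.
rewrite /below /= => xc yc xy; rewrite !kernelKE; apply: (kern_strict s01 Ku Ks (i := i)).
- by apply/eqP => /subr0_eq.
- by move=> j ji; rewrite !mxE (negbTE ji).
- rewrite !mxE eqxx; have -> : `|x 0 i - (2 * c - y 0 i)| = - (x 0 i - (2 * c - y 0 i)).
    by rewrite ltr0_norm//; lra.
  by rewrite ltr_norml; apply/andP; split; lra.
Qed.

Lemma borel_polarize i c : borel_set (pol i c : set V).
Proof.
have bM := minimizer_borel Mmin; have bM' := borel_refl i c bM; have bH := borel_below i c.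
have mI (A B : set V) : borel_set A -> borel_set B -> borel_set (A `&` B).
  exact: (@measurableI _ (borelRV R n)).
have mU (A B : set V) : borel_set A -> borel_set B -> borel_set (A `|` B).
  exact: (@measurableU _ (borelRV R n)).
rewrite (_ : (pol i c : set V) = (M `&` refl i c @^-1` M) `|`
    (below i c `&` (M `|` refl i c @^-1` M))); first exact: mU (mI _ _ bM bM') (mI _ _ bH (mU _ _ bM bM')).
apply/seteqP; split=> x; rewrite /polarize /=.
  case: ifPn => [/set_mem xH /orP[/set_mem xM|/set_mem xM]|_ /andP[/set_mem xM /set_mem xM']].
  - by right; split => //; left.
  - by right; split => //; right.
  - by left.
move=> [[xM xM']|[xH [xM|xM]]].
- by rewrite (mem_set xM) (mem_set xM'); case: ifP.
- by rewrite (mem_set xH) (mem_set xM).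
- by rewrite (mem_set xH) (mem_set xM) orbT.
Qed.

Lemma bounded_polarize i c : bounded_set (pol i c : set V).
Proof.
have [r r0 Mr] := (bounded_setP M).1 (minimizer_bounded Mmin).
apply/bounded_setP; exists (r + 2 * `|c|); first by rewrite ltr_wpDr// mulr_ge0.
move=> x; rewrite /polarize /= => h.
have {h} : M x \/ M (refl i c x).
  by move: h; case: ifP => _; [move=> /orP[]|move=> /andP[+ _]]; move=> /set_mem ?; [left|right|left].
move=> [/Mr h|/Mr h]; first by apply: lt_le_trans h _; rewrite lerDl mulr_ge0.
have r0' : 0 < r + 2 * `|c| by rewrite ltr_wpDr// mulr_ge0.
apply/(norm_lt_coord _ r0') => j.
have := le_lt_trans (coord_le_norm (refl i c x) j) h.
rewrite mxE; case: eqP => [->|_] hj; last by apply: lt_le_trans hj _; rewrite lerDl mulr_ge0.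
have -> : x 0 i = 2 * c - (2 * c - x 0 i) by ring.
apply: le_lt_trans (ler_normB _ _) _.
by rewrite normrM ger0_norm// addrC ltrD2r.
Qed.

(** Polarizing a minimizer gives a bounded Borel set of the same volume, so its
    perimeter cannot decrease. *)
Lemma refl_dichotomy i c : vol (Kept i c) = 0%E \/ vol (Moved i c) = 0%E.
Proof.
have mM := minimizer_measurable Mmin.
have mH : measurable (below i c : set T) by apply: borel_measurable; exact: borel_below.
have isig f : measurable_fun setT (f : T -> \bar R) -> (forall x, 0 <= f x)%E ->
    (\int[vol]_x f (refl i c x) = 1 * \int[vol]_x f x)%E.
  by move=> mf f0; rewrite mul1e (integral_refl mf f0).
have mP : measurable ([set x : V | x 0 i = c] : set T).
  rewrite (_ : [set _ | _] = (fun x : V => x 0 i) @^-1` [set c])//.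
  have := @measurable_coord R n i measurableT [set c].
  by rewrite setTI; apply.
have P0 := vol_hyperplane i c.
have HP (x : T) : ~ [set x : V | x 0 i = c] x -> (refl i c x \in below i c) = (x \notin below i c).
  exact: below_refl.
have volpol := measure_polarize (measurable_refl i c) isig (reflK i c) mH mP P0 HP mM.
apply: (@polarize_dichotomy _ T R vol (kernelK K s) (kernelK_measurable s Ku Ks) (@kernelK_ge0 R n K s)
  (refl i c) (below i c) [set x : V | x 0 i = c] (measurable_refl i c) isig (reflK i c) mH mP P0 HP
  (kernelK_refl i c) (@kernelK_polarize i c) M mM).
  by rewrite -/(vper M) (minimizer_per s01 Ku Ks Mmin) ltry.
have := isoperimetric_bounded n1 s01 Ku Ks Mmin
  (borel_measurable (borel_polarize i c)) (bounded_polarize i c).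
have -> : vol (pol i c : set V) = vol M by exact: volpol.
have v0 : 0 < fine (vol M).
  by rewrite -lte_fin -(minimizer_vol Mmin); exact: (minimizer_vol_gt0 Mmin).
rewrite divff ?gt_eqF// powR1 mulr1 -(minimizer_per s01 Ku Ks Mmin).
exact: le_trans.
Qed.

Let mM : measurable (M : set T). Proof. exact: (minimizer_measurable Mmin). Qed.

Let mcoord i c : measurable_fun setT (fun x : T => (x : V) 0 i - c : measurableTypeR R).
Proof. by apply: measurable_funB; [exact: measurable_coord|exact: measurable_cst]. Qed.

(** The first moment about the hyperplane; its integral vanishes when [c] is the
    i-th coordinate of the barycentre [m]. *)
Let F i c (x : T) : \bar R := (((x : V) 0 i - c) * \1_M x)%:E.

Let mF i c : measurable_fun setT (F i c).
Proof.
apply/measurable_EFinP; apply: measurable_funM; first exact: mcoord.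
by apply: measurable_indic; exact: mM.
Qed.

Let iI : vol.-integrable setT (fun x : T => (\1_M x)%:E).
Proof.
apply/integrableP; split; first by apply/measurable_EFinP; apply: measurable_indic; exact: mM.
under eq_integral => x _ do rewrite abse_EFin ger0_norm//.
rewrite integral_indic; [|exact: measurableT|exact: mM].
by rewrite setIT [X in (X < _)%E](minimizer_vol Mmin) ltry.
Qed.

Let iF i c : vol.-integrable setT (F i c).
Proof.
have [r r0 Mr] := (bounded_setP M).1 (minimizer_bounded Mmin).
apply: (@le_integrable _ _ _ vol setT measurableT _ (fun x => (r + `|c|)%:E * (\1_M x)%:E)%E); [exact: mF| |].
  move=> x _; rewrite /F -EFinM !abse_EFin lee_fin !normrM !indicE.
  case: (boolP (x \in M)) => [/set_mem/Mr xr|_]; last by rewrite normr0 !mulr0.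
  rewrite normr1 !mulr1; apply: le_trans (ler_normB _ _) _.
  rewrite [leRHS]ger0_norm; last by rewrite addr_ge0// ltW.
  by rewrite lerD2r; apply: le_trans (coord_le_norm x i) _; exact: ltW.
exact: (integrableZl measurableT _ iI).
Qed.

Let integral_F i c : (\int[vol]_x F i c x = \int[vol]_x F i 0 x - c%:E * vol M)%E.
Proof.
have mI : (\int[vol]_x (\1_M x)%:E = vol M)%E.
  by rewrite integral_indic; [rewrite setIT| |exact: mM].
rewrite -mI -(integralZl _ iI)// -integralB; [|by []|exact: iF|exact: integrableZl].
apply: eq_integral => x _; rewrite /F -EFinM -EFinB subr0; congr EFin; ring.
Qed.

Let m : V := \row_i (fine (\int[vol]_x F i 0 x) / fine (vol M)).

Let integral_F_centre i c : (\int[vol]_x F i c x = ((m 0 i - c) * fine (vol M))%:E)%E.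
Proof.
have v0 : 0 < fine (vol M).
  by rewrite -lte_fin -(minimizer_vol Mmin); exact: (minimizer_vol_gt0 Mmin).
have := integrable_fin_num measurableT (iF i 0) => /= h.
rewrite integral_F -(fineK h) (minimizer_vol Mmin) -EFinM -EFinB mxE; congr EFin.
by rewrite mulrBl divfK ?gt_eqF.
Qed.

Let w i c (x : T) : R := Num.max 0 (c - (x : V) 0 i).

Let mw i c : measurable_fun setT (w i c).
Proof.
apply: measurable_maxr; first exact: measurable_cst.
by apply: measurable_funB; [exact: measurable_cst|exact: measurable_coord].
Qed.

Let mKept i c : measurable (Kept i c).
Proof.
apply: measurable_pol_kept; [exact: measurable_refl|exact: borel_measurable (borel_below i c)|exact: mM].
Qed.

Let mMoved i c : measurable (Moved i c).
Proof.
apply: measurable_pol_moved; [exact: measurable_refl|exact: borel_measurable (borel_below i c)|exact: mM].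
Qed.

(** With the weight [w], the mass of M in the half-space plus the mass that
    polarization would bring in equals the mass of the reflected other half plus
    the mass of the kept part. *)
Let balance i c : (\int[vol]_x (F i c)^\- x + \int[vol]_x (w i c x * \1_(Moved i c) x)%:E =
  \int[vol]_x (F i c)^\+ x + \int[vol]_x (w i c x * \1_(Kept i c) x)%:E)%E.
Proof.
have w0 x : 0 <= w i c x by rewrite /w le_max lexx.
rewrite -(integral_refl (measurable_funepos (mF i c)) (@funepos_ge0 _ _ _) i c).
have mI A : measurable (A : set T) -> measurable_fun setT (fun x => (w i c x * \1_A x)%:E).
  move=> mA; apply/measurable_EFinP; apply: measurable_funM; first exact: mw.
  exact: measurable_indic.
have I0 A x : (0 <= (w i c x * \1_A x)%:E)%E by rewrite lee_fin mulr_ge0.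
have Fn (x : T) : ((F i c)^\- x = (w i c x * @indic T R M x)%:E)%E.
  rewrite funenegE /F /w -EFinN -mulNr opprB -EFin_max; congr EFin.
  by rewrite indicE; case: (x \in M); rewrite ?mulr1 ?mulr0 ?maxxx// maxC.
have Fp (x : T) : ((F i c)^\+ (refl i c x) = (w i c x * @indic T R M (refl i c x))%:E)%E.
  rewrite funeposE /F /w refl_coord -EFin_max; congr EFin.
  rewrite indicE; case: (_ \in M); rewrite ?mulr1 ?mulr0 ?maxxx// maxC.
  by congr Num.max; ring.
have mMr : measurable (refl i c @^-1` M : set T).
  by rewrite -[X in measurable X]setTI; apply: measurable_refl => //; exact: mM.
have DD (A B : set T) : measurable A -> measurable B ->
    (\int[vol]_x (w i c x * \1_A x)%:E + \int[vol]_x (w i c x * \1_B x)%:E =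
     \int[vol]_x ((w i c x * \1_A x)%:E + (w i c x * \1_B x)%:E))%E.
  move=> mA mB; symmetry; apply: (@ge0_integralD _ T R vol setT measurableT).
  - by move=> x _; exact: I0.
  - exact: mI.
  - by move=> x _; exact: I0.
  - exact: mI.
under eq_integral => x _ do rewrite Fn.
rewrite DD; [|exact: mM|exact: mMoved].
transitivity (\int[vol]_x (w i c x * @indic T R (refl i c @^-1` M) x)%:E +
  \int[vol]_x (w i c x * \1_(Kept i c) x)%:E)%E; last first.
  by congr (_ + _)%E; apply: eq_integral => x _; rewrite Fp.
rewrite DD; [|exact: mMr|exact: mKept].
apply: eq_integral => x _; rewrite -!EFinD; congr EFin.
(* off the half-space the weight vanishes *)
have [xH|xH] := boolP (x \in below i c); last first.
  suff -> : w i c x = 0 by rewrite !mul0r.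
  by move: xH; rewrite notin_setE /below /= => /negP; rewrite -leNgt -subr_le0 /w => /max_l.
rewrite -!mulrDr; congr (_ * _).
rewrite !indicE.
have -> : (x \in Kept i c) = (x \in M) && (refl i c x \notin M).
  by apply/idP/idP; rewrite /pol_kept inE /= xH.
have -> : (x \in Moved i c) = (x \notin M) && (refl i c x \in M).
  by apply/idP/idP; rewrite /pol_moved inE /= xH.
have -> : (x \in refl i c @^-1` M) = (refl i c x \in M).
  by apply/idP/idP; rewrite !inE.
by case: (x \in M); case: (refl i c x \in M); rewrite ?addr0 ?add0r.
Qed.

Let w_gt0 i c A x : (A `<=` below i c) -> A x -> 0 < w i c x.
Proof. by move=> /[apply]; rewrite /below /= /w lt_max subr_gt0 => ->; rewrite orbT. Qed.

Let weight_eq0 i c (A : set T) : vol A = 0%E -> measurable A ->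
  (\int[vol]_x (w i c x * \1_A x)%:E = 0)%E.
Proof.
move=> A0 mA; rewrite -(integral0 vol setT).
have mwA : measurable_fun setT (fun x => (w i c x * \1_A x)%:E).
  by apply/measurable_EFinP; apply: measurable_funM; [exact: mw|exact: measurable_indic].
apply: ae_eq_integral => //; exists A; split => // x /=; rewrite indicE.
by case: (boolP (x \in A)) => [/set_mem//|_]; rewrite mulr0 => -[].
Qed.

(** Suppose the hyperplane lies above the barycentre. If the kept part is null,
    then [balance] compares the two half-moments and forces the moved part to
    have weight 0; the other case is symmetric. *)
Lemma refl_centre : exists m : V, forall i c,
  (m 0 i <= c -> vol (Moved i c) = 0%E) /\ (c <= m 0 i -> vol (Kept i c) = 0%E).
Proof.
have v0 : 0 < fine (vol M).
  by rewrite -lte_fin -(minimizer_vol Mmin); exact: (minimizer_vol_gt0 Mmin).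
exists m => i c.
have XH : Kept i c `<=` below i c by move=> x; rewrite /pol_kept /= => /andP[/set_mem].
have YH : Moved i c `<=` below i c by move=> x; rewrite /pol_moved /= => /andP[/set_mem].
have w0 x : 0 <= w i c x by rewrite /w le_max lexx.
have := balance i c; have := integral_F_centre i c; rewrite integralE.
have := integrable_pos_fin_num measurableT (iF i c).
have := integrable_neg_fin_num measurableT (iF i c).
case: (\int[vol]_x (F i c)^\- x)%E => // b _; case: (\int[vol]_x (F i c)^\+ x)%E => // a _.
move=> /eqP; rewrite -EFinB eqe => /eqP abE bal.
have null (A : set T) : measurable A -> A `<=` below i c ->
    (\int[vol]_x (w i c x * \1_A x)%:E <= 0)%E -> vol A = 0%E.
  move=> mA AH hA; apply: (@null_of_integral_eq0 _ T R vol (w i c) A);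
    [exact: mA|exact: mw|exact: w0|by move=> x; apply: w_gt0|].
  apply/eqP; rewrite eq_le hA/= integral_ge0// => x _.
  by rewrite lee_fin mulr_ge0.
split=> mc.
- have [X0|//] := refl_dichotomy i c.
  apply: null; [exact: mMoved|exact: YH|].
  move: bal; rewrite (weight_eq0 i c X0 (mKept i c)) adde0.
  have ab : a <= b by rewrite -subr_le0 abE mulr_le0_ge0// ?subr_le0// ltW.
  case: (integral _ _ _) => //= d; rewrite -EFinD => -[h].
  by rewrite lee_fin; lra.
- have [//|Y0] := refl_dichotomy i c.
  apply: null; [exact: mKept|exact: XH|].
  move: bal; rewrite (weight_eq0 i c Y0 (mMoved i c)) adde0.
  have ab : b <= a by rewrite -subr_ge0 abE mulr_ge0// ?subr_ge0// ltW.
  case: (integral _ _ _) => //= d; rewrite -EFinD => -[h].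
  by rewrite lee_fin; lra.
Qed.

End centre.

(** * Boxes in a centred minimizer *)

Section null_sets.
Variables (R : realType) (n : nat).
Local Notation V := 'rV[R]_n.
Local Notation vol := (lebesgueRV R n).
Local Notation T := (leb R n).
Implicit Types A B : set V.

Lemma null_subset A B : A `<=` B -> vol B = 0%E -> vol A = 0%E.
Proof. by move=> AB B0; apply/eqP; rewrite eq_le vol_ge0 andbT -B0 le_vol. Qed.

Lemma null_bigcup (F : nat -> set V) :
  (forall k, vol (F k) = 0%E) -> vol (\bigcup_k F k) = 0%E.
Proof.
move=> F0; apply/eqP; rewrite eq_le vol_ge0 andbT.
apply: le_trans (outer_measure_sigma_subadditive (borel_lebesgue R n)^*%mu F) _.
by rewrite eseries0// => k _ _; exact: F0.
Qed.

Lemma null_union A B : vol A = 0%E -> vol B = 0%E -> vol (A `|` B) = 0%E.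
Proof.
by move=> A0 B0; rewrite -bigcup2E; apply: null_bigcup => -[|[|k]]//=; exact: measure0.
Qed.

Lemma null_bigcup_fin (I : finType) (F : I -> set V) :
  (forall i, vol (F i) = 0%E) -> vol [set x | exists i, F i x] = 0%E.
Proof.
move=> F0; pose G k := if @unpickle I k is Some i then F i else set0.
apply: (@null_subset _ (\bigcup_k G k)).
  by move=> x [i Fi]; exists (pickle i) => //; rewrite /G pickleK.
by apply: null_bigcup => k; rewrite /G; case: (unpickle k) => // ; exact: measure0.
Qed.

(** Lebesgue measure is complete. *)
Lemma measurable_null A : vol A = 0%E -> measurable (A : set T).
Proof.
move=> A0; apply: le_caratheodory_measurable => B.
have BA0 : vol (B `&` A) = 0%E by apply: (@null_subset _ A) => // x [].
rewrite -[X in (_ <= X)%E]add0e -[in leRHS]BA0; apply: leeD => //; exact: le_mu_ext.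
Qed.

End null_sets.

(** The hypothesis [refl_null] is what [refl_centre] says about a minimizer whose
    barycentre is the origin. *)
Section centred.
Variables (R : realType) (n : nat).
Local Notation V := 'rV[R]_n.
Local Notation vol := (lebesgueRV R n).
Local Notation T := (leb R n).
Variable N : set V.
Hypothesis bN : borel_set N.
Hypothesis refl_null : forall i d,
  vol [set y | [/\ N y, `|refl i d y 0 i| < `|y 0 i| & ~ N (refl i d y)]] = 0%E.

(** The composition of the reflections in {x_i = u_i / 2} for i in [l]; for the
    list of all coordinates it is the point reflection x -> u - x. *)
Definition part_refl (l : seq 'I_n) (u x : V) : V :=
  \row_i (if i \in l then u 0 i - x 0 i else x 0 i).

Lemma vol_part_refl l (u : V) (A : set V) : vol (part_refl l u @^-1` A) = vol A.
Proof.
have -> : part_refl l u =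
    daff (\row_i (if i \in l then -1 else 1)) (\row_i (if i \in l then u 0 i else 0)).
  by apply/funext => x; apply/rowP => i; rewrite !mxE; case: ifP => _; ring.
rewrite vol_daff => [|i]; last by rewrite mxE; case: ifP; rewrite ?oppr_eq0 oner_eq0.
by rewrite big1 ?invr1 ?mul1e// => i _; rewrite mxE; case: ifP; rewrite ?normrN normr1.
Qed.

(** Each further reflection loses only the preimage of a null set. *)
Lemma part_refl_null l (u : V) :
  vol [set x | [/\ N x, (forall i, `|u 0 i - x 0 i| < `|x 0 i|) & ~ N (part_refl l u x)]] = 0%E.
Proof.
elim: l => [|i l ih].
  rewrite (_ : [set _ | _] = set0) ?measure0//; apply/seteqP; split => // x [Nx _] /=; apply.
  by have -> : part_refl [::] u x = x by apply/rowP => i; rewrite mxE.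
have [il|il] := boolP (i \in l).
  have -> // : part_refl (i :: l) u = part_refl l u.
  apply/funext => x; apply/rowP => j; rewrite !mxE in_cons.
  by case: eqP => // ->; rewrite il.
have Z0 := refl_null i (u 0 i / 2).
set Z := [set y | _] in Z0.
apply: null_subset (null_union ih (etrans (vol_part_refl l u Z) Z0)) => x /= [Nx h Nl].
have [Nlx|Nlx] := pselect (N (part_refl l u x)); last by left; split.
right; rewrite /Z /=.
have E : refl i (u 0 i / 2) (part_refl l u x) = part_refl (i :: l) u x.
  apply/rowP => j; rewrite !mxE in_cons; case: eqP => [->|//] /=.
  by rewrite (negbTE il) mulrC divfK.
by rewrite E; split => //; rewrite !mxE in_cons eqxx (negbTE il); exact: h.
Qed.

Lemma pointrefl_null (u : V) :
  vol [set x | [/\ N x, (forall i, `|u 0 i - x 0 i| < `|x 0 i|) & ~ N (u - x)]] = 0%E.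
Proof.
rewrite -(part_refl_null (enum 'I_n) u); congr (vol _); apply/funext => x /=.
suff -> : part_refl (enum 'I_n) u x = u - x by [].
by apply/rowP => i; rewrite !mxE mem_enum.
Qed.

Definition box (q : V) : set V := [set y | forall i, `|y 0 i| < `|q 0 i|].

Let G : set (T * T) := [set p | [/\ N p.1, box p.1 ((p.2 : V) - p.1) & ~ N ((p.2 : V) - p.1)]].

Let mG : measurable G.
Proof.
have ms : measurable_fun setT (fun p : T * T => (p.2 : V) - p.1 : borelRV R n).
  have sw : measurable_fun setT (fun p : T * T => (p.2, p.1)).
    by apply/measurable_fun_pairP; split; [exact: measurable_snd|exact: measurable_fst].
  exact: (measurableT_comp (@measurable_sub R n) sw).
have mf : measurable_fun setT (fun p : T * T => p.1 : borelRV R n).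
  exact: (measurableT_comp (@measurable_leb_borel R n) measurable_fst).
have -> : G = (fun p : T * T => p.1 : borelRV R n) @^-1` N `&`
    \bigcap_(i in [set: 'I_n]) ((fun p : T * T => `|((p.2 : V) - p.1) 0 i| < `|(p.1 : V) 0 i|) @^-1` [set true]) `&`
    (fun p : T * T => (p.2 : V) - p.1 : borelRV R n) @^-1` (~` N).
  apply/seteqP; split=> -[x u] /=; first by move=> [Nx h Nu]; split => //; split => // i _; exact: h.
  by move=> [[Nx h] Nu]; split => // i; apply: h.
apply: measurableI; [apply: measurableI|].
- by rewrite -[X in measurable X]setTI; exact: mf.
- apply: fin_bigcap_measurable => // i _; rewrite -[X in measurable X]setTI.
  have mc1 := measurableT_comp (@measurable_borel_coord R n i) ms.
  have mc2 := measurableT_comp (@measurable_borel_coord R n i) mf.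
  apply: measurable_fun_ltr.
    exact: (measurableT_comp (@normr_measurable R setT) mc1).
    exact: (measurableT_comp (@normr_measurable R setT) mc2).
  exact: measurableT.
  by [].
- by rewrite -[X in measurable X]setTI; apply: ms => //; apply: measurableC; exact: bN.
Qed.

Let gG (p : T * T) : \bar R := (\1_G p)%:E.

Let mgG : measurable_fun setT gG.
Proof. by apply/measurable_EFinP; exact: measurable_indic. Qed.

(** By [pointrefl_null] the set [G] of pairs (x, u) is null in x for each u. By
    Tonelli's theorem it is null in u for almost every x, and its section at x
    is a translate of [box x `\` N]. *)
Lemma ae_box_null : exists Z : set V, vol Z = 0%E /\
  forall x, N x -> ~ Z x -> vol (box x `\` N) = 0%E.
Proof.
have gG0 p : (0 <= gG p)%E by rewrite /gG lee_fin.
have integral_mem (A : set T) (f : T -> \bar R) : measurable A ->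
    (forall x, f x = (`[<A x>]%:R)%:E) -> (\int[vol]_x f x = vol A)%E.
  move=> mA fA; rewrite -[A in RHS]setIT -(integral_indic vol measurableT mA).
  by apply: eq_integral => x _; rewrite fA indicE.
have gGE x u : gG (x, u) = (`[<G (x, u)>]%:R)%:E by rewrite /gG indicE.
have mG1 u : measurable [set x : T | G (x, u)].
  rewrite (_ : [set _ | _] = ysection G u); first exact: measurable_ysection.
  by apply/seteqP; split => x /=; rewrite /ysection /= inE.
have mG2 x : measurable [set u : T | G (x, u)].
  rewrite (_ : [set _ | _] = xsection G x); first exact: measurable_xsection.
  by apply/seteqP; split => u /=; rewrite /xsection /= inE.
have h1 : (\int[vol]_x \int[vol]_u gG (x, u) = 0)%E.
  rewrite (fubini_tonelli _ mgG gG0) -[RHS](integral0 vol setT).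
  apply: eq_integral => u _.
  have vG : vol [set x : T | G (x, u)] = 0%E.
    apply: null_subset (pointrefl_null u) => x [/= Nx h h']; split => // i.
    by have := h i; rewrite !mxE.
  apply: etrans vG; apply: integral_mem (mG1 u) _ => x; exact: gGE.
have mF := measurable_fun_fubini_tonelli_F gG mgG gG0.
have FE x : N x -> fubini_F vol gG x = vol (box x `\` N).
  move=> Nx; rewrite /fubini_F (integral_mem [set u | G (x, u)] _ (mG2 x)); last by move=> u; exact: gGE.
  rewrite -[RHS](vol_shift (- x)); congr (vol _).
  by apply/seteqP; split=> u /=; [move=> [_ h h']|move=> [h h']].
have := (ae_eq_integral_abs vol measurableT (mF vol)).1.
under eq_integral => x _ do rewrite gee0_abs ?integral_ge0//.
move=> /(_ h1) [Z [mZ Z0 ZF]]; exists Z; split => // x Nx Zx.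
by rewrite -FE//; apply: contrapT => h; apply: Zx; apply: ZF => /=; apply: contra_not h; apply.
Qed.

End centred.

(** * The star body spanned by the boxes *)

Section boxcore.
Variables (R : realType) (n : nat).
Local Notation V := 'rV[R]_n.
Local Notation vol := (lebesgueRV R n).
Local Notation T := (leb R n).
Implicit Types (x y q : V).

Lemma box_le q q' : (forall i, `|q 0 i| <= `|q' 0 i|) -> box q `<=` box q'.
Proof. by move=> qq x xq i; exact: lt_le_trans (xq i) (qq i). Qed.

Lemma box_mono q x y : (forall i, `|y 0 i| <= `|x 0 i|) -> box q x -> box q y.
Proof. by move=> yx xq i; exact: le_lt_trans (yx i) (xq i). Qed.

Lemma open_box q : open (box q).
Proof.
rewrite openE => x xq.
exists (fun _ j => [set t | `|t| < `|q 0 j|]) => [i j|y h]; last first.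
  by move=> j; exact: (h 0 j).
rewrite ord1; apply: open_nbhs_nbhs; split; last exact: xq.
rewrite (_ : [set _ | _] = ball (0 : R) `|q 0 j|); first exact: ball_open.
by apply/seteqP; split=> t; rewrite -ball_normE /= sub0r normrN.
Qed.

(** Rational boxes form a base, which makes [boxcore] a countable union of
    boxes. *)
Lemma box_rat q x : box q x -> exists w : 'rV[rat]_n,
  box (map_mx ratr w : V) x /\ box (map_mx ratr w : V) `<=` box q.
Proof.
move=> xq.
have h i : exists r : rat, `|x 0 i| < ratr r < `|q 0 i|.
  by have [r] := rat_in_itvoo (xq i); rewrite in_itv => ?; exists r.
have /choice[r hr] := h; exists (\row_i r i).
have r0 i : `|(map_mx ratr (\row_i r i) : V) 0 i| = ratr (r i).
  by rewrite !mxE ger0_norm//; have /andP[h1 _] := hr i; exact: le_trans (ltW h1).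
split=> [i|]; first by rewrite r0; have /andP[] := hr i.
by apply: box_le => i; rewrite r0 ltW//; have /andP[] := hr i.
Qed.

Variable N : set V.
Hypothesis bN : borel_set N.
Hypothesis bdN : bounded_set N.
Hypothesis N0 : (0 < vol N)%E.
Hypothesis ae_box : exists Z : set V, vol Z = 0%E /\
  forall x, N x -> ~ Z x -> vol (box x `\` N) = 0%E.

Definition boxcore : set V := [set x | exists q, vol (box q `\` N) = 0%E /\ box q x].

Lemma open_boxcore : open boxcore.
Proof.
rewrite openE => x [q [q0 xq]].
have : nbhs x (box q) by apply: open_nbhs_nbhs; split => //; exact: open_box.
by apply: filterS => y yq; exists q.
Qed.

Lemma boxcore_mono x y : (forall i, `|y 0 i| <= `|x 0 i|) -> boxcore x -> boxcore y.
Proof. by move=> yx [q [q0 xq]]; exists q; split => //; exact: box_mono xq. Qed.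

Let mL : measurable (boxcore : set T).
Proof. by apply: borel_measurable; apply: sub_sigma_algebra; exact: open_boxcore. Qed.
Let mN : measurable (N : set T). Proof. exact: borel_measurable. Qed.

Lemma boxcore_sub : vol (boxcore `\` N) = 0%E.
Proof.
pose F k : set V := if @unpickle 'rV[rat]_n k is Some w then
  if `[< vol (box (map_mx ratr w : V) `\` N) = 0%E >] then box (map_mx ratr w : V) `\` N else set0
  else set0.
apply: (@null_subset _ _ _ (\bigcup_k F k)).
  move=> x [[q [q0 xq]] Nx]; have [w [xw wq]] := box_rat xq.
  exists (pickle w) => //; rewrite /F pickleK ifT//.
  by apply/asboolP; apply: null_subset q0 => y [] /wq.
apply: null_bigcup => k; rewrite /F; case: (unpickle k) => [w|]; last exact: measure0.
by case: ifPn => [/asboolP//|_]; exact: measure0.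
Qed.

Lemma bernoulli (e : R) k : 0 <= e <= 1 -> 1 - k%:R * e <= (1 - e) ^+ k.
Proof.
move=> /andP[e0 e1]; elim: k => [|k ih]; first by rewrite mul0r subr0.
rewrite exprS; apply: le_trans (ler_wpM2l _ ih); last by rewrite subr_ge0.
rewrite mulrSr; have : 0 <= k%:R * e * e by rewrite !mulr_ge0.
nra.
Qed.

(** For 0 < e < 1, almost every x in [N] has [(1 - e) x] in [boxcore], since its
    box does not contain x itself but does contain [(1 - e) x]. This bounds the
    volume of [N] by [(1 - e) ^ (- n)] times that of [boxcore], hence by that of
    [N `&` boxcore] in the limit. *)
Lemma boxcore_sup : vol (N `\` boxcore) = 0%E.
Proof.
have Noo : (vol N < +oo)%E by exact: vol_lty_bounded.
have Nfin : vol N \is a fin_num by rewrite ge0_fin_numE ?vol_ge0.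
have sub (A B C : set V) : A `<=` B `|` C -> vol B = 0%E -> (vol A <= vol C)%E.
  move=> ABC B0; rewrite -[leRHS]add0e -[in leRHS]B0.
  by apply: le_trans (le_vol ABC) _; exact: outer_measureU2.
have IN : (vol (N `&` boxcore) <= vol N)%E by apply: le_vol => x [].
have Ifin : vol (N `&` boxcore) \is a fin_num.
  by rewrite ge0_fin_numE ?vol_ge0// (le_lt_trans IN).
have LI : (vol boxcore <= vol (N `&` boxcore))%E.
  apply: sub boxcore_sub => x Lx; have [Nx|Nx] := pselect (N x); [by right|by left].
have split : vol N = (vol (N `&` boxcore) + vol (N `\` boxcore))%E.
  rewrite -measureU; [|exact: measurableI|exact: measurableD|].
    by congr (vol _); rewrite setUIDK.
  by apply/seteqP; split=> // x [[_ Lx] [_ +]].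
suff : (vol N <= vol (N `&` boxcore))%E.
  move=> NI; apply/eqP; rewrite eq_le vol_ge0 andbT.
  by rewrite -(leeD2lE _ _ Ifin) adde0 -split.
have [Z [Z0 HZ]] := ae_box.
have step (e : R) : 0 < e < 1 -> (1 - e) ^+ n * fine (vol N) <= fine (vol (N `&` boxcore)).
  move=> /andP[e0 e1].
  have t0 : 0 < 1 - e by rewrite subr_gt0.
  have H0 : vol [set x : V | exists i, x 0 i = 0] = 0%E.
    by apply: (@null_bigcup_fin _ _ _ (fun i => [set x : V | x 0 i = 0])) => i; exact: vol_hyperplane.
  have : (vol N <= vol ((fun x : V => (1 - e) *: x) @^-1` boxcore))%E.
    apply: (sub N (Z `|` [set x : V | exists i, x 0 i = 0])); last exact: null_union Z0 H0.
    move=> x Nx.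
    have [Zx|Zx] := pselect (Z x); first by left; left.
    have [Hx|Hx] := pselect (exists i, x 0 i = 0); first by left; right.
    right; exists x; split; first exact: HZ.
    move=> i; rewrite mxE normrM ger0_norm ?(ltW t0)// gtr_pMl ?ltrBlDl ?ltrDr//.
    by rewrite normr_gt0; apply/eqP => xi; apply: Hx; exists i.
  rewrite vol_scale ?gt_eqF// ger0_norm ?(ltW t0)// => h.
  rewrite -lee_fin EFinM !fineK//.
  apply: le_trans LI.
  by rewrite -lee_pdivlMl ?exprn_gt0.
rewrite -(fineK Nfin) -(fineK Ifin) lee_fin.
apply/ler_addgt0Pr => d d0.
set a := fine (vol N) in step *; set b := fine (vol (N `&` _)) in step *.
have a0 : 0 <= a by rewrite fine_ge0// vol_ge0.
have na0 : 0 <= n%:R * a by rewrite mulr_ge0.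
have D0 : 0 < d + n%:R * a + 1 by rewrite ltr_wpDl// addr_ge0// ltW.
(* small enough for n * e * a <= d *)
pose e := d / (d + n%:R * a + 1).
have e0 : 0 < e by rewrite divr_gt0.
have e1 : e < 1 by rewrite ltr_pdivrMr// mul1r -addrA ltrDl ltr_wpDl.
have e01 : 0 <= e <= 1 by rewrite !ltW.
have sb := step e; rewrite e0 e1 in sb; have {}sb := sb isT.
have bern := ler_wpM2r a0 (bernoulli n e01).
have ed : n%:R * e * a <= d.
  rewrite (_ : n%:R * e * a = (n%:R * a) * d / (d + n%:R * a + 1)); last by rewrite /e; ring.
  rewrite ler_pdivrMr// [leRHS]mulrC ler_pM2r//; lra.
lra.
Qed.

(** A box reaching beyond the bound of [N] in direction i contains a small box
    of positive volume outside of [N]. *)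
Lemma bounded_boxcore : bounded_set boxcore.
Proof.
have [r r0 Nr] := (bounded_setP N).1 bdN.
apply/bounded_setP; exists (r + 1); first by rewrite ltr_wpDr.
suff h x i : boxcore x -> `|x 0 i| <= r.
  move=> x Lx; apply: le_lt_trans (_ : r < _); last by rewrite ltrDl.
  by apply/(norm_le_coord _ (ltW r0)) => i; exact: h.
move=> [q [q0 xq]]; rewrite leNgt; apply/negP => rx.
pose A j : set R := if j == i then `]r, `|q 0 j|[%classic else `]0, `|q 0 j|[%classic.
have mA j : measurable (A j) by rewrite /A; case: ifP.
have : vol [set v : V | forall j, A j (v 0 j)] = 0%E.
  apply: null_subset q0 => v /= Av; split.
    move=> j; have := Av j; rewrite /A; case: ifP => _; rewrite /= in_itv/= => /andP[h1 h2].
      by rewrite gtr0_norm// (lt_trans r0).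
    by rewrite gtr0_norm.
  move=> Nv; have := Nr _ Nv; have := Av i; rewrite /A eqxx /= in_itv/= => /andP[h1 _].
  apply/negP; rewrite -leNgt; apply: le_trans (coord_le_norm v i).
  by rewrite (le_trans (ltW h1))// ler_norm.
rewrite vol_box// => /eqP; apply/negP; rewrite gt_eqF//.
have AE j : lebesgue_measure (A j) = (`|q 0 j| - (if j == i then r else 0))%:E.
  rewrite /A; case: eqP => [->|_]; rewrite lebesgue_measure_itv /= lte_fin.
    by rewrite (lt_trans rx (xq i)) -EFinB.
  by rewrite (le_lt_trans _ (xq j)) ?normr_ge0// -EFinB.
under eq_bigr do rewrite AE.
rewrite prodEFin lte_fin; apply: prodr_gt0 => j _; rewrite subr_gt0.
by case: eqP => [->|_]; [exact: lt_trans rx (xq i)|exact: le_lt_trans (xq j)].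
Qed.

Lemma boxcore0 : boxcore 0.
Proof.
have [x Lx] : boxcore !=set0.
  apply/set0P/eqP => L0; move: N0; rewrite lt_neqAle => /andP[/eqP + _]; apply.
  by rewrite -boxcore_sup L0 setD0.
by apply: boxcore_mono Lx => i; rewrite mxE normr0.
Qed.

Lemma unconditional_boxcore : unconditional boxcore.
Proof.
move=> i; have refl_in x : boxcore x -> boxcore (reflection i x).
  by apply: boxcore_mono => j; rewrite mxE; case: ifP; rewrite ?normrN.
apply/seteqP; split=> [_ [x Lx <-]|x Lx]; first exact: refl_in.
by exists (reflection i x); [exact: refl_in|exact: reflectionK].
Qed.

Lemma star_boxcore : star_shaped boxcore.
Proof.
move=> x t Lx /andP[t0 t1]; apply: boxcore_mono Lx => i.
by rewrite mxE normrM ger0_norm// ler_piMl.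
Qed.

Let rays x := [set r : R | 0 <= r /\ boxcore (r *: x)].

Let rays0 x : rays x 0.
Proof. by split => //; rewrite scale0r; exact: boxcore0. Qed.

Let rays_ub x : x != 0 -> has_sup (rays x).
Proof.
move=> x0; split; first by exists 0; exact: rays0.
have [r r0 Lr] := (bounded_setP boxcore).1 bounded_boxcore.
exists (r / `|x|) => t [t0 /Lr]; rewrite normrZ ger0_norm// => h.
by rewrite ler_pdivlMr ?normr_gt0// ltW.
Qed.

(** Lower semicontinuity comes from openness. For the upper bound, a point
    [b y] of [boxcore] with y near x and b slightly larger than the radial
    function at x dominates, in every |coordinate|, a point of the ray through x
    outside of [boxcore]; vanishing coordinates of x impose no condition. *)
Lemma radial_boxcore_continuous x : x != 0 -> radial boxcore y @[y --> x] --> radial boxcore x.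
Proof.
move=> x0; have nF : Filter (nbhs x) by exact: nbhs_filter.
apply/cvgrPdist_le => /= e e0.
have rho0 : 0 <= radial boxcore x.
  by apply: sup_upper_bound; [exact: rays_ub|exact: rays0].
set rho := radial boxcore x in rho0 *.
have near0 : \forall y \near x, y != 0.
  have := @cvgr_gt _ _ (nbhs x) nF _ _ (@norm_continuous R V x) 0.
  by rewrite normr_gt0 => /(_ x0); apply: filterS => y; rewrite normr_gt0.
have lower : \forall y \near x, rho - e <= radial boxcore y.
  have [a [a0 La] ra] := sup_adherent e0 (rays_ub x0).
  have : \forall y \near x, boxcore (a *: y).
    apply: (@scaler_continuous R V a x boxcore); apply: open_nbhs_nbhs; split => //; exact: open_boxcore.
  move: near0; apply: filterS2 => y y0 Ly; apply: le_trans (ltW ra) _.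
  by apply: sup_upper_bound; [exact: rays_ub|split].
have upper : \forall y \near x, radial boxcore y <= rho + e.
  have Nb : ~ boxcore ((rho + e / 2) *: x).
    move=> Lb; have : rho + e / 2 <= rho.
      by apply: sup_upper_bound; [exact: rays_ub|split => //; rewrite addr_ge0// divr_ge0// ltW].
    by rewrite gerDl leNgt divr_gt0.
  have : nbhs x [set y : V | forall i, (rho + e / 2) * `|x 0 i| <= (rho + e) * `|y 0 i|].
    apply: (@filter_forall V _ (fun i => [set y : V | (rho + e / 2) * `|x 0 i| <= (rho + e) * `|y 0 i|]) (nbhs x) nF) => i.
    have [->|xi] := eqVneq (x 0 i) 0.
      by apply: nearW => y /=; rewrite normr0 mulr0 mulr_ge0// addr_ge0// ltW.
    have hc := cvg_norm (@coord_continuous R 1 n 0 i x).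
    have re : 0 < rho + e by rewrite ltr_wpDl.
    have := @cvgr_gt _ _ (nbhs x) nF _ _ (hc nF) ((rho + e / 2) * `|x 0 i| / (rho + e)).
    rewrite /= ltr_pdivrMr// mulrC ltr_pM2l ?normr_gt0// ltrD2l ltr_pdivrMr// ltr_pMr// ltr1n.
    by move=> /(_ isT); apply: filterS => y; rewrite ltr_pdivrMr// => /ltW; rewrite [leRHS]mulrC.
  move: near0; apply: filterS2 => y y0 hy.
  have [h1 h2] := rays_ub y0.
  apply: ge_sup => // t [t0 Lt]; rewrite leNgt; apply/negP => tb; apply: Nb.
  apply: boxcore_mono Lt => i; rewrite !mxE !normrM.
  rewrite (ger0_norm t0) ger0_norm; last by rewrite addr_ge0// divr_ge0// ltW.
  by apply: le_trans (hy i) _; rewrite ler_wpM2r// ltW.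
move: lower upper; apply: filterS2 => y h1 h2; rewrite ler_norml; apply/andP; split; lra.
Qed.

Lemma star_body_boxcore : star_body boxcore.
Proof.
split; [exact: bounded_boxcore|exact: star_boxcore| |].
  by apply: open_nbhs_nbhs; split; [exact: open_boxcore|exact: boxcore0].
apply: continuous_in_subspaceT => x; rewrite inE => x0.
exact: radial_boxcore_continuous.
Qed.
End boxcore.

(** * The star body of a minimizer *)

Section existence.
Variables (R : realType) (n : nat).
Local Notation V := 'rV[R]_n.
Local Notation vol := (lebesgueRV R n).
Local Notation T := (leb R n).

Variables (K : set V) (s : R).
Hypotheses (n1 : (1 <= n)%N) (s01 : 0 < s < 1).
Hypotheses (Ku : unconditional K) (Ks : strictly_convex_body K).
Variable M : set V.
Hypothesis Mmin : minimizer s K M.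

(** Translate the minimizer so that its barycentre is the origin, and take the
    union of the boxes almost contained in it. *)
Lemma exists_rearranging_body : exists L : set V, rearranging_body M L.
Proof.
have [m hm] := refl_centre n1 s01 Ku Ks Mmin.
pose N : set V := translate (- m) M.
have NE x : N x <-> M (x + m) by rewrite /N translateE /preimage /= opprK.
have bN : borel_set N by apply: borel_translate; exact: (minimizer_borel Mmin).
have bdN : bounded_set N.
  have [r r0 Mr] := (bounded_setP M).1 (minimizer_bounded Mmin).
  apply/bounded_setP; exists (r + `|m|); first by rewrite ltr_wpDr.
  move=> x /NE/Mr h; rewrite -[x](addrK m); apply: le_lt_trans (ler_normB _ _) _.
  by rewrite ltrD2r.
have N0 : (0 < vol N)%E by rewrite vol_translate; exact: (minimizer_vol_gt0 Mmin).
have refl_null i d :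
    vol [set y | [/\ N y, `|refl i d y 0 i| < `|y 0 i| & ~ N (refl i d y)]] = 0%E.
  have [hY hX] := hm i (m 0 i + d).
  have reflm x : refl i (m 0 i + d) (x + m) = refl i d x + m.
    by apply/rowP => j; rewrite !mxE; case: eqP => // ->; ring.
  have [d0|d0] := leP 0 d.
    have {hX}Y0 : vol (pol_moved (refl i (m 0 i + d) : T -> T) (below i (m 0 i + d)) M) = 0%E.
      by apply: hY; rewrite lerDl.
    rewrite -(vol_refl i d) -(vol_shift (- m)).
    apply: null_subset Y0 => x /=.
    have reflm' : refl i d (x - m) = refl i (m 0 i + d) x - m.
      by rewrite -{2}(subrK m x) reflm addrK.
    rewrite reflK => -[/NE + h Nx]; rewrite reflm' subrK => Mx.
    rewrite /pol_moved /=; apply/and3P; split.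
    - apply/mem_set; move: h; rewrite /below /= !mxE eqxx => h.
      rewrite ltNge; apply/negP => xd; move: h; apply/negP; rewrite -leNgt.
      rewrite [leRHS]ger0_norm; last by lra.
      by rewrite ler_norml; apply/andP; split; lra.
    - by apply/negP => /set_mem xM; apply: Nx; apply/NE; rewrite subrK.
    - exact/mem_set.
  have {hY}X0 : vol (pol_kept (refl i (m 0 i + d) : T -> T) (below i (m 0 i + d)) M) = 0%E.
    by apply: hX; rewrite gerDl ltW.
  rewrite -(vol_shift (- m)); apply: null_subset X0 => x /= [/NE + h Nx].
  have reflm' : refl i d (x - m) = refl i (m 0 i + d) x - m.
    by rewrite -{2}(subrK m x) reflm addrK.
  rewrite subrK => Mx; rewrite reflm' in Nx; rewrite /pol_kept /=; apply/and3P; split.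
  - apply/mem_set; move: h; rewrite /below /= !mxE eqxx => h.
    rewrite ltNge; apply/negP => xd; move: h; apply/negP; rewrite -leNgt.
    rewrite [leRHS]ler0_norm; last by lra.
    by rewrite ler_norml; apply/andP; split; lra.
  - exact/mem_set.
  - by apply/negP => /set_mem xM; apply: Nx; apply/NE; rewrite subrK.
have ae := ae_box_null bN refl_null.
exists (boxcore N); split.
- exact: unconditional_boxcore.
- exact: star_body_boxcore.
- exists m; rewrite /equivalent -(vol_shift m).
  apply: null_subset (null_union (boxcore_sub N) (boxcore_sup bN bdN ae)) => x /=.
  rewrite translateE /preimage /= addrK => -[[Mx Lx]|[Lx Mx]].
  - by right; split => //; exact/NE.
  - by left; split => //; rewrite NE.
Qed.

End existence.

(** * Superlevel sets of a rearrangement *)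

Section symmetrization.
Variables (R : realType) (n : nat).
Local Notation V := 'rV[R]_n.
Local Notation vol := (lebesgueRV R n).
Local Notation T := (leb R n).
Implicit Types (E : set V) (x : V) (r t : R).

Variables (L : set V) (v : R).
Hypotheses (n1 : (1 <= n)%N) (mL : measurable (L : set T)) (L0 : L 0).
Hypotheses (Lstar : star_shaped L) (volL : vol L = v%:E) (v0 : 0 < v).

Lemma dilate0 : dilate 0 L = [set 0].
Proof.
apply/seteqP; split=> [_ [x _ <-]|_ ->]; first by rewrite scale0r.
by exists 0 => //; rewrite scale0r.
Qed.

Lemma vol_dilateL r : 0 <= r -> vol (dilate r L) = (r ^+ n * v)%:E.
Proof.
rewrite le_eqVlt => /orP[/eqP<-|r0].
  by rewrite dilate0 vol_point// expr0n gtn_eqF// mul0r.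
by rewrite vol_dilate ?gt_eqF// volL ger0_norm ?ltW// EFinM.
Qed.

Lemma measurable_dilateL r : 0 <= r -> measurable (dilate r L : set T).
Proof.
rewrite le_eqVlt => /orP[/eqP<-|r0].
  by apply: measurable_null; rewrite dilate0 vol_point.
by apply: measurable_dilate => //; rewrite gt_eqF.
Qed.

Lemma dilate_mono r r' : 0 <= r <= r' -> dilate r L `<=` dilate r' L.
Proof.
move=> /andP[r0 rr'] _ [x Lx <-].
have [r'0|r'0] := eqVneq r' 0.
  have -> : r = 0 by apply/eqP; rewrite eq_le r0 andbT -r'0.
  by rewrite r'0 scale0r; exists 0 => //; rewrite scale0r.
have r'p : 0 < r' by rewrite lt_def r'0 (le_trans r0).
exists ((r / r') *: x); last by rewrite scalerA mulrC divfK.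
by apply: Lstar => //; rewrite divr_ge0 ?(ltW r'p)//= ler_pdivrMr// mul1r.
Qed.

Definition eqradius E := xget 0 [set r | 0 <= r /\ vol (dilate r L) = vol E].

Lemma symmetrizationE E : (vol E < +oo)%E -> symmetrization L E = dilate (eqradius E) L.
Proof. by move=> Eoo; rewrite /symmetrization lt_eqF. Qed.

(** The radius exists because the volume of [dilate r L] is [r ^ n * v]. *)
Lemma eqradiusP E : (vol E < +oo)%E -> 0 <= eqradius E /\ eqradius E ^+ n * v = fine (vol E).
Proof.
move=> Eoo; have Efin : vol E \is a fin_num by rewrite ge0_fin_numE ?vol_ge0.
suff : [set r | 0 <= r /\ vol (dilate r L) = vol E] (eqradius E).
  by move=> [r0]; rewrite vol_dilateL// => <-.
apply: xgetPex; exists ((fine (vol E) / v) `^ (n%:R^-1)); split; first exact: powR_ge0.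
have q0 : 0 <= fine (vol E) / v by rewrite divr_ge0 ?fine_ge0 ?vol_ge0// ltW.
rewrite vol_dilateL ?powR_ge0// -powR_mulrn ?powR_ge0// -powRrM mulVf ?powRr1//.
  by rewrite divfK ?gt_eqF// fineK.
by rewrite pnatr_eq0 -lt0n.
Qed.

Lemma eqradius_ge0 E : (vol E < +oo)%E -> 0 <= eqradius E.
Proof. by case/eqradiusP. Qed.

Lemma eqradius_mono E E' : (vol E' < +oo)%E -> (vol E <= vol E')%E -> eqradius E <= eqradius E'.
Proof.
move=> E'oo EE'; have Eoo := le_lt_trans EE' E'oo.
have [r0 rE] := eqradiusP Eoo; have [r'0 r'E] := eqradiusP E'oo.
rewrite -(@ler_pXn2r _ n)// ?nnegrE// -(ler_pM2r v0) rE r'E.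
by apply: fine_le => //; rewrite ge0_fin_numE ?vol_ge0.
Qed.

Variable u : T -> R.
Hypotheses (mu : measurable_fun setT u) (uoo : forall t, 0 < t -> (vol (suplevel u t) < +oo)%E).

Local Notation rad t := (eqradius (suplevel u t)).

(** The superlevel set at t of the rearrangement of a function with modulus u:
    the union of the dilates of L attached to the levels above t. *)
Definition rearr_level t : set V := [set x | exists2 tau, t < tau & dilate (rad tau) L x].

Lemma rad_mono t t' : 0 < t -> t <= t' -> rad t' <= rad t.
Proof.
move=> t0 tt'; apply: eqradius_mono; first exact: uoo.
by apply: le_vol => x; rewrite /suplevel /=; exact: le_lt_trans.
Qed.

Lemma rearr_levelE t : 0 <= t ->
  rearr_level t = \bigcup_k dilate (rad (t + k.+1%:R^-1)) L.
Proof.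
move=> t0; apply/seteqP; split=> x.
  move=> [tau ttau xtau].
  have : 0 < tau - t by rewrite subr_gt0.
  move=> /ltr_add_invr[k]; rewrite add0r => hk; exists k => //.
  have k0 : 0 < k.+1%:R^-1 :> R by rewrite invr_gt0.
  have h : t + k.+1%:R^-1 <= tau by rewrite -lerBrDl ltW.
  have h0 : 0 < t + k.+1%:R^-1 by rewrite ltr_wpDl.
  apply: dilate_mono xtau; rewrite rad_mono// eqradius_ge0//.
  exact/uoo/(lt_le_trans h0).
move=> [k _ xk]; exists (t + k.+1%:R^-1) => //.
by rewrite ltrDl invr_gt0.
Qed.

Lemma measurable_rearr_level t : 0 <= t -> measurable (rearr_level t : set T).
Proof.
move=> t0; rewrite rearr_levelE//; apply: bigcup_measurable => k _.
apply: measurable_dilateL; apply: eqradius_ge0; apply: uoo.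
by rewrite ltr_wpDl// invr_gt0.
Qed.

(** Both sets are increasing unions over the levels [t + 1 / (k + 1)], and the
    volumes agree at each of these levels. *)
Lemma vol_rearr_level t : 0 <= t -> vol (rearr_level t) = vol (suplevel u t).
Proof.
move=> t0; rewrite rearr_levelE//.
have tk k : 0 < t + k.+1%:R^-1 by rewrite ltr_wpDl// invr_gt0.
have nd k k' : (k <= k')%N -> t + k'.+1%:R^-1 <= t + k.+1%:R^-1.
  by move=> kk'; rewrite lerD2l lef_pV2 ?posrE// ler_nat.
have E : suplevel u t = \bigcup_k suplevel u (t + k.+1%:R^-1).
  apply/seteqP; split=> x; rewrite /suplevel /=.
    rewrite -subr_gt0 => /ltr_add_invr[k]; rewrite add0r => hk; exists k => //=.
    by rewrite -ltrBrDl.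
  by move=> [k _] /=; apply: lt_trans; rewrite ltrDl invr_gt0.
have volk k : vol (dilate (rad (t + k.+1%:R^-1)) L) = vol (suplevel u (t + k.+1%:R^-1)).
  have oo := uoo (tk k); have [r0 rE] := eqradiusP oo.
  by rewrite vol_dilateL// rE fineK// ge0_fin_numE ?vol_ge0.
have mS k : measurable (suplevel u (t + k.+1%:R^-1)) by exact: measurable_suplevel.
have mD k : measurable (dilate (rad (t + k.+1%:R^-1)) L : set T).
  by apply: measurable_dilateL; apply: eqradius_ge0; exact: uoo.
have c1 : vol (dilate (rad (t + k.+1%:R^-1)) L) @[k --> \oo] -->
    vol (\bigcup_k dilate (rad (t + k.+1%:R^-1)) L).
  apply: (@nondecreasing_cvg_mu _ T R vol) => //; first exact: bigcup_measurable.
  move=> k k' kk'; apply/subsetPset; apply: dilate_mono.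
  by rewrite rad_mono ?nd// eqradius_ge0//; exact: uoo.
have c2 : vol (suplevel u (t + k.+1%:R^-1)) @[k --> \oo] --> vol (suplevel u t).
  rewrite E; apply: (@nondecreasing_cvg_mu _ T R vol) => //; first exact: bigcup_measurable.
  move=> k k' kk'; apply/subsetPset => x; rewrite /suplevel /=.
  by apply: le_lt_trans; exact: nd.
move: c1; under eq_fun do rewrite volk.
by move=> c1; exact: (cvg_unique _ c1 c2).
Qed.

Lemma rearr_level_sub t : 0 < t -> rearr_level t `<=` dilate (rad t) L.
Proof.
move=> t0 x [tau ttau xtau]; apply: dilate_mono xtau.
rewrite rad_mono ?(ltW ttau)// eqradius_ge0//; exact/uoo/(lt_trans t0).
Qed.

Lemma rearr_level_null t : 0 < t -> vol (dilate (rad t) L `\` rearr_level t) = 0%E.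
Proof.
move=> t0; have oo := uoo t0; have [r0 rE] := eqradiusP oo.
have mD := measurable_dilateL r0.
have mS := measurable_rearr_level (ltW t0).
have SD := rearr_level_sub t0.
have vS : vol (dilate (rad t) L) = vol (rearr_level t).
  by rewrite (vol_rearr_level (ltW t0)) vol_dilateL// rE fineK// ge0_fin_numE ?vol_ge0.
have fin : vol (rearr_level t) \is a fin_num.
  by rewrite -vS vol_dilateL.
have Doo : (vol (dilate (rad t) L) < +oo)%E by rewrite vol_dilateL// ltry.
rewrite (measureD mD mS Doo) setIidr//.
by transitivity (vol (rearr_level t) - vol (rearr_level t))%E; [congr (_ - _)%E|exact: subee].
Qed.

End symmetrization.

(** * The rearrangement inequality *)

Section rearrangement.
Variables (R : realType) (n : nat).
Local Notation V := 'rV[R]_n.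
Local Notation vol := (lebesgueRV R n).
Local Notation T := (leb R n).

Variables (K : set V) (s : R).
Hypotheses (n1 : (1 <= n)%N) (s01 : 0 < s < 1).
Hypotheses (Ku : unconditional K) (Ks : strictly_convex_body K).
Variable M : set V.
Hypothesis Mmin : minimizer s K M.
Variable L : set V.
Hypothesis ML : rearranging_body M L.

Local Notation vper := (vper K s).
Local Notation k := (kernelK K s).
Local Notation v := (fine (vol M)).
Local Notation p := (fine (vper M)).

Let mM : measurable (M : set T) := minimizer_measurable Mmin.

(** L agrees with a translate of M up to a null set. *)
Let bodyL : [/\ measurable (L : set T), vol L = v%:E & vper L = p%:E].
Proof.
have [_ _ [b]] := ML; rewrite /equivalent => D0; set D := M `+` translate b L in D0.
have mD : measurable (D : set T) by exact: measurable_null.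
have tE : translate b L = (M `\` D) `|` (D `\` M).
  apply/seteqP; split=> x; rewrite /D /=; first by have [] := pselect (M x); tauto.
  by have [] := pselect (M x); have [] := pselect (translate b L x); tauto.
have mt : measurable (translate b L : set T).
  by rewrite tE; apply: measurableU; exact: measurableD.
have LE : translate (- b) (translate b L) = L.
  by apply/seteqP; split=> x; rewrite !translateE /preimage /= opprK addrK.
have mL : measurable (L : set T) by rewrite -LE; exact: measurable_translate.
split => //.
- rewrite -(vol_translate b) -(minimizer_vol Mmin).
  have sub A B : A `<=` B `|` D -> (vol A <= vol B)%E.
    move=> AB; rewrite -[leRHS]adde0 -[in leRHS]D0.
    by apply: le_trans (le_vol AB) _; exact: outer_measureU2.
  apply/eqP; rewrite eq_le !sub// => x; rewrite /D /=.
    by move=> Mx; have [] := pselect (translate b L x); tauto.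
  by move=> tx; have [] := pselect (M x); tauto.
- rewrite -(vper_translate s Ku Ks b mL) -(minimizer_per s01 Ku Ks Mmin).
  apply: (vper_null_eq s Ku Ks mt mM mD D0) => x; rewrite /D /= => h.
  by have [] := pselect (M x); have [] := pselect (translate b L x); tauto.
Qed.

Let mL : measurable (L : set T). Proof. by case: bodyL. Qed.
Let volL : vol L = v%:E. Proof. by case: bodyL. Qed.
Let perL : vper L = p%:E. Proof. by case: bodyL. Qed.
Let v0 : 0 < v.
Proof. by rewrite -lte_fin -(minimizer_vol Mmin); exact: (minimizer_vol_gt0 Mmin). Qed.
Let Lstar : star_shaped L. Proof. by case: ML => _ []. Qed.
Let L0 : L 0. Proof. by case: ML => _ [_ _ + _] _; exact: interior_subset. Qed.

Let vper_null (E : set V) : vol E = 0%E -> vper E = 0%E.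
Proof.
move=> E0; rewrite (vper_null_eq s Ku Ks (measurable_null E0) measurable0 (measurable_null E0) E0)//.
rewrite /vper /per /interaction; apply: integral0_eq => q _.
by rewrite /pairf indic0 !mul0r.
Qed.

(** The dilates of L realise equality in the isoperimetric inequality. For
    [r = 0] the dilate is a point and both sides vanish. *)
Lemma vper_dilate_body r : 0 <= r ->
  vper (dilate r L) = (p * ((r ^+ n * v) / v) `^ ((n%:R - s) / n%:R))%:E.
Proof.
have [s0 s1] := andP s01; have nR : (1 : R) <= n%:R by rewrite ler1n.
have ns : 0 < n%:R - s by rewrite subr_gt0 (lt_le_trans s1).
have nN0 : (n%:R : R) != 0 by rewrite pnatr_eq0 -lt0n.
move=> r0; rewrite mulfK ?gt_eqF//.
rewrite -powR_mulrn// -powRrM mulrCA divff// mulr1.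
move: r0; rewrite le_eqVlt => /orP[/eqP<-|r0]; last first.
  by rewrite vper_dilate// perL muleC.
rewrite vper_null ?powR0 ?gt_eqF ?mulr0//.
by rewrite (dilate0 L0) vol_point.
Qed.

Variable f : V -> R.
Hypothesis fint : vol.-integrable setT (EFin \o f).

Let u : T -> R := fun x => `|f x|.

Let mf : measurable_fun setT (f : T -> R).
Proof. by apply/measurable_EFinP; exact: (measurable_int vol fint). Qed.

Let mu : measurable_fun setT u.
Proof. exact: measurableT_comp. Qed.

Let I := fine (\int[vol]_x (u x)%:E)%E.

Let IE : (\int[vol]_x (u x)%:E)%E = I%:E.
Proof.
have u0 : (0 <= \int[vol]_x (u x)%:E)%E.
  by apply: integral_ge0 => x _; rewrite lee_fin /u.
have fin : (\int[vol]_x (u x)%:E)%E \is a fin_num.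
  by rewrite (ge0_fin_numE u0); have /integrableP[_] := fint.
by rewrite /I fineK.
Qed.

Let markov t : 0 < t -> (vol (suplevel u t) <= (I / t)%:E)%E.
Proof.
move=> t0; have mS : measurable (suplevel u t) by exact: measurable_suplevel.
rewrite mulrC EFinM lee_pdivlMl// -IE.
rewrite -[suplevel u t]setIT -(integral_indic vol measurableT mS).
have mI : measurable_fun setT (fun x => (\1_(suplevel u t) x)%:E : \bar R).
  by apply/measurable_EFinP; exact: measurable_indic.
rewrite -(ge0_integralZl vol measurableT mI _ (_ : (0 <= t%:E)%E)); last 2 first.
- by move=> x _; rewrite lee_fin.
- by rewrite lee_fin ltW.
apply: ge0_le_integral; [by []|by move=> x _; rewrite mule_ge0 ?lee_fin// ltW| | |].
- by apply: measurable_funeM; exact: mI.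
- by apply/measurable_EFinP; exact: mu.
move=> x _; rewrite -EFinM lee_fin indicE; case: (boolP (x \in _)) => [/set_mem|_].
  by rewrite /suplevel /= mulr1 => /ltW.
by rewrite mulr0 /u.
Qed.

Let uoo t : 0 < t -> (vol (suplevel u t) < +oo)%E.
Proof. by move=> t0; apply: le_lt_trans (markov t0) _; rewrite ltry. Qed.

Let h : T -> \bar R := rearrangement L f.

Let h_ge0 x : (0 <= h x)%E.
Proof. by apply: ereal_sup_ubound; left. Qed.

Let h_level t : 0 <= t -> [set x | (t%:E < h x)%E] = rearr_level L u t.
Proof.
move=> t0; apply/seteqP; split=> x; rewrite /h /rearrangement /=.
  move=> /ereal_sup_gt[_ [->|[tau [tau0 xtau] <-]] tx].
    by move: tx; rewrite lte_fin ltNge t0.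
  exists tau; first by rewrite -lte_fin.
  by rewrite -symmetrizationE//; exact: uoo.
move=> [tau ttau xtau]; have tau0 : 0 < tau by exact: le_lt_trans ttau.
apply: (@lt_le_trans _ _ tau%:E); first by rewrite lte_fin.
apply: ereal_sup_ubound; right; exists tau => //; split => //.
by rewrite symmetrizationE//; exact: uoo.
Qed.

Let mlevel t : 0 <= t -> measurable (rearr_level L u t : set T).
Proof. by move=> t0; exact: (measurable_rearr_level n1 mL L0 Lstar volL v0 uoo t0). Qed.

Let mh : measurable_fun setT h.
Proof.
apply: (measurability _ (ErealGenOInfty.measurableE R)) => /= _ [_ [t ->]] <-.
rewrite setTI preimage_itvoy.
have [t0|t0] := leP 0 t; first by rewrite h_level//; exact: mlevel.
rewrite (_ : [set _ | _] = setT)//; apply/seteqP; split => // x _ /=.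
by apply: lt_le_trans (h_ge0 x); rewrite lte_fin.
Qed.

(** The rearrangement is infinite at the origin, so [g] below is its real-valued
    version; the two differ on the null set [Z] only. *)
Let Z : set T := [set x | h x = +oo%E].

Let mZ : measurable Z.
Proof.
have := mh measurableT (emeasurable_set1 (+oo%E : \bar R)); rewrite setTI; exact.
Qed.

Let Z0 : vol Z = 0%E.
Proof.
apply/eqP; rewrite eq_le vol_ge0 andbT; apply/lee_addgt0Pr => e e0; rewrite add0e.
have I0 : 0 <= I by rewrite /I fine_ge0// integral_ge0// => x _; rewrite lee_fin /u.
have t0 : 0 < (I + 1) / e by rewrite divr_gt0// ltr_wpDl.
have ZS : Z `<=` rearr_level L u ((I + 1) / e).
  by rewrite -(h_level (ltW t0)) => x; rewrite /Z /= => ->; rewrite ltry.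
apply: le_trans (le_vol ZS) _.
rewrite (vol_rearr_level n1 mL L0 Lstar volL v0 mu uoo (ltW t0)).
apply: le_trans (markov t0) _; rewrite lee_fin ler_pdivrMr// mulrC divfK ?gt_eqF//.
by rewrite lerDl.
Qed.

Let g : T -> R := fun x => fine (h x).

Let mg : measurable_fun setT g.
Proof. exact: (measurableT_comp (fine_measurable measurableT) mh). Qed.

Let gE x : ~ Z x -> h x = (g x)%:E.
Proof.
move=> Zx; rewrite /g fineK// ge0_fin_numE ?h_ge0//.
by rewrite ltey; apply/eqP.
Qed.

Let g_level t : 0 < t -> vper (suplevel g t) = vper (dilate (eqradius L (suplevel u t)) L).
Proof.
move=> t0; have oo := uoo t0; have r0 := eqradius_ge0 n1 L0 volL v0 oo.
have mS := measurable_suplevel mg t.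
have mSl := mlevel (ltW t0).
have mD := measurable_dilateL n1 mL L0 r0.
have Sl0 := rearr_level_null n1 mL L0 Lstar volL v0 mu uoo t0.
have SD := rearr_level_sub n1 L0 Lstar volL v0 uoo t0.
rewrite (vper_null_eq s Ku Ks mS mSl mZ Z0); last first.
  by move=> x Zx; rewrite -(h_level (ltW t0)) /suplevel /= gE// lte_fin.
apply: (vper_null_eq s Ku Ks mSl mD (measurableD mD mSl) Sl0) => x hx.
by split=> [/SD//|Dx]; apply: contrapT => Sx; apply: hx.
Qed.

(** For t < 0 both superlevel sets are the whole space; for t > 0 this is the
    isoperimetric inequality. *)
Let level_le t : t != 0 -> (vper (suplevel g t) <= vper (suplevel u t))%E.
Proof.
rewrite neq_lt => /orP[t0|t0].
  suff E (w : T -> R) : (forall x, 0 <= w x) -> suplevel w t = setT.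
    by rewrite !E// => x; [rewrite /u|rewrite /g fine_ge0].
  by move=> w0; apply/seteqP; split=> // x _; exact: lt_le_trans (w0 x).
have oo := uoo t0; have [r0 rE] := eqradiusP n1 L0 volL v0 oo.
rewrite g_level// vper_dilate_body// rE.
apply: (isoperimetric n1 s01 Ku Ks Mmin _ oo); exact: measurable_suplevel.
Qed.

Let mk := kernelK_measurable s Ku Ks.
Let k0 := @kernelK_ge0 R n K s.
Let kC := kernelKC s Ku Ks.

Let layer_cake_le :
  (\int[vol \x vol]_q (`|g q.1 - g q.2| * k q.1 q.2)%:E <=
   \int[vol \x vol]_q (`|u q.1 - u q.2| * k q.1 q.2)%:E)%E.
Proof.
have cg := @coarea _ T R vol k mk k0 kC g mg.
have cu := @coarea _ T R vol k mk k0 kC u mu.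
rewrite [leLHS]cg [leRHS]cu; apply: lee_wpmul2l; first by rewrite lee_fin ler0n.
apply: ae_ge0_le_integral.
- exact: measurableT.
- by move=> t _; exact: vper_ge0.
- exact: (measurable_per_suplevel vol mk k0 mg).
- by move=> t _; exact: vper_ge0.
- exact: (measurable_per_suplevel vol mk k0 mu).
- exists [set 0]; split; [exact: measurable_set1|exact: lebesgue_measure_set1|].
  move=> t /= ht; apply: contrapT => t0; apply: ht => _; apply: level_le.
  exact/eqP.
Qed.

Let seminorm_f :
  fractional_seminorm s K (EFin \o f) = (\int[vol \x vol]_q (`|f q.1 - f q.2| * k q.1 q.2)%:E)%E.
Proof.
have mF := measurable_difference_weight mk mf.
rewrite (fubini_tonelli1 _ mF)//.
by move=> q; rewrite lee_fin mulr_ge0.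
Qed.

Let seminorm_h :
  fractional_seminorm s K h = (\int[vol \x vol]_q (`|g q.1 - g q.2| * k q.1 q.2)%:E)%E.
Proof.
have mh1 : measurable_fun setT (fun q : T * T => h q.1) by exact: measurableT_comp mh measurable_fst.
have mh2 : measurable_fun setT (fun q : T * T => h q.2) by exact: measurableT_comp mh measurable_snd.
have mG := measurable_difference_weight mk mg.
pose H (q : T * T) : \bar R := (`|h q.1 - h q.2| * (k q.1 q.2)%:E)%E.
have mH : measurable_fun setT H.
  apply: emeasurable_funM; last by apply/measurable_EFinP; exact: mk.
  exact: (measurableT_comp (@abse_measurable R setT) (emeasurable_funB mh1 mh2)).
have H0 q : (0 <= H q)%E by rewrite /H mule_ge0// lee_fin.
have G0 (q : T * T) : (0 <= (`|g q.1 - g q.2| * k q.1 q.2)%:E)%E by rewrite lee_fin mulr_ge0.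
rewrite -(integral_null_eq mZ Z0 mH mG H0 G0).
  by rewrite (fubini_tonelli1 _ mH H0).
by move=> x y Zx Zy; rewrite /H /= !gE.
Qed.

(** Replace f by its modulus and compare the two coarea formulas. *)
Lemma fractional_seminorm_rearrangement :
  (fractional_seminorm s K (rearrangement L f) <= fractional_seminorm s K (EFin \o f))%E.
Proof.
rewrite seminorm_h seminorm_f; apply: le_trans layer_cake_le _.
apply: ge0_le_integral.
- exact: measurableT.
- by move=> q _; rewrite lee_fin mulr_ge0.
- exact: (measurable_difference_weight mk mu).
- exact: (measurable_difference_weight mk mf).
- by move=> q _; rewrite lee_fin ler_wpM2r// ler_dist_dist.
Qed.

End rearrangement.

Theorem theorem1p2 (R : realType) (n : nat) (s : R) (K M : set 'rV[R]_n) :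
  (1 <= n)%N -> 0 < s < 1 ->
  unconditional K -> strictly_convex_body K ->
  minimizer s K M ->
  (exists L : set 'rV[R]_n, rearranging_body M L) /\
  (forall L : set 'rV[R]_n, rearranging_body M L ->
   forall f : 'rV[R]_n -> R,
     (lebesgueRV R n).-integrable setT (EFin \o f) ->
     (fractional_seminorm s K (EFin \o f) >=
      fractional_seminorm s K (rearrangement L f))%E).
Proof.
move=> n1 s01 Ku Ks Mmin; split; first exact: (exists_rearranging_body n1 s01 Ku Ks Mmin).
by move=> L ML f fint; exact: (fractional_seminorm_rearrangement n1 s01 Ku Ks Mmin ML fint).
Qed.
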